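(* Let $Q$ be a quiver whose underlying undirected graph is a Dynkin diagram of type $A_n$ ($n\ge 1$), $D_n$ ($n\geq 4$), $E_6$ or $E_7$. Then $$\bigcup_{\pi\in P_Q}\{\alpha_\pi(\gamma)\mid \gamma\in\Gamma_{\pi,nd}\}=\{\text{real Schur roots of }Q\}.$$ Moreover, if $Q$ is of type $A_n$, then $$\bigcup_{\pi\in P_Q}\{\alpha_\pi(\gamma)\mid \gamma\in\Gamma_{\pi,s}\}=\{\text{real Schur roots of }Q\}.$$
   Context: Roots. A quiver $Q$ is a finite directed graph without loops or oriented 2-cycles, with vertex set $[n]=\{1,\dots,n\}$. Its exchange matrix is $B=(b_{ij})$, $b_{ij}=\#\{\text{arrows } i\to j\}-\#\{\text{arrows } j\to i\}$. Let $\Delta_Q$ be the root system of the Kac–Moody algebra with generalized Cartan matrix $(a_{ij})$, $a_{ii}=2$, $a_{ij}=-|b_{ij}|$ for $i\ne j$; let $\alpha_1,\dots,\alpha_n$ be the simple roots, $\Delta_Q^+$ the positive roots, and $s_i(\alpha_j)=\alpha_j-a_{ij}\alpha_i$ the simple reflections. For integer combinations, $\sum\beta_i\alpha_i\le_D\sum\beta_i'\alpha_i$ means $\beta_i\le\beta_i'$ for all $i$, and $<_D$ means $\le_D$ with $\beta_i<\beta'_i$ for some $i$. Let $P_Q$ be the set of permutations $\pi\in S_n$ such that if $a>b$ then there is no arrow $\pi(a)\to\pi(b)$ in $Q$. A real Schur root of $Q$ is the dimension vector $(d_i)$, viewed as $\sum d_i\alpha_i$, of an indecomposable exceptional module (no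 self-extensions) over the path algebra $kQ$, $k$ algebraically closed. (For Dynkin types $A$, $D$, $E$ the real Schur roots are exactly the elements of $\Delta_Q^+$.) Curves. Let $H=\mathbb R\times\mathbb R_{\ge0}$, $b=(0,0)$, and for $i\in[n]$ let $p_i=(i,1)$ and $\rho_i=\{(i,y)\mid y\ge1\}$; let $P=\{p_1,\dots,p_n\}$. An admissible curve is a smooth map $\gamma:[0,1]\to H$ such that (a) $\gamma(0)\in P$, $\gamma(1)=b$; (b) $\gamma(x)\in P\cup\{b\}$ implies $x\in\{0,1\}$; (c) whenever $\gamma((0,1])$ meets a ray $\rho_i$, it does so transversely (there being finitely many crossings). It is non-self-crossing if it is injective. If $\gamma(0)=p_{k_0}$ and, as $x$ increases, $\gamma(x)$ crosses successively $\rho_{k_1},\dots,\rho_{k_m}$ ($m\ge0$), then for $\pi\in S_n$ put $a=\pi(k_0)$, $j_i=\pi(k_i)$. The associated root $\alpha_\pi(\gamma)$ is whichever of $\pm s_{j_m}\cdots s_{j_1}\alpha_a$ is positive. A non-self-crossing admissible curve $\gamma$ is non-decreasing (resp. strictly increasing) with respect to $\pi$ if for all $i\in[m]$, $s_{j_i}\cdots s_{j_1}\alpha_a\ge_D s_{j_{i-1}}\cdots s_{j_1}\alpha_a$ (resp. $>_D$), where for $i=1$ the right side is $\alpha_a$. $\Gamma_{\pi,nd}$ and $\Gamma_{\pi,s}$ denote the sets of non-self-crossing admissible curves that are non-decreasing, respectively strictly increasing, with respect to $\pi$. *)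

(* Defs.v *)
From mathcomp Require Import all_boot all_order all_algebra all_fingroup.
From mathcomp Require Import all_classical all_reals all_analysis.

Set Implicit Arguments.
Unset Strict Implicit.
Unset Printing Implicit Defensive.

Import Order.TTheory GRing.Theory Num.Theory.
Import numFieldNormedType.Exports.

Local Open Scope classical_set_scope.
Local Open Scope ring_scope.

(* The vertices 1, ..., n are represented by 'I_n, so i : 'I_n stands for the
   vertex i.+1; this shift is visible in marked_point and ray below. *)

Record quiver (n : nat) := Quiver {
  arrow : finType;
  src : arrow -> 'I_n;
  tgt : arrow -> 'I_n;
  no_loop : forall a, src a != tgt a;
  no_2cycle : forall a b, ~~ ((src a == tgt b) && (tgt a == src b))
}.

Definition arrows_between n (Q : quiver n) (i j : 'I_n) : nat :=
  #|[pred a : arrow Q | (src a == i) && (tgt a == j)]|.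

Definition exchange_mx n (Q : quiver n) : 'M[int]_n :=
  \matrix_(i, j) ((arrows_between Q i j)%:Z - (arrows_between Q j i)%:Z).

Definition cartan_mx n (Q : quiver n) : 'M[int]_n :=
  \matrix_(i, j) (if i == j then 2 else - `|exchange_mx Q i j|).

(* The underlying undirected graph of Q is, up to relabelling the vertices, the
   simple graph on {0, ..., n-1} whose edges are the {i, j} with e i j or
   e j i. *)
Definition has_diagram n (Q : quiver n) (e : rel nat) : Prop :=
  exists s : 'S_n, forall i j : 'I_n,
    (arrows_between Q (s i) (s j) + arrows_between Q (s j) (s i))%N
      = (e i j || e j i) :> nat.

Definition path_edge : rel nat := fun i j => i.+1 == j.

(* The path 0 - 1 - ... - (n-2), with the vertex n-1 attached to c. *)
Definition branch_edge (n c : nat) : rel nat := fun i j =>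
  ((i.+1 == j) && (j < n.-1)%N) || ((i == c) && (j == n.-1)).

Definition type_A n (Q : quiver n) : Prop :=
  (1 <= n)%N /\ has_diagram Q path_edge.
Definition type_D n (Q : quiver n) : Prop :=
  (4 <= n)%N /\ has_diagram Q (branch_edge n (n - 3)).
Definition type_E6 n (Q : quiver n) : Prop :=
  n = 6%N /\ has_diagram Q (branch_edge 6 2).
Definition type_E7 n (Q : quiver n) : Prop :=
  n = 7%N /\ has_diagram Q (branch_edge 7 2).

(* Integer combinations of simple roots are row vectors of coordinates. *)
Definition simple_root n (i : 'I_n) : 'rV[int]_n := delta_mx 0 i.

(* The linear extension of alpha_j |-> alpha_j - a_ij alpha_i. *)
Definition simple_reflection n (Q : quiver n) (i : 'I_n) (v : 'rV[int]_n) :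
    'rV[int]_n :=
  \sum_j v 0 j *: (simple_root j - cartan_mx Q i j *: simple_root i).

Definition leD n (u v : 'rV[int]_n) : Prop := forall i, u 0 i <= v 0 i.
Definition ltD n (u v : 'rV[int]_n) : Prop :=
  leD u v /\ exists i, u 0 i < v 0 i.

Definition P_ n (Q : quiver n) : set 'S_n :=
  [set s | forall a b : 'I_n, (b < a)%N ->
     ~ exists x : arrow Q, src x = s a /\ tgt x = s b].

(* Finite-dimensional kQ-modules are matrix representations of Q; matrices act
   on row vectors from the right, so an arrow i -> j gives k^(d i) -> k^(d j). *)

Record qrep (k : fieldType) n (Q : quiver n) := QRep {
  qdim : 'I_n -> nat;
  qmap : forall a : arrow Q, 'M[k]_(qdim (src a), qdim (tgt a))
}.

Section Representations.
Variables (k : fieldType) (n : nat) (Q : quiver n).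
Implicit Types M N : qrep k Q.

Definition qfamily M N := forall i : 'I_n, 'M[k]_(qdim M i, qdim N i).

Definition qhom M N (f : qfamily M N) : Prop :=
  forall a : arrow Q, qmap M a *m f (tgt a) = f (src a) *m qmap N a.

Definition qiso M N : Prop :=
  exists (f : qfamily M N) (g : qfamily N M),
    [/\ qhom f, qhom g, forall i, f i *m g i = 1%:M
      & forall i, g i *m f i = 1%:M].

Definition qzero M : Prop := forall i, qdim M i = 0%N.

Definition qsum M N : qrep k Q :=
  @QRep k n Q (fun i => qdim M i + qdim N i)%N
    (fun a => block_mx (qmap M a) 0 0 (qmap N a)).

Definition indecomposable M : Prop :=
  ~ qzero M /\ forall N1 N2, qiso M (qsum N1 N2) -> qzero N1 \/ qzero N2.

Definition short_exact M E N (f : qfamily M E) (g : qfamily E N) : Prop :=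
  [/\ qhom f, qhom g &
     forall i, [/\ row_free (f i), (f i :=: kermx (g i))%MS
                 & row_full (g i)]].

(* Ext^1(M, M) = 0: every short exact sequence 0 -> M -> E -> M -> 0 splits. *)
Definition exceptional M : Prop :=
  forall E (f : qfamily M E) (g : qfamily E M), short_exact f g ->
    exists s : qfamily M E, qhom s /\ forall i, s i *m g i = 1%:M.

Definition dim_vector M : 'rV[int]_n := \row_i (qdim M i)%:Z.

End Representations.

Definition real_Schur_roots (k : closedFieldType) n (Q : quiver n) :
    set 'rV[int]_n :=
  [set v | exists M : qrep k Q,
     [/\ indecomposable M, exceptional M & v = dim_vector M]].

(* A curve is a total map gamma : R -> R * R of which only the restriction to
   [0, 1] is relevant. *)

Section Curves.
Variable R : realType.
Implicit Types (gamma : R -> R * R) (f g : R -> R) (t u : R).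

(* Smooth on [0, 1], i.e. the restriction of a C^oo function on the line. *)
Definition smooth01 f : Prop :=
  exists g, (forall m t, derivable (derive1n m g) t 1) /\
            (forall t, 0 <= t <= 1 -> f t = g t).

Definition base_point : R * R := (0, 0).
Definition marked_point n (i : 'I_n) : R * R := (i.+1%:R, 1).
Definition ray n (i : 'I_n) : set (R * R) :=
  [set z | z.1 = i.+1%:R /\ 1 <= z.2].

Definition crossing_times n gamma : set R :=
  [set t | 0 < t <= 1 /\ exists i : 'I_n, ray i (gamma t)].

Record admissible n gamma : Prop := Admissible {
  adm_smooth : smooth01 (fun t => (gamma t).1) /\
               smooth01 (fun t => (gamma t).2);
  adm_half_plane : forall t, 0 <= t <= 1 -> 0 <= (gamma t).2;
  adm_start : exists i : 'I_n, gamma 0 = marked_point i;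
  adm_end : gamma 1 = base_point;
  adm_avoid : forall t, 0 <= t <= 1 ->
    (exists i : 'I_n, gamma t = marked_point i) \/ gamma t = base_point ->
    t = 0 \/ t = 1;
  (* Rays are vertical, so transversality says that the velocity has a nonzero
     horizontal component.  By adm_end, a crossing time is never 1, so this
     two-sided derivative depends only on gamma on [0, 1]. *)
  adm_transverse : forall t, crossing_times n gamma t ->
    derive1 (fun u => (gamma u).1) t != 0;
  (* Not implied by the above: crossings could accumulate at time 0. *)
  adm_finite : finite_set (crossing_times n gamma)
}.

Definition non_self_crossing gamma : Prop :=
  forall t u, 0 <= t <= 1 -> 0 <= u <= 1 -> gamma t = gamma u -> t = u.

(* gamma starts at p_{k0} and then crosses successively the rays indexed by ks;
   ts lists the crossing times. *)
Definition itinerary n gamma (k0 : 'I_n) (ks : seq 'I_n) : Prop :=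
  gamma 0 = marked_point k0 /\
  exists ts : seq R,
    [/\ sorted <%R ts, forall t, t \in ts <-> crossing_times n gamma t,
        size ts = size ks
      & forall i, (i < size ks)%N ->
          ray (nth k0 ks i) (gamma (nth 0 ts i))].

Section Monotonicity.
Variables (n : nat) (Q : quiver n) (s : 'S_n).

(* This is s_{j_i} ... s_{j_1} alpha_a with a = s k0 and j_l = s k_l *)
Definition reflected_root (k0 : 'I_n) (ks : seq 'I_n) (i : nat) : 'rV[int]_n :=
  foldl (fun v k => simple_reflection Q (s k) v) (simple_root (s k0))
    (take i ks).

(* v is a Weyl group image of a simple root, hence a root, so exactly one of v
   and - v is positive, i.e. nonzero with nonnegative coordinates. *)
Definition is_associated_root gamma (beta : 'rV[int]_n) : Prop :=
  exists k0 ks, itinerary gamma k0 ks /\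
    let v := reflected_root k0 ks (size ks) in
    (beta = v \/ beta = - v) /\ ltD 0 beta.

Definition monotone_along (r : 'rV[int]_n -> 'rV[int]_n -> Prop) gamma : Prop :=
  exists k0 ks, itinerary gamma k0 ks /\
    forall i, (i < size ks)%N ->
      r (reflected_root k0 ks i) (reflected_root k0 ks i.+1).

Definition Gamma_nd : set (R -> R * R) :=
  [set gamma | [/\ admissible n gamma, non_self_crossing gamma
                 & monotone_along (@leD n) gamma]].

Definition Gamma_s : set (R -> R * R) :=
  [set gamma | [/\ admissible n gamma, non_self_crossing gamma
                 & monotone_along (@ltD n) gamma]].

Definition associated_roots (G : set (R -> R * R)) : set 'rV[int]_n :=
  [set beta | exists2 gamma, G gamma & is_associated_root gamma beta].

End Monotonicity.
End Curves.

(* Main.v *)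
(* Both unions are the set of nonnegative integer vectors v with q(v) = 1, where q is the Tits form,
   which is positive definite for a Dynkin diagram; these vectors are the positive roots.

   Reflections preserve q, so curves only yield positive roots.  Conversely, let v be a positive root
   that is not simple.  Some vertex i has v_i > 0 and pairing 1 with v, and v - alpha_i is a positive
   root.  If v_i = 1, then i is adjacent to exactly one vertex in the support of v - alpha_i; so if
   the vertices of this support label consecutive marked points, i can be put next to them, on the
   side given by the direction of its arrow, and a curve for v - alpha_i that winds around these
   points is extended across the new ray.  In type A every root arises in this way, by strictly
   increasing curves.  For the remaining roots the curve also has to sweep across a whole block of
   consecutive rays.  In type D one such sweep suffices for the induction; in types E6 and E7 a
   finite search provides the sweeps, except for 48 pairs of a root of E7 and an orientation, for
   which explicit polygons are given.  Polygons become smooth curves when they are traversed with a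
   speed that vanishes to infinite order at their vertices.

   For an indecomposable representation M, positive definiteness of q forces every nonzero
   endomorphism to be invertible: a nonzero endomorphism of minimal rank and of square zero would
   produce a smaller indecomposable representation with self-extensions.  Hence End(M) = k, and
   q(dim M) = dim End(M) - dim Ext(M, M) is positive only if Ext(M, M) = 0 and q(dim M) = 1.
   Conversely, if q(v) = 1, choose M of dimension v with dim End(M) minimal.  A nonsplit extension
   between two complementary summands of M would have a smaller endomorphism algebra, so
   Ext(M, M) = 0, dim End(M) = 1, and M is indecomposable. *)

From HB Require Import structures.
Require Import Defs.
From mathcomp Require Import all_boot all_order all_algebra all_fingroup.
From mathcomp Require Import all_classical all_reals all_analysis.
From mathcomp Require Import ring lra zify.

Set Implicit Arguments.
Unset Strict Implicit.
Unset Printing Implicit Defensive.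

Import Order.TTheory GRing.Theory Num.Theory.
Import numFieldNormedType.Exports.

Local Open Scope classical_set_scope.
Local Open Scope ring_scope.

(** * Smooth curves along polygons *)

(** The order of the marked points and the curve constrain each other: a sequence of reflections
    that climbs to a given root has to be drawn without self-crossing around points whose order is
    restricted by the arrows. Both are therefore built together. A list of vertices grows only at
    its two ends, and the drawing stays in a box whose loose end is free at the bottom, so that
    every move can be drawn whatever was drawn before. On a tree, a vertex with a single neighbour
    in the list fits at one of the two ends for every orientation. In these moves the ray of an
    inner vertex is crossed only together with the whole block, and a sweep must not lower any
    coefficient on its way; this is the obstacle when coefficients exceed 1. The explicit polygons
    lie outside this scheme and cannot be continued to larger roots. For representations no geometry
    of orbits is used. The role of semicontinuity is played by a comparison of dimensions: the
    endomorphisms of a deformed representation are split into graded pieces, which are endomorphisms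
    of the original one. *)

Section SmoothFunctions.
Variable R : realType.
Implicit Types (f g : R -> R) (t x : R).

(** [Cn m] asks for m + 1 derivatives, on the whole line. *)
Fixpoint Cn (m : nat) f : Prop :=
  (forall t, derivable f t 1) /\ if m is m'.+1 then Cn m' (derive1 f) else True.

Definition Csmooth f := forall m, Cn m f.

Lemma CnW m f : Cn m.+1 f -> Cn m f.
Proof. by elim: m f => [|m IH] f /= [df]; [case | case=> ? ?; split=> //; apply: IH]. Qed.

Lemma Csmooth_derive1n f : Csmooth f -> forall m t, derivable (derive1n m f) t 1.
Proof.
move=> sf m; move: f {sf}(sf m); elim: m => [|m IH] f /= [df h] t //.
by have := IH _ h t; rewrite /derive1n -iterSr.
Qed.

Lemma Cn_ext m f g : f =1 g -> Cn m f -> Cn m g.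
Proof. by move=> /funext ->. Qed.

Lemma Cn_cst m (c : R) : Cn m (fun=> c).
Proof.
elim: m c => [|m IH] c /=; split=> //.
suff -> : derive1 (fun=> c) = (fun=> 0) by apply: IH.
by apply/funext=> t; rewrite derive1_cst.
Qed.

Lemma CnD m f g : Cn m f -> Cn m g -> Cn m (fun t => f t + g t).
Proof.
have D f1 g1 : (forall t, derivable f1 t 1) -> (forall t, derivable g1 t 1) ->
    forall t, derivable (fun t => f1 t + g1 t) t 1.
  by move=> d1 d2 t; apply: (derivableD (d1 t) (d2 t)).
elim: m f g => [|m IH] f g /= [df hf] [dg hg]; (split; first exact: D) => //.
suff -> : derive1 (fun t => f t + g t) = fun t => derive1 f t + derive1 g t by apply: IH.
by apply/funext=> t; rewrite !derive1E deriveD.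
Qed.

Lemma CnM m f g : Cn m f -> Cn m g -> Cn m (fun t => f t * g t).
Proof.
elim: m f g => [|m IH] f g hf hg.
  by case: hf hg => [df _] [dg _]; split; [move=> t; exact: (@derivableM _ _ f g t 1 (df t) (dg t)) |].
move: (hf) (hg) => /= [df hf'] [dg hg']; split=> [t|].
  exact: (@derivableM _ _ f g t 1 (df t) (dg t)).
suff -> : derive1 (fun t => f t * g t) = fun t => f t * derive1 g t + g t * derive1 f t.
  by apply: CnD; apply: IH => //; apply: CnW.
by apply/funext=> t; rewrite !derive1E deriveM.
Qed.

Lemma CnV m f : (forall t, f t != 0) -> Cn m f -> Cn m (fun t => (f t)^-1).
Proof.
move=> f0; elim: m => [|m IH] hf.
  by case: hf => df _; split; [move=> t; exact: (derivableV (f0 t) (df t)) |].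
move: (hf) => /= [df hf']; split=> [t|]; first exact: (derivableV (f0 t) (df t)).
suff -> : derive1 (fun t => (f t)^-1) = fun t => (-1) * ((f t)^-1 * (f t)^-1 * derive1 f t).
  apply: CnM; first exact: Cn_cst.
  by apply: CnM => //; apply: CnM; apply: IH; apply: CnW.
apply/funext=> t; rewrite !derive1E deriveV//.
by rewrite scaleNr -[_ *: _]/(_ * _) mulN1r expr2 invfM.
Qed.

Lemma is_derive_affine f (a b t d : R) : is_derive (a * t + b) 1 f d ->
  is_derive t 1 (fun x => f (a * x + b)) (a * d).
Proof.
move=> hf; have ha : is_derive t 1 (fun x => a * x + b) a.
  have := @is_deriveD _ _ _ (fun x => a * x) (cst b) t 1 a 0 _ _.
  rewrite addr0; apply.
  have := @is_deriveM _ _ (cst a) id t 1 0 1 _ _.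
  by rewrite /= scaler0 addr0 /GRing.scale /= mulr1; apply.
by rewrite mulrC; exact: (@is_derive1_comp _ f (fun x => a * x + b)).
Qed.

Lemma Cn_affine m f (a b : R) : Cn m f -> Cn m (fun t => f (a * t + b)).
Proof.
have D g t : derivable g (a * t + b) 1 -> derivable (fun t => g (a * t + b)) t 1.
  by move=> /derivableP /is_derive_affine [].
elim: m f => [|m IH] f /= [df hf]; (split; first by move=> t; apply: D).
  by [].
suff -> : derive1 (fun t => f (a * t + b)) = fun t => a * derive1 f (a * t + b).
  by apply: CnM; [exact: Cn_cst | exact: IH].
apply/funext=> t; rewrite !derive1E.
by have /derivableP /is_derive_affine [? ->] := df (a * t + b).
Qed.

(** The factors [x ^- k] make the family stable: the derivative of a member is a combination of two
    others, so smoothness follows by induction on the order. *)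
Definition flat (k : nat) x : R := if 0 < x then x ^- k * expR (- x^-1) else 0.

Lemma flat_ge0 k x : 0 <= flat k x.
Proof.
by rewrite /flat; case: ltP => // x0; rewrite mulr_ge0 ?expR_ge0 ?invr_ge0 ?exprn_ge0 // ltW.
Qed.

Lemma flat_gt0 k x : 0 < x -> 0 < flat k x.
Proof. by move=> x0; rewrite /flat x0 mulr_gt0 ?expR_gt0 ?invr_gt0 ?exprn_gt0. Qed.

Lemma flat_le0 k x : x <= 0 -> flat k x = 0.
Proof. by rewrite /flat leNgt => /negbTE ->. Qed.

(** The term of degree k + 2 in the series of [expR x^-1] beats [x ^- k] by two powers of x; hence
    the difference quotient at 0 tends to 0. *)
Lemma flat_bound k x : 0 <= x -> flat k x <= (k.+2)`!%:R * x * x.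
Proof.
rewrite le_eqVlt => /predU1P[<-|x0]; first by rewrite flat_le0// mulr0.
have h := @expR_ge1Dxn R x^-1 k.+1.
have {}h : (x ^- k.+2) / (k.+2)`!%:R <= expR x^-1.
  by have := h _; rewrite invr_ge0 ltW// exprVn => /(_ isT); lra.
have F : (0 : R) < (k.+2)`!%:R by rewrite ltr0n fact_gt0.
rewrite /flat x0 expRN ler_pdivrMr ?expR_gt0//.
have X : 0 < x ^+ k by rewrite exprn_gt0.
have {}h : 1 <= x ^+ k.+2 * (k.+2)`!%:R * expR x^-1.
  have P : 0 <= x ^+ k.+2 * (k.+2)`!%:R by rewrite mulr_ge0 ?exprn_ge0 ?ltW.
  apply: le_trans (ler_wpM2l P h); rewrite le_eqVlt; apply/orP; left; apply/eqP.
  by field; rewrite !gt_eqF// exprn_gt0.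
rewrite -[X in X <= _]mulr1 ler_pdivrMl//.
apply: le_trans h _; rewrite !exprS le_eqVlt; apply/orP; left; apply/eqP; ring.
Qed.

Lemma is_derive_flat k x :
  is_derive x 1 (flat k) (- k%:R * flat k.+1 x + flat k.+2 x).
Proof.
have [x0|x0|->] := ltgtP x 0.
- rewrite !flat_le0 ?ltW// mulr0 addr0.
  apply: (near_eq_is_derive (f := cst 0)).
  near=> y; rewrite flat_le0//.
  by near: y; have := @lt_nbhsl R x 0 x0; apply: filterS => y /ltW.
- have H : is_derive x 1 (fun y : R => (y ^- k) * expR (- y^-1))
     (- k%:R * flat k.+1 x + flat k.+2 x).
    have x1 : x != 0 by rewrite gt_eqF.
    have e1 : is_derive x 1 (fun y : R => - y^-1) (x ^- 2).
      have h := @is_deriveV _ id x 1 1 x1 (is_derive_id _ _).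
      have {h} := @is_deriveN _ _ _ _ x 1 _ h.
      by rewrite scaleNr opprK -[_ *: _]/(_ * _) mulr1.
    have e2 := @is_derive1_comp _ _ (fun y : R => - y^-1) _ _ _ (is_derive_expR (- x^-1)) e1.
    have e3 : is_derive x 1 (fun y : R => (y ^- k)) (- (x ^- k.*2 * (k%:R * x ^+ k.-1))).
      have h : is_derive x 1 (fun y : R => y ^+ k) (k%:R * x ^+ k.-1).
        case: k {e2} => [|k'] /=; first by rewrite mul0r; apply: is_derive_cst.
        have := @is_deriveX _ _ id k'.+1 x 1 1 (is_derive_id _ _).
        rewrite -[_ *: _]/(_ * _) mulr1 /=.
        by have -> : id ^+ k'.+1 = (fun y : R => y ^+ k'.+1) by apply/funext => y; rewrite exprfctE.
      have h2 := @is_deriveV _ (fun y : R => y ^+ k) x _ 1 (expf_neq0 k x1) h.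
      by move: h2; rewrite -[_ *: _]/(_ * _) mulNr -exprM muln2.
    have := @is_deriveM _ _ _ _ x 1 _ _ e3 e2.
    have -> : - k%:R * flat k.+1 x + flat k.+2 x = x ^- k * (expR (- x^-1) / x ^+ 2) +
        expR (- x^-1) * - (x ^- k.*2 * (k%:R * x ^+ k.-1)).
      rewrite /flat x0; case: k {e2 e3} => [|k'] /=.
        by rewrite double0 !expr0; field.
      by rewrite -addnn !exprS exprD exprS; field; rewrite x1 expf_neq0.
    exact.
  apply: (near_eq_is_derive (f := fun y : R => (y ^- k) * expR (- y^-1)) _ H).
  by near=> y; rewrite /flat ifT//; near: y; apply: lt_nbhsr.
- rewrite !flat_le0// mulr0 addr0.
  have C : (fun h : R => h^-1 *: (flat k (h *: 1 + 0) - flat k 0)) @ 0^' --> (0 : R).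
    have e : forall h : R, h^-1 *: (flat k (h *: 1 + 0) - flat k 0) = flat k h / h.
      by move=> h; rewrite (flat_le0 _ (lexx 0)) subr0 /GRing.scale /= mulr1 addr0 mulrC.
    under eq_fun do rewrite e.
    apply/cvgrPdist_le => eps eps0; rewrite near_withinE.
    near=> h => h0; rewrite sub0r normrN normrM normfV.
    rewrite (ger0_norm (flat_ge0 _ _)) ler_pdivrMr ?normr_gt0//.
    have [hle|hgt] := lerP h 0; first by rewrite flat_le0// mulr_ge0// ltW.
    rewrite gtr0_norm//; apply: le_trans (flat_bound _ (ltW hgt)) _.
    rewrite ler_pM2r// -ler_pdivlMl ?ltr0n ?fact_gt0//.
    by near: h; apply: lt_le_nbhsl; apply: mulr_gt0 => //; rewrite invr_gt0 ltr0n fact_gt0.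
  by apply: DeriveDef; [apply: cvgP C | apply: cvg_lim C].
Unshelve. all: by end_near. Qed.

Lemma derive1_flat k : derive1 (flat k) = fun x => - k%:R * flat k.+1 x + flat k.+2 x.
Proof. by apply/funext=> x; rewrite derive1E; have [_ ->] := is_derive_flat k x. Qed.

Lemma Csmooth_flat k : Csmooth (flat k).
Proof.
move=> m; elim: m k => [|m IH] k /=; (split; first by move=> t; case: (is_derive_flat k t)).
  by [].
by rewrite derive1_flat; apply: CnD; [apply: CnM; [exact: Cn_cst | exact: IH] | exact: IH].
Qed.

Lemma flat0_lt x y : 0 < y -> x < y -> flat 0 x < flat 0 y.
Proof.
move=> y0 xy; have [x0|x0] := lerP x 0; first by rewrite flat_le0 // flat_gt0.
by rewrite /flat x0 y0 !expr0 !invr1 !mul1r ltr_expR ltrN2 ltf_pV2.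
Qed.

(** A smooth transition from 0 to 1, constant outside [0, 1] and with positive derivative inside:
    legs traversed with it join smoothly and have nonzero speed in their interior. *)
Definition step x := flat 0 x / (flat 0 x + flat 0 (1 - x)).

Lemma step_den x : 0 < flat 0 x + flat 0 (1 - x).
Proof.
have [x0|x0] := lerP x 0; first by rewrite ltr_wpDl ?flat_ge0 ?flat_gt0 //; lra.
by rewrite ltr_pwDl ?flat_ge0 ?flat_gt0.
Qed.

Lemma step_le0 x : x <= 0 -> step x = 0.
Proof. by move=> x0; rewrite /step flat_le0 // mul0r. Qed.

Lemma step_ge1 x : 1 <= x -> step x = 1.
Proof.
move=> x1; have := step_den x; rewrite /step (@flat_le0 0 (1 - x)); last by lra.
by rewrite addr0 => h; rewrite divff // gt_eqF.
Qed.

Lemma step_lt x y : 0 <= x -> x < y -> y <= 1 -> step x < step y.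
Proof.
move=> x0 xy y1; rewrite /step ltr_pdivrMr ?step_den // mulrAC ltr_pdivlMr ?step_den //.
have h1 : flat 0 x < flat 0 y by apply: flat0_lt => //; lra.
have h2 : flat 0 (1 - y) < flat 0 (1 - x) by apply: flat0_lt; lra.
have := @flat_ge0 0 x; have := @flat_ge0 0 (1 - y); nra.
Qed.

Lemma Csmooth_step : Csmooth step.
Proof.
move=> m; have h : Cn m (fun x => flat 0 (1 - x)).
  apply: Cn_ext (Cn_affine (-1) 1 (@Csmooth_flat 0 m)) => x /=; congr flat; ring.
apply: CnM; first exact: Csmooth_flat.
by apply: CnV; [move=> t; rewrite gt_eqF // step_den | apply: CnD => //; exact: Csmooth_flat].
Qed.

Lemma derive1_step_gt0 x : 0 < x -> x < 1 -> 0 < derive1 step x.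
Proof.
move=> x0 x1; have d1 := is_derive_flat 0 x; rewrite oppr0 mul0r add0r in d1.
have d2 : is_derive x 1 (fun y : R => flat 0 (1 - y)) (- flat 2 (1 - x)).
  have := @is_derive_affine (flat 0) (-1) 1 x _ (is_derive_flat 0 _).
  rewrite oppr0 mul0r add0r mulN1r (_ : -1 * x + 1 = 1 - x); last by ring.
  by under eq_fun do rewrite mulN1r addrC.
have dd := @is_deriveD _ _ _ _ _ x 1 _ _ d1 d2.
have nz : flat 0 x + flat 0 (1 - x) != 0 by rewrite gt_eqF // step_den.
have dv := @is_deriveV _ (fun y => flat 0 y + flat 0 (1 - y)) x _ 1 nz dd.
have [_ /=] := @is_deriveM _ _ _ _ x 1 _ _ d1 dv.
rewrite derive1E => ->; rewrite -![_ *: _]/(_ * _).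
have p1 := flat_gt0 0 x0; have p2 := flat_gt0 2 x0.
have q : 0 < 1 - x by lra.
have q1 := flat_gt0 0 q; have q2 := flat_gt0 2 q.
set a := flat 0 x in p1 nz *; set b := flat 2 x in p2 *.
set c := flat 0 _ in q1 nz *; set d := flat 2 _ in q2 *.
rewrite (_ : _ + _ = (b * c + a * d) / (a + c) ^+ 2).
  by rewrite divr_gt0 ?exprn_gt0 ?addr_gt0 ?mulr_gt0.
by field.
Qed.

Lemma step_onto l : 0 < l -> l < 1 -> exists x, [/\ 0 < x, x < 1 & step x = l].
Proof.
move=> l0 l1; have [||x] := @IVT R step 0 1 l ler01.
- apply: derivable_within_continuous => x _; exact: (Csmooth_step 0).1.
- by rewrite step_le0 // step_ge1 // minEle maxEle ler01 !ltW.
rewrite in_itv /= => /andP [x0 x1] e; exists x; split=> //.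
- by rewrite lt_neqAle x0 andbT; apply/eqP => z; move: e; rewrite -z step_le0 //; lra.
- by rewrite lt_neqAle x1 andbT; apply/eqP => z; move: e; rewrite z step_ge1 //; lra.
Qed.

End SmoothFunctions.

(** * Polygonal routes and their smooth parametrization *)

Section Routes.
Variables (R : realType) (n : nat).
Local Notation pt := (R * R)%type.
Implicit Types (A B z : pt) (K : set pt) (s : seq (pt * option 'I_n)).

Definition lerp A B (l : R) : pt := (A.1 + l * (B.1 - A.1), A.2 + l * (B.2 - A.2)).
Definition segm A B : set pt := [set z | exists2 l, 0 <= l <= 1 & z = lerp A B l].
Definition rays : set pt := [set z | exists i : 'I_n, ray i z].

(** The start [A] may lie on a ray, because the first leg starts at a marked point. A crossing lies
    above height 1, hence not at a marked point, and inside the leg, where [step] has positive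
    derivative. *)
Definition leg_ok A B (o : option 'I_n) : Prop :=
  [/\ A <> B, forall z, segm A B z -> 0 <= z.2 &
  if o is Some k then A.1 <> B.1 /\ exists z0,
    [/\ segm A B z0, z0 <> A /\ z0 <> B, ray k z0, 1 < z0.2
      & forall z, segm A B z -> rays z -> z = z0]
  else forall z, segm A B z -> z <> A -> ~ rays z].

(** Injectivity is built in: [K] is everything drawn so far, and a leg may touch it only where it
    starts. *)
Fixpoint route K A s : Prop :=
  if s is (B, o) :: s' then
    [/\ leg_ok A B o, forall z, segm A B z -> z <> A -> ~ K z
      & route (K `|` segm A B) B s']
  else True.

(** Leg number i, counted from 0, is traversed while u runs from i to i + 1. As [step] is constant
    outside [0, 1], one formula holds for all u, and smoothness is that of a sum. *)
Fixpoint polyline A s (u : R) : pt :=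
  if s is (B, _) :: s' then
    (A.1 + step u * (B.1 - A.1) + ((polyline B s' (u - 1)).1 - B.1),
     A.2 + step u * (B.2 - A.2) + ((polyline B s' (u - 1)).2 - B.2))
  else A.

Lemma lerp0 A B : lerp A B 0 = A.
Proof. by rewrite /lerp !mul0r !addr0 -surjective_pairing. Qed.

Lemma lerp1 A B : lerp A B 1 = B.
Proof. by rewrite /lerp !mul1r !subrKC -surjective_pairing. Qed.

Lemma lerp_inj A B l m : A <> B -> lerp A B l = lerp A B m -> l = m.
Proof.
move=> nAB [/addrI e1 /addrI e2]; apply/eqP; apply: contra_notT nAB => lm.
have : (l - m) * (B.1 - A.1) = 0 by rewrite mulrBl e1 subrr.
have : (l - m) * (B.2 - A.2) = 0 by rewrite mulrBl e2 subrr.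
move=> /eqP; rewrite mulf_eq0 !subr_eq0 (negbTE lm) /= => /eqP b2.
move=> /eqP; rewrite mulf_eq0 !subr_eq0 (negbTE lm) /= => /eqP b1.
by rewrite (surjective_pairing A) (surjective_pairing B) b1 b2.
Qed.

Lemma segmR A B : segm A B B.
Proof. by exists 1; rewrite ?lerp1 // lexx ler01. Qed.

Lemma step_itv (u : R) : 0 <= step u <= 1.
Proof.
have [u0|u0] := lerP u 0; first by rewrite step_le0 // lexx ler01.
have [u1|u1] := lerP 1 u; first by rewrite step_ge1 // lexx ler01.
rewrite -[X in X <= _ <= _](@step_le0 _ 0) // -[X in _ <= _ <= X](@step_ge1 _ 1) //.
by rewrite !ltW // step_lt // ltW.
Qed.

Lemma step_gt0 (u : R) : 0 < u -> 0 < step u.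
Proof.
have [u1|u1] := lerP 1 u; first by rewrite step_ge1.
by move=> u0; rewrite -(@step_le0 _ 0) // step_lt // ltW.
Qed.

Lemma polyline_le0 A s (u : R) : u <= 0 -> polyline A s u = A.
Proof.
elim: s A u => [|[B o] s IH] A u u0 //=; rewrite IH; last by lra.
by rewrite !subrr !addr0 step_le0 // !mul0r !addr0 -surjective_pairing.
Qed.

Lemma polyline_le1 A B o s (u : R) : u <= 1 -> polyline A ((B, o) :: s) u = lerp A B (step u).
Proof. by move=> u1 /=; rewrite polyline_le0 ?subrr ?addr0 //; lra. Qed.

Lemma polyline_ge1 A B o s (u : R) : 1 <= u -> polyline A ((B, o) :: s) u = polyline B s (u - 1).
Proof.
move=> u1 /=; rewrite step_ge1 // !mul1r !subrKC.
by case: (polyline _ _ _).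
Qed.

Lemma polyline_end A s : polyline A s (size s)%:R = last A (map fst s).
Proof.
elim: s A => [|[B o] s IH] A //.
by rewrite polyline_ge1 ?ler1n // -[size (_ :: _)]/(size s).+1 -natr1 addrK IH.
Qed.

Lemma polyline_smooth A s m :
  Cn m (fun u => (polyline A s u).1) /\ Cn m (fun u => (polyline A s u).2).
Proof.
elim: s A => [|[B o] s IH] A; first by split; apply: Cn_cst.
have [h1 h2] := IH B; have st := @Csmooth_step R m.
have sh f : Cn m f -> Cn m (fun u : R => f (u - 1)).
  by move=> /(Cn_affine 1 (-1)); apply: Cn_ext => u; rewrite mul1r.
have ln c d : Cn m (fun u : R => c + step u * d).
  by apply: CnD; [exact: Cn_cst | apply: CnM => //; exact: Cn_cst].
split; [have := CnD (ln A.1 (B.1 - A.1)) (CnD (sh _ h1) (Cn_cst m (- B.1)))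
  | have := CnD (ln A.2 (B.2 - A.2)) (CnD (sh _ h2) (Cn_cst m (- B.2)))]; exact.
Qed.

Arguments polyline : simpl never.

Lemma route_avoid K A s (u : R) : route K A s -> 0 < u -> u <= (size s)%:R ->
  ~ K (polyline A s u).
Proof.
elim: s K A u => [|[B o] s IH] K A u; first by move=> _ /lt_le_trans h /h; rewrite ltxx.
move=> [[nAB _ _] hK hs] u0 us; have [u1|u1] := lerP u 1.
  rewrite polyline_le1 //; apply: hK; first by exists (step u); rewrite ?step_itv.
  rewrite -[X in _ <> X](lerp0 A B) => /(lerp_inj nAB) e.
  by have := step_gt0 u0; rewrite e ltxx.
rewrite polyline_ge1 ?ltW // => hKp.
apply: (IH _ _ (u - 1) hs); [lra | move: us => /=; rewrite -natr1; lra | by left].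
Qed.

Lemma route_inj K A s (u v : R) : route K A s -> 0 <= u -> u < v -> v <= (size s)%:R ->
  polyline A s u <> polyline A s v.
Proof.
elim: s K A u v => [|[B o] s IH] K A u v.
  by move=> _ u0 uv; rewrite leNgt (le_lt_trans u0 uv).
move=> [[nAB _ _] _ hs] u0 uv vs; have sz : v - 1 <= (size s)%:R.
  by move: vs => /=; rewrite -natr1; lra.
have [v1|v1] := lerP v 1.
  rewrite !polyline_le1 //; last by lra.
  move=> /(lerp_inj nAB) e; have := step_lt u0 uv v1; rewrite e ltxx //.
rewrite (@polyline_ge1 _ _ _ _ v) ?ltW //; have [u1|u1] := lerP u 1.
  rewrite polyline_le1 // => e; apply: (route_avoid hs _ sz); first by lra.
  by rewrite -e; right; exists (step u); rewrite ?step_itv.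
rewrite polyline_ge1; last exact: ltW.
apply: (IH _ _ _ _ hs) => //; lra.
Qed.

Lemma route_above K A s (u : R) : 0 <= A.2 -> route K A s -> 0 <= u -> u <= (size s)%:R ->
  0 <= (polyline A s u).2.
Proof.
elim: s K A u => [|[B o] s IH] K A u A0 //; move=> [[_ h _] _ hs] u0 us.
have [u1|u1] := lerP u 1.
  by rewrite polyline_le1 //; apply: h; exists (step u); rewrite ?step_itv.
rewrite polyline_ge1; last exact: ltW.
apply: (IH _ _ _ _ hs); [exact: h (segmR _ _) | lra |].
by move: us => /=; rewrite -natr1; lra.
Qed.

Lemma derive1_polyline_lt1 A B o s (u : R) : u < 1 ->
  derive1 (fun u => (polyline A ((B, o) :: s) u).1) u = derive1 (@step R) u * (B.1 - A.1).
Proof.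
move=> u1; rewrite derive1E.
have ds : is_derive u 1 (@step R) (derive1 (@step R) u).
  by apply: DeriveDef; [exact: (@Csmooth_step R 0).1 | rewrite derive1E].
have d1 := @is_deriveM _ _ (@step R) (cst (B.1 - A.1)) u 1 _ 0 ds (is_derive_cst _ _ _).
have d2 := @is_deriveD _ _ _ (cst A.1) _ u 1 0 _ (is_derive_cst _ _ _) d1.
rewrite scaler0 add0r add0r -[_ *: _]/(_ * _) [X in is_derive _ _ _ X]mulrC in d2.
suff [_ ->] : is_derive u 1 (fun u => (polyline A ((B, o) :: s) u).1)
   (derive1 (@step R) u * (B.1 - A.1)) by [].
apply: near_eq_is_derive d2.
near=> v; rewrite polyline_le1 //; near: v; exact: lt_le_nbhsl.
Unshelve. all: by end_near. Qed.

Lemma derive1_polyline_gt1 A B o s (u : R) : 1 < u ->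
  derive1 (fun u => (polyline A ((B, o) :: s) u).1) u
  = derive1 (fun u => (polyline B s u).1) (u - 1).
Proof.
move=> u1; rewrite derive1E.
set f := fun u => (polyline B s u).1.
have df : is_derive (1 * u + -1) 1 f (derive1 f (1 * u + -1)).
  by apply: DeriveDef; [exact: (polyline_smooth B s 0).1.1 | rewrite derive1E].
have d1 := is_derive_affine df.
rewrite !mul1r in d1.
suff [_ ->] : is_derive u 1 (fun u => (polyline A ((B, o) :: s) u).1)
   (derive1 f (u - 1)) by [].
apply: near_eq_is_derive d1.
near=> v; rewrite mul1r polyline_ge1 //; near: v; exact: lt_le_nbhsr.
Unshelve. all: by end_near. Qed.

Lemma route_crossings K A s : route K A s -> exists tk : seq (R * 'I_n),
  [/\ map snd tk = pmap snd s, sorted <%R (map fst tk),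
      forall u, u \in map fst tk <-> 0 < u <= (size s)%:R /\ rays (polyline A s u)
    & forall p, p \in tk -> [/\ ray p.2 (polyline A s p.1), 1 < (polyline A s p.1).2
        & derive1 (fun u => (polyline A s u).1) p.1 != 0]].
Proof.
elim: s K A => [|[B o] s IH] K A.
  move=> _; exists [::]; split=> // u; split=> // -[/andP [/lt_le_trans h /h]].
  by rewrite ltxx.
move=> [[nAB _ ho] _ /IH [tk [e1 e2 e3 e4]]].
pose tk' := [seq (p.1 + 1, p.2) | p <- tk].
have sz (u : R) : (1 < u <= (size ((B, o) :: s))%:R) = (0 < u - 1 <= (size s)%:R).
  by rewrite /= -natr1 subr_gt0 lerBlDr.
have mem (u : R) : u \in map fst tk' <-> 1 < u <= (size ((B, o) :: s))%:R
    /\ rays (polyline A ((B, o) :: s) u).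
  rewrite sz -map_comp; split=> [/mapP [p ptk ->] /=|[u1 r]].
    have /e3 [h1 h2] := map_f fst ptk; rewrite addrK; split=> //.
    by rewrite polyline_ge1 ?addrK //; move: h1; lra.
  move: r; rewrite polyline_ge1; last by lra.
  move=> r; have /e3 /mapP [p ptk pu] := conj u1 r.
  by apply/mapP; exists p => //=; rewrite -pu subrK.
have srt : sorted <%R (map fst tk').
  rewrite -map_comp (map_comp (fun x => x + 1) fst) sorted_map.
  by apply: sub_sorted e2 => x y /=; rewrite ltrD2r.
have prop p : p \in tk' -> [/\ ray p.2 (polyline A ((B, o) :: s) p.1),
    1 < (polyline A ((B, o) :: s) p.1).2
    & derive1 (fun u => (polyline A ((B, o) :: s) u).1) p.1 != 0].
  move=> /mapP [q qtk ->]; have [h1 h2 h3] := e4 _ qtk.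
  have /e3 [/andP [q0 _] _] := map_f fst qtk.
  have q1 : 1 < q.1 + 1 by lra.
  rewrite -[(q.1 + 1, q.2).1]/(q.1 + 1) -[(q.1 + 1, q.2).2]/(q.2).
  by rewrite derive1_polyline_gt1 // (polyline_ge1 _ _ _ _ (ltW q1)) addrK.
have me : map snd tk' = pmap snd s by rewrite -e1 -map_comp; apply: eq_map.
have bd (u : R) : 0 < u -> u <= (size ((B, o) :: s))%:R -> u <= 1 \/ 1 < u <= (size ((B, o) :: s))%:R.
  by move=> u0 us; have [|u1] := lerP u 1; [left | right].
have N1 : 1 <= (size ((B, o) :: s))%:R :> R by rewrite ler1n.
case: o ho sz mem prop bd N1 => [k|] ho sz mem prop bd N1; last first.
  exists tk'; split=> // u; rewrite mem; split=> -[/andP [h1 h2] h3].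
    by split=> //; rewrite h2 andbT; lra.
  split=> //; have [u1|//] := bd _ h1 h2.
  move: h3; rewrite polyline_le1 // => h3; case: (ho _ _ _ h3).
    by exists (step u); rewrite ?step_itv.
  rewrite -[X in _ <> X](lerp0 A B) => /(lerp_inj nAB) e.
  by have := step_gt0 h1; rewrite e ltxx.
case: ho => nv [z0 [[l /andP [l0 l1] zl] [nA nB] rz z2 uniqz]].
(* The crossing point divides the leg in the ratio given by [l]; it is reached at the time [v] with
   [step v = l]. *)
have [||v [v0 v1 vl]] := @step_onto R l.
- by rewrite lt_neqAle l0 andbT; apply/eqP => e; apply: nA; rewrite zl -e lerp0.
- by rewrite lt_neqAle l1 andbT; apply/eqP => e; apply: nB; rewrite zl e lerp1.
have pv : polyline A ((B, Some k) :: s) v = z0 by rewrite polyline_le1 ?ltW // vl.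
exists ((v, k) :: tk'); split.
- by rewrite /= me.
- rewrite /= path_min_sorted //; apply/allP => x /mem [/andP [h _] _]; exact: lt_trans h.
- move=> u; rewrite in_cons; split=> [/predU1P [->|/mem [/andP [h1 h2] h3]]|].
  + rewrite pv; split; last by exists k.
    by rewrite v0 /=; apply: le_trans N1; apply: ltW.
  + by split=> //; rewrite h2 andbT; lra.
  + move=> [/andP [h1 h2] h3]; have [u1|u1] := bd _ h1 h2; last first.
      by apply/orP; right; apply/mem.
    move: h3; rewrite polyline_le1 // => /uniqz e.
    have {}e : lerp A B (step u) = lerp A B (step v).
      by rewrite vl -zl; apply: e; exists (step u); rewrite ?step_itv.
    move: e => /(lerp_inj nAB) e; apply/orP; left; apply/eqP.
    have [uv|uv|//] := ltgtP u v.
      by have := step_lt (ltW h1) uv (ltW v1); rewrite e ltxx.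
    by have := step_lt (ltW v0) uv u1; rewrite e ltxx.
- move=> p; rewrite in_cons => /predU1P [->|/prop //].
  rewrite (_ : (v, k).1 = v) // (_ : (v, k).2 = k) // pv; split=> //.
  rewrite derive1_polyline_lt1 // mulf_neq0 //; first by rewrite gt_eqF // derive1_step_gt0.
  by rewrite subr_eq0; apply/eqP => e; apply: nv.
Qed.

Lemma route_curve (k0 : 'I_n) s : route set0 (marked_point R k0) s ->
  last (marked_point R k0) (map fst s) = base_point R ->
  exists gamma : R -> pt, [/\ admissible n gamma, non_self_crossing gamma
                  & itinerary gamma k0 (pmap snd s)].
Proof.
set A := marked_point R k0 => rt la.
pose N : R := (size s)%:R; pose gamma t := polyline A s (N * t).
have N0 : 0 < N.
  (* There is at least one leg: marked points have height 1, the base point has height 0. *)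
  rewrite ltr0n; case: (s) la => //= /(congr1 snd) /= /eqP; by rewrite oner_eq0.
have N1 : N != 0 by rewrite gt_eqF.
have rg t : 0 <= t <= 1 -> 0 <= N * t /\ N * t <= N.
  by move=> /andP [t0 t1]; split; [rewrite mulr_ge0 // ltW | rewrite -[X in _ <= X]mulr1 ler_wpM2l // ltW].
have inj : non_self_crossing gamma.
  move=> t u ht hu e; have [t0 t1] := rg _ ht; have [u0 u1] := rg _ hu.
  have [h|h|//] := ltgtP t u.
    by case: (route_inj rt t0 _ u1 e); rewrite ltr_pM2l.
  by case: (route_inj rt u0 _ t1 (esym e)); rewrite ltr_pM2l.
have g0 : gamma 0 = A by rewrite /gamma mulr0 polyline_le0.
have g1 : gamma 1 = base_point R by rewrite /gamma mulr1 polyline_end.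
have [tk [e1 e2 e3 e4]] := route_crossings rt.
have ct t : crossing_times n gamma t <-> N * t \in map fst tk.
  rewrite e3; split=> -[/andP [h1 h2] h3]; (split; last exact: h3).
    by rewrite mulr_gt0 //= -[X in _ <= X]mulr1 ler_wpM2l // ltW.
  by move: h1 h2; rewrite pmulr_rgt0 // => -> /=; rewrite -[X in _ <= X -> _]mulr1 ler_pM2l.
pose ts := [seq t / N | t <- map fst tk].
have tsP t : t \in ts <-> crossing_times n gamma t.
  rewrite ct; split=> [/mapP [u h ->]|h]; first by rewrite mulrC divfK.
  by apply/mapP; exists (N * t) => //; rewrite mulrAC divff // mul1r.
have above t : crossing_times n gamma t -> 1 < (gamma t).2.
  move=> /ct /mapP [p ptk e]; rewrite /gamma e; by have [] := e4 _ ptk.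
exists gamma; split=> //.
  split.
  - have sm m := polyline_smooth A s m.
    have cm m f : Cn m f -> Cn m (fun t => f (N * t)).
      by move=> /(Cn_affine N 0); apply: Cn_ext => t; rewrite addr0.
    split.
      exists (fun t => (gamma t).1); split=> // m t; apply: Csmooth_derive1n => m'.
      exact: (cm m' _ (sm m').1).
    exists (fun t => (gamma t).2); split=> // m t; apply: Csmooth_derive1n => m'.
    exact: (cm m' _ (sm m').2).
  - by move=> t /rg [t0 t1]; apply: route_above rt t0 t1; exact: ler01.
  - by exists k0.
  - by [].
  - move=> t ht [[i e]|e]; last by right; apply: inj => //; rewrite ?ler01 ?lexx // e g1.
    left; case/andP: (ht) => t0 t1; move: t0; rewrite le_eqVlt => /predU1P [<- //|t0].
    have : crossing_times n gamma t.
      by split; [rewrite t0 | exists i; rewrite e; split=> //=].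
    by move=> /above; rewrite e ltxx.
  - move=> t /ct /mapP [p ptk e]; have [_ _] := e4 _ ptk; rewrite -e.
    have -> : (fun u => (gamma u).1) = fun u => (polyline A s (N * u + 0)).1.
      by apply/funext => u; rewrite addr0.
    have df : is_derive (N * t + 0) 1 (fun u => (polyline A s u).1)
                (derive1 (fun u => (polyline A s u).1) (N * t + 0)).
      by apply: DeriveDef; [exact: (polyline_smooth A s 0).1.1 | rewrite derive1E].
    have [_] := is_derive_affine df.
    by rewrite [derive1 _ t]derive1E addr0 => -> h; rewrite mulf_neq0.
  - by apply: sub_finite_set (finite_seq ts) => t /tsP.
split=> //; exists ts; split=> //.
- rewrite sorted_map; apply: sub_sorted e2 => x y /= xy.
  by rewrite ltr_pM2r // invr_gt0.
- by rewrite !size_map -e1 size_map.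
- move=> i; rewrite -e1 size_map => isz.
  have ptk := mem_nth (0, k0) isz; have [h _ _] := e4 _ ptk.
  rewrite (nth_map (0, k0)) // (nth_map 0) ?size_map // (nth_map (0, k0)) //.
  by rewrite /gamma mulrC divfK.
Qed.

End Routes.

(** * Curves around consecutive marked points *)

Section Drawing.
Variables (R : realType) (n : nat).
Local Notation pt := (R * R)%type.
Implicit Types (A B z : pt) (K D : set pt) (s : seq (pt * option 'I_n)).

Fixpoint trace A s : set pt :=
  if s is (B, _) :: s' then segm A B `|` trace B s' else [set A].

Lemma route_sub K K' A s : K' `<=` K -> route K A s -> route K' A s.
Proof.
elim: s K K' A => [|[B o] s IH] K K' A //= sK [h1 h2 h3]; split=> //.
  by move=> z zAB zA /sK; apply: h2.
by apply: IH h3; apply: setSU.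
Qed.

(** A region [D] that contains everything drawn before is enough to continue; the exact union in
    [route] never has to be handled. *)
Lemma route_cat K D A s s' : route K A s -> K `<=` D -> trace A s `<=` D ->
  route D (last A (map fst s)) s' -> route K A (s ++ s').
Proof.
elim: s K A => [|[B o] s IH] K A /=; first by move=> _ sK _; apply: route_sub.
move=> [h1 h2 h3] sK sD h; split=> //; apply: IH h3 _ _ h.
  by move=> z [/sK //|zAB]; apply: sD; left.
by move=> z zs; apply: sD; right.
Qed.

Lemma trace_cat A s s' : trace A (s ++ s') `<=` trace A s `|` trace (last A (map fst s)) s'.
Proof.
elim: s A => [|[B o] s IH] A z /=; first by right.
by move=> [h|/IH [h|h]]; [left; left | left; right | right].
Qed.

Lemma segm_horizontal x x' y z : segm (x, y) (x', y) z ->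
  z.2 = y /\ (x <= z.1 <= x' \/ x' <= z.1 <= x).
Proof.
move=> [l /andP [l0 l1] ->] /=; split; first by rewrite subrr mulr0 addr0.
by have [h|h] := lerP x x'; [left | right]; apply/andP; split; nra.
Qed.

Lemma segm_vertical x y y' z : segm (x, y) (x, y') z ->
  z.1 = x /\ (y <= z.2 <= y' \/ y' <= z.2 <= y).
Proof.
move=> [l /andP [l0 l1] ->] /=; split; first by rewrite subrr mulr0 addr0.
by have [h|h] := lerP y y'; [left | right]; apply/andP; split; nra.
Qed.

Definition off_grid (x : R) := forall i : nat, x <> i%:R.

Lemma pt_eq z x y : z.1 = x -> z.2 = y -> z = (x, y).
Proof. by case: z => ? ? /= -> ->. Qed.

(** A segment from height at most 1 to height below 1 can reach the rays only at its start. *)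
Lemma leg_low (x y x' y' : R) : 0 <= y <= 1 -> 0 <= y' < 1 -> (x, y) <> (x', y') ->
  leg_ok (x, y) (x', y') (None : option 'I_n).
Proof.
move=> /andP [y0 y1] /andP [y'0 y'1] ne; split=> // z [l /andP [l0 l1] ->] /=.
  by nra.
move=> nz [i [/= _ e2]]; apply: nz; rewrite -[RHS](lerp0 _ (x', y')).
suff -> : l = 0 by [].
by nra.
Qed.

Lemma leg_vertical (x y y' : R) : 0 <= y -> 0 <= y' -> y <> y' -> off_grid x ->
  leg_ok (x, y) (x, y') (None : option 'I_n).
Proof.
move=> y0 y'0 ne ng; split; first by case.
  by move=> z /segm_vertical [_ [/andP [h _]|/andP [h _]]]; apply: le_trans h.
by move=> z /segm_vertical [e _] _ [i [/= e2 _]]; apply: (ng i.+1); rewrite -e.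
Qed.

(** The second condition on x and x' keeps the leg strictly between the two neighbours of ray k,
    which stands over k + 1. *)
Lemma leg_cross (x x' y : R) (k : 'I_n) (d : bool) : 1 < y ->
  (if d then x < k.+1%:R < x' else x' < k.+1%:R < x) ->
  (if d then k%:R < x /\ x' < k.+2%:R else x < k.+2%:R /\ k%:R < x') ->
  leg_ok (x, y) (x', y) (Some k).
Proof.
move=> y1 h1 h2; have k1 : k.+1%:R = k%:R + 1 :> R by rewrite -natr1.
have k2 : k.+2%:R = k%:R + 1 + 1 :> R by rewrite -!natr1.
rewrite k1 k2 in h1 h2.
have xx : x <> x' by move=> e; case: d h1 {h2} => /andP; rewrite e; lra.
split; [by case | by move=> z /segm_horizontal [-> _]; lra |].
split=> //; exists (k.+1%:R, y).
have sg : segm (x, y) (x', y) (k.+1%:R, y).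
  exists ((k.+1%:R - x) / (x' - x)); last first.
    have nz : x' - x != 0 by apply/eqP => /eqP; rewrite subr_eq0 => /eqP /esym.
    by rewrite /lerp /= subrr mulr0 addr0 divfK // subrKC.
  rewrite k1; case: d h1 {h2} => /andP [h1 h2].
    by rewrite divr_ge0 ?ler_pdivrMr; lra.
  rewrite -mulrNN -invrN !opprB divr_ge0 ?ler_pdivrMr; lra.
split=> //.
- by split=> -[]; rewrite k1 => e; case: d h1 {h2} => /andP; lra.
- by split=> //=; lra.
move=> z /segm_horizontal [z2 z1] [i [e _]]; apply: pt_eq => //.
have L1 : k%:R < i.+1%:R :> R by rewrite -e; case: d h1 h2 => /andP h1 h2; case: z1 => /andP; lra.
have L2 : i.+1%:R < k.+2%:R :> R by rewrite k2 -e; case: d h1 h2 => /andP h1 h2; case: z1 => /andP; lra.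
rewrite !ltr_nat !ltnS in L1 L2.
by rewrite e; congr (_.+1%:R); apply/eqP; rewrite eqn_leq L1 L2.
Qed.

End Drawing.

(** * Loops around a box *)

Section Stages.
Variables (R : realType) (n : nat).
Local Notation pt := (R * R)%type.
Implicit Types (A B z : pt) (K D : set pt) (s : seq (pt * option 'I_n)) (d : bool) (k : 'I_n) (ks : seq 'I_n) (a x y : R).

Definition adjacent d : rel 'I_n := fun i j => if d then j == i.+1 :> nat else i == j.+1 :> nat.

Definition past d (a : R) (k : 'I_n) : R := k.+1%:R + (if d then a else - a).

Definition run d (a y : R) ks : seq (pt * option 'I_n) :=
  [seq ((past d a k, y), Some k) | k <- ks].

Lemma pmap_run d a y ks : pmap snd (run d a y ks) = ks.
Proof. by elim: ks => //= k ks ->. Qed.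

Lemma run_route d a y x k ks : 1 < y -> 0 < a -> a < 1 ->
  (if d then k%:R < x < k.+1%:R else k.+1%:R < x < k.+2%:R) ->
  path (adjacent d) k ks ->
  let w := past d a (last k ks) in
  [/\ route [set z | z.2 = y -> if d then z.1 <= x else x <= z.1] (x, y) (run d a y (k :: ks)),
      trace (x, y) (run d a y (k :: ks)) `<=`
        [set z | z.2 = y /\ if d then x <= z.1 <= w else w <= z.1 <= x],
      last (x, y) (map fst (run d a y (k :: ks))) = (w, y)
    & if d then x < w else w < x].
Proof.
move=> y1 a0 a1; elim: ks k x => [|k' ks IH] k x hx.
  move=> _ /=.
  have k1 : k.+1%:R = k%:R + 1 :> R by rewrite -natr1.
  have k2 : k.+2%:R = k%:R + 1 + 1 :> R by rewrite -!natr1.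
  have xw : if d then x < past d a k else past d a k < x.
    by move: hx; rewrite /past k1 k2; case: d => /andP; lra.
  split=> //.
  - split=> //; first by apply: (@leg_cross _ _ _ _ _ _ d) => //; move: hx; rewrite /past k1 k2; case: (d) => /andP; lra.
    move=> z /segm_horizontal [z2 z1] nz /(_ z2) h; apply: nz; apply: pt_eq => //.
    by move: xw h z1; case: (d); lra.
  - move=> z [/segm_horizontal [z2 z1]|->]; split=> //; last by move: xw => /=; case: (d); lra.
    by move: xw z1; case: (d); lra.
move=> /andP [adj pth].
have rE : run d a y [:: k, k' & ks] = ((past d a k, y), Some k) :: run d a y (k' :: ks) by [].
have k1 : k.+1%:R = k%:R + 1 :> R by rewrite -natr1.
have k2 : k.+2%:R = k%:R + 1 + 1 :> R by rewrite -!natr1.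
have xw : if d then x < past d a k else past d a k < x.
  by move: hx; rewrite /past k1 k2; case: (d) => /andP; lra.
have {}IH := IH k' (past d a k) _ pth; case: IH => [|h1 h2 h3 h4].
  move: adj; rewrite /adjacent /past; case: (d) => /eqP e.
    by rewrite e k1 k2; lra.
  have k'1 : k'.+1%:R = k%:R :> R by rewrite e.
  by rewrite -[k'.+2%:R]natr1 k'1 k1; lra.
rewrite {}rE [last k _]/=; move: (run d a y (k' :: ks)) h1 h2 h3 => L h1 h2 h3.
split=> //.
- split=> //.
  + by apply: (@leg_cross _ _ _ _ _ _ d) => //; move: hx; rewrite /past k1 k2; case: (d) => /andP; lra.
  + move=> z /segm_horizontal [z2 z1] nz /(_ z2) h; apply: nz; apply: pt_eq => //.
    by move: xw h z1; case: (d); lra.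
  + apply: route_sub h1 => z [h z2|/segm_horizontal [z2 z1] _]; move: xw; [move: (h z2) | move: z1]; by case: (d); lra.
- move=> z [/segm_horizontal [z2 z1]|/h2 [z2 z1]]; split=> //; move: xw h4 z1; by case: (d); lra.
- by move: xw h4; case: (d); lra.
Qed.

Definition box (l r b : R) : set pt :=
  [set z | (l - b <= z.1 <= r + b) && (1 - b <= z.2 <= 1 + b)].

(** The loose end lies on the bottom edge of the box, straight below the start, where it can be
    continued to the base point or around the whole box. A margin below 1/2 leaves a strip between
    the box and the next ray. *)
Definition drawn (k0 : 'I_n) s (l r b : R) : Prop :=
  [/\ 0 <= b, b < 2^-1, l <= k0.+1%:R <= r &
  [/\ route set0 (marked_point R k0) s, trace (marked_point R k0) s `<=` box l r b
    & last (marked_point R k0) (map fst s) = (k0.+1%:R, 1 - b)]].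

Lemma drawn0 (k0 : 'I_n) : drawn k0 [::] k0.+1%:R k0.+1%:R 0.
Proof.
split; [by rewrite lexx | by rewrite invr_gt0 ltr0n | by rewrite !lexx |]; split=> //.
  by move=> _ -> /=; rewrite /box /= !subr0 !addr0 !lexx.
by rewrite subr0.
Qed.

Lemma drawn_grow (k0 : 'I_n) s l r b l' r' : l' <= l -> r <= r' ->
  drawn k0 s l r b -> drawn k0 s l' r' b.
Proof.
move=> ll rr [b0 b1 /andP [h1 h2] [h3 h4 h5]]; split=> //; first by rewrite (le_trans ll) ?(le_trans h2).
split=> // z /h4 /andP [/andP [z1 z2] z3]; apply/andP; split=> //; lra.
Qed.

Definition inner (l r b x0 u a : R) : set pt :=
  [set z | [\/ box l r b z, z.1 = x0 /\ 1 - a <= z.2 <= 1 - b,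
     z.2 = 1 - a /\ (x0 <= z.1 <= u \/ u <= z.1 <= x0) | z.1 = u /\ 1 - a <= z.2 <= 1 + a]].

Definition entry (x0 u a : R) : seq (pt * option 'I_n) :=
  [:: ((x0, 1 - a), None); ((u, 1 - a), None); ((u, 1 + a), None)].

Definition exit (x0 w b : R) : seq (pt * option 'I_n) :=
  [:: ((w, 1 - b), None); ((x0, 1 - b), None)].

Lemma entry_route (l r b x0 u a : R) : 0 <= b -> b < a -> a < 1 -> x0 <> u ->
  (u < l - b \/ r + b < u) -> off_grid u ->
  route (box l r b) (x0, 1 - b) (entry x0 u a).
Proof.
move=> b0 ba a1 xu uo gu; split.
- apply: leg_low; [by lra | by lra |]; by case=> e; lra.
- move=> z /segm_vertical [z1 z2] nz; have {}nz : z.2 <> 1 - b by move=> e; apply: nz; apply: pt_eq.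
  by move=> /andP [_ /andP [z3 z4]]; clear uo; case: z2 => /andP [? ?]; lra.
split.
- apply: leg_low; [by lra | by lra |]; by case=> e; lra.
- move=> z /segm_horizontal [z2 z1] nz; have {}nz : z.1 <> x0 by move=> e; apply: nz; apply: pt_eq.
  move=> [/andP [_ /andP [z3 z4]]|/segm_vertical [z3 _] //]; clear uo z1; lra.
split=> //.
- by apply: leg_vertical => //; clear uo; lra.
- move=> z /segm_vertical [z1 z2] nz; have {}nz : z.2 <> 1 - a by move=> e; apply: nz; apply: pt_eq.
  move=> [[/andP [/andP [z3 z4] _]|/segm_vertical [z3 _]]|/segm_horizontal [z3 _]] //.
    by clear z2; rewrite z1 in z3 z4; case: uo; lra.
  by apply: xu; rewrite -z1 -z3.
Qed.

Lemma entry_trace (l r b x0 u a : R) : 0 <= b -> b < a ->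
  trace (x0, 1 - b) (entry x0 u a) `<=` inner l r b x0 u a.
Proof.
move=> b0 ba z [/segm_vertical [z1 z2]|[/segm_horizontal [z2 z1]|[/segm_vertical [z1 z2]|->]]].
- by constructor 2; split=> //; case: z2 => /andP [? ?]; lra.
- by constructor 3.
- by constructor 4; split=> //; case: z2 => /andP [? ?]; lra.
- by constructor 4; split=> //=; lra.
Qed.

(** The last two hypotheses put w outside the interval between x0 and u, so that the descent along w
    misses the horizontal leg of [entry]. *)
Lemma exit_route (l r b x0 u w a b' : R) : 0 <= b -> b < a -> a < b' -> b' < 1 ->
  x0 <> w -> u <> w -> (w < l - b \/ r + b < w) -> off_grid w ->
  (u <= x0 -> w < u \/ x0 < w) -> (x0 <= u -> w < x0 \/ u < w) ->
  route [set z | inner l r b x0 u a z \/ z.2 = 1 + a /\ (u <= z.1 <= w \/ w <= z.1 <= u)]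
    (w, 1 + a) (exit x0 w b').
Proof.
move=> b0 ba ab b1 xw uw wo gw c1 c2; split=> //.
- by apply: leg_vertical => //; clear wo c1 c2; lra.
- move=> z /segm_vertical [z1 _] nz.
  have {}nz : z.2 <> 1 + a by move=> e; apply: nz; apply: pt_eq.
  move=> [[|||]|]; rewrite /box /= ?z1.
  + by move=> /andP [/andP [? ?] _]; clear c1 c2; case: wo; lra.
  + by move=> [? _]; apply: xw.
  + move=> [_ [/andP [h1 h2]|/andP [h1 h2]]]; clear wo.
      by have := c2 (le_trans h1 h2); clear c1 c2; case; lra.
    by have := c1 (le_trans h1 h2); clear c1 c2; case; lra.
  + by move=> [? _]; apply: uw.
  + by move=> [? _].
clear c1 c2 wo; split=> //.
- by apply: leg_low; [lra | lra | case=> e; apply: xw].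
- move=> z /segm_horizontal [z2 _] nz.
  have {}nz : z.1 <> w by move=> e; apply: nz; apply: pt_eq.
  move=> [[[|||]|]|/segm_vertical [? _] //]; rewrite /box /= z2.
  + by move=> /andP [_ /andP [? ?]]; lra.
  + by move=> [_ /andP [? ?]]; lra.
  + by move=> [? _]; lra.
  + by move=> [_ /andP [? ?]]; lra.
  + by move=> [? _]; lra.
Qed.

Lemma box_sub (l r b l' r' b' : R) : l' <= l -> r <= r' -> b <= b' ->
  box l r b `<=` box l' r' b'.
Proof. by move=> ? ? ? z /andP [/andP [? ?] /andP [? ?]]; rewrite /box /=; lra. Qed.

Lemma inner_sub (l r b x0 u a l' r' b' : R) : 0 <= b -> b < a -> a <= b' -> l' <= l -> r <= r' ->
  l <= x0 -> x0 <= r -> l' - a <= u -> u <= r' + a ->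
  inner l r b x0 u a `<=` box l' r' b'.
Proof.
move=> b0 ba ab ll rr lx xr u1 u2 z [].
- by apply: box_sub => //; lra.
- by move=> [z1 /andP [? ?]]; rewrite /box /= z1; lra.
- by move=> [z2 [/andP [? ?]|/andP [? ?]]]; rewrite /box /= z2; lra.
- by move=> [z1 /andP [? ?]]; rewrite /box /= z1; lra.
Qed.

(* The new loop leaves the box downwards, climbs along the line [u] to the height [1 + a], crosses
   to the line [w] and returns below everything drawn so far. *)
Lemma drawn_loop (k0 : 'I_n) s (l r b l' r' u a : R) d k ks :
  drawn k0 s l r b -> b < a -> a < 2^-1 -> l' <= l -> r <= r' ->
  (if d then k%:R < u < k.+1%:R else k.+1%:R < u < k.+2%:R) ->
  path (adjacent d) k ks -> off_grid u ->
  let w := past d a (last k ks) in let x0 := k0.+1%:R in off_grid w ->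
  l' - a <= u <= r' + a -> l' - a <= w <= r' + a ->
  (u < l - b \/ r + b < u) -> (w < l - b \/ r + b < w) ->
  (u <= x0 -> w < u \/ x0 < w) -> (x0 <= u -> w < x0 \/ u < w) ->
  exists s' b', drawn k0 s' l' r' b' /\ pmap snd s' = pmap snd s ++ k :: ks.
Proof.
move=> [b0 b1 /andP [lx xr] [rt tr la]] ba a1 ll rr hu pth gu w x0 gw.
move=> /andP [u1 u2] /andP [w1 w2] uo wo c1 c2; rewrite -/x0 in lx xr la.
have half : (2^-1 : R) * 2 = 1 by rewrite mulVf.
have [y1 a0 a11] : [/\ 1 < 1 + a, 0 < a & a < 1] by clear - b0 ba a1 half; split; lra.
(* The new margin lies strictly between a and 1/2: the return at height 1 - b' passes below the
   entry at height 1 - a, and room remains for later loops. *)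
pose b' := (a + 2^-1) / 2.
have [ab' b'1 b'2 b'0] : [/\ a < b', b' < 2^-1, b' < 1 & 0 <= b'].
  have b'E : b' * 2 = a + 2^-1 by rewrite divfK.
  by clearbody b'; clear - b'E a0 a1 half; split; lra.
have [rr1 rr2 rr3 rr4] := run_route y1 a0 a11 hu pth.
rewrite -/w in rr2 rr3 rr4.
have x0u : x0 <> u by move=> e; rewrite e in lx xr; clear - b0 lx xr uo; case: uo; lra.
have x0w : x0 <> w by move=> e; rewrite e in lx xr; clear - b0 lx xr wo; case: wo; lra.
have uw : u <> w by move: rr4; clear; case: (d); lra.
have x0E : x0 = k0.+1%:R by [].
clearbody w x0.
pose D := [set z | inner l r b x0 u a z \/ z.2 = 1 + a /\ (u <= z.1 <= w \/ w <= z.1 <= u)].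
have rpost : route D (w, 1 + a) (exit x0 w b') by apply: exit_route.
have rrD : trace (u, 1 + a) (run d a (1 + a) (k :: ks)) `<=` D.
  by move=> z /rr2 [z2 z1]; right; split=> //; move: z1; case: (d); [left | right].
have rrun : route (inner l r b x0 u a) (u, 1 + a) (run d a (1 + a) (k :: ks) ++ exit x0 w b').
  apply: (@route_cat _ _ _ D) => //; last by rewrite rr3.
    apply: route_sub rr1; clear - b0 ba a0 y1 => z [] /=.
    - by move=> /andP [_ /andP [? ?]] ?; lra.
    - by move=> [_ /andP [? ?]] ?; lra.
    - by move=> [? _] ?; lra.
    - by move=> [-> _] _; case: (d).
  by move=> z; left.
have bi := @inner_sub l r b x0 u a l' r' b' b0 ba (ltW ab') ll rr lx xr u1 u2.
have bD : D `<=` box l' r' b'.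
  move=> z [/bi //|[z2 z1]]; rewrite /box /= z2; clear - z1 ab' u1 u2 w1 w2 a0.
  by case: z1 => /andP [? ?]; lra.
exists (s ++ entry x0 u a ++ run d a (1 + a) (k :: ks) ++ exit x0 w b'), b'; split; last first.
  by rewrite !pmap_cat pmap_run /= cats0.
have rall : route (box l r b) (x0, 1 - b) (entry x0 u a ++ run d a (1 + a) (k :: ks) ++ exit x0 w b').
  apply: (@route_cat _ _ _ (inner l r b x0 u a)); last exact: rrun.
  - exact: entry_route.
  - by move=> z; constructor 1.
  - exact: entry_trace.
split=> //.
  by rewrite -x0E (le_trans ll) //= (le_trans xr).
split.
- apply: (@route_cat _ _ _ (box l r b)) => //; last by rewrite la.
- move=> z /trace_cat [/tr|]; first by apply: box_sub => //; apply: ltW; apply: lt_trans ab'.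
  rewrite la => /trace_cat [/(@entry_trace l r b x0 u a b0 ba) /bi //|].
  move=> /trace_cat [/rrD /bD //|]; rewrite rr3.
  move=> [/segm_vertical [z1 z2]|[/segm_horizontal [z2 z1]|->]]; rewrite /box /= ?z1 ?z2; clear uo wo c1 c2.
  + by clear - z2 w1 w2 ab' a0; case: z2 => /andP [? ?]; lra.
  + by clear - z1 w1 w2 ab' a0 lx xr ll rr; case: z1 => /andP [? ?]; lra.
  + by clear - w1 w2 ab' a0 lx xr ll rr; lra.
- by rewrite !map_cat !last_cat /= x0E.
Qed.

(** The box has no point below height 1 - b, so the straight leg from its bottom edge to the base
    point leaves it at once. *)
Lemma drawn_curve (k0 : 'I_n) s l r b : drawn k0 s l r b ->
  exists gamma : R -> pt, [/\ admissible n gamma, non_self_crossing gamma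
                            & itinerary gamma k0 (pmap snd s)].
Proof.
move=> [b0 b1 lr [rt tr la]].
have half : (2^-1 : R) * 2 = 1 by rewrite mulVf.
have nb : (k0.+1%:R, 1 - b) <> (0 : R, 0 : R) by move=> [_]; lra.
have := @route_curve R n k0 (s ++ [:: (base_point R, None)]).
rewrite pmap_cat /= cats0; apply; last by rewrite map_cat last_cat.
apply: (@route_cat _ _ _ (box l r b)) => //; rewrite la; split=> //.
  by apply: leg_low => //; lra.
move=> z [t /andP [t0 t1] ->] nz; rewrite /box /= => /andP [_ /andP [h _]].
by apply: nz; rewrite -[RHS](lerp0 _ (base_point R)); congr lerp; nra.
Qed.

End Stages.

(** * From sequences of reflections to curves *)

Section Reach.
Variables (n : nat) (Q : quiver n) (rel : 'rV[int]_n -> 'rV[int]_n -> Prop).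
Implicit Types (v : 'rV[int]_n) (s us : seq 'I_n).

Definition reflect_all v us := foldl (fun w j => simple_reflection Q j w) v us.

Fixpoint climb v us : Prop :=
  if us is j :: us' then
    rel v (simple_reflection Q j v) /\ climb (simple_reflection Q j v) us'
  else True.

(* [reach s v]: if the vertices in [s] label consecutive marked points, then some curve around
   exactly these points climbs to [v]. *)
Inductive reach : seq 'I_n -> 'rV[int]_n -> Prop :=
| reach_start i : reach [:: i] (simple_root i)
| reach_grow s s0 s1 v : reach s v -> reach (s0 ++ s ++ s1) v
| reach_cross_r s j v : reach s v -> rel v (simple_reflection Q j v) ->
    reach (rcons s j) (simple_reflection Q j v)
| reach_cross_l s j v : reach s v -> rel v (simple_reflection Q j v) ->
    reach (j :: s) (simple_reflection Q j v)
| reach_sweep_r s v : reach s v -> climb v s -> reach s (reflect_all v s)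
| reach_sweep_l s v : reach s v -> climb v (rev s) -> reach s (reflect_all v (rev s)).

Lemma climb_cat v us us' : climb v us -> climb (reflect_all v us) us' -> climb v (us ++ us').
Proof. by elim: us v => //= j us IH v [h1 h2] h3; split=> //; apply: IH. Qed.

Lemma reflect_all_cat v us us' :
  reflect_all v (us ++ us') = reflect_all (reflect_all v us) us'.
Proof. exact: foldl_cat. Qed.

Lemma reach_neq0 s v : reach s v -> s <> [::].
Proof.
elim=> //; first by move=> t [|? ?] s1 w _ //; case: t.
by move=> [|? ?].
Qed.

Lemma climbP (p : 'S_n) k0 ks : climb (simple_root (p k0)) (map p ks) ->
  forall i, (i < size ks)%N ->
    rel (reflected_root Q p k0 ks i) (reflected_root Q p k0 ks i.+1).
Proof.
rewrite /reflected_root; elim: ks (simple_root (p k0)) => [|k ks IH] v //= [h1 h2] [|i] isz /=.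
  by rewrite take0.
exact: IH.
Qed.

Lemma reflected_rootE (p : 'S_n) k0 ks :
  reflected_root Q p k0 ks (size ks) = reflect_all (simple_root (p k0)) (map p ks).
Proof.
rewrite /reflected_root take_size /reflect_all.
by elim: ks (simple_root _) => //= k ks IH v.
Qed.

Variable R : realType.

Lemma off_grid_add (m : nat) (a : R) : 0 < a -> a < 1 -> off_grid (m%:R + a).
Proof.
move=> a0 a1 i e; have : m%:R < i%:R :> R by lra.
have : i%:R < m.+1%:R :> R by rewrite -natr1; lra.
by rewrite !ltr_nat ltnS => h1 h2; move: (leq_trans h2 h1); rewrite ltnn.
Qed.

Lemma off_grid_past d (a : R) (k : 'I_n) : 0 < a -> a < 1 -> off_grid (past d a k).
Proof.
move=> a0 a1; rewrite /past; case: d; first exact: off_grid_add.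
have -> : k.+1%:R - a = k%:R + (1 - a) by rewrite -natr1; ring.
by apply: off_grid_add; lra.
Qed.

Lemma adjacent_rev k (ps : seq 'I_n) : sorted (adjacent true) (k :: ps) ->
  sorted (adjacent false) (rev (k :: ps)).
Proof. by rewrite rev_sorted; apply: sub_sorted => i j. Qed.

Lemma adjacent_bounds (ps : seq 'I_n) k0 x : sorted (adjacent true) ps -> x \in ps ->
  (head k0 ps <= x <= last k0 ps)%N.
Proof.
case: ps => // k ps.
have tr : transitive (fun i j : 'I_n => (i <= j)%N) by move=> i j m; apply: leq_trans.
move=> /(@sub_sorted _ _ (fun i j : 'I_n => (i <= j)%N)) h xs.
have {}h : sorted (fun i j : 'I_n => (i <= j)%N) (k :: ps).
  by apply: h => i j /= /eqP ->; apply: leqnSn.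
apply/andP; split=> /=.
  move: xs; rewrite in_cons => /predU1P [->//|xs].
  by move: h => /= /(order_path_min tr) /allP /(_ _ xs).
case/lastP: ps xs h => [|ps y]; first by rewrite mem_seq1 => /eqP ->.
rewrite -rcons_cons mem_rcons in_cons last_rcons => /predU1P [-> //|xs].
rewrite -rev_sorted rev_rcons /=; move=> /(order_path_min _) /allP.
move=> /(_ _ x); rewrite mem_rev; apply=> //.
by move=> i j m h1 h2; apply: leq_trans h2 h1.
Qed.

Ltac geo := try solve [lra | left; lra | right; lra
  | let h := fresh in move=> h; solve [left; lra | right; lra]].

(** Each constructor costs at most one loop. [reach_grow] only widens the box; the crossing and
    sweeping constructors use vertical lines u and w outside the old box, each at distance a from a
    marked point. *)
Lemma reach_drawn s v : reach s v -> forall (p : 'S_n) (ps : seq 'I_n),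
  map p ps = s -> sorted (adjacent true) ps ->
  exists k0 legs (b : R),
  [/\ drawn k0 legs (head k0 ps).+1%:R (last k0 ps).+1%:R b,
      climb (simple_root (p k0)) (map p (pmap snd legs))
    & reflect_all (simple_root (p k0)) (map p (pmap snd legs)) = v].
Proof.
have half : (2^-1 : R) * 2 = 1 by rewrite mulVf.
have pick (b : R) : 0 <= b -> b < 2^-1 -> exists a, [/\ b < a, a < 2^-1, 0 < a & a < 1].
  move=> b0 b1; exists ((b + 2^-1) / 2).
  have : (b + 2^-1) / 2 * 2 = b + 2^-1 by rewrite divfK.
  by move: ((b + _) / 2) => a aE; clear - aE b0 b1 half; split; lra.
have ext (p : 'S_n) k0 (legs legs' : seq ((R * R) * option 'I_n)) ks w us :
    climb (simple_root (p k0)) (map p (pmap snd legs)) ->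
    reflect_all (simple_root (p k0)) (map p (pmap snd legs)) = w ->
    pmap snd legs' = pmap snd legs ++ ks -> map p ks = us -> climb w us ->
    climb (simple_root (p k0)) (map p (pmap snd legs')) /\
    reflect_all (simple_root (p k0)) (map p (pmap snd legs')) = reflect_all w us.
  move=> h1 h2 -> h4 h5; rewrite map_cat h4 reflect_all_cat h2; split=> //.
  by apply: climb_cat => //; rewrite h2.
elim.
- move=> i p [|k0 [|? ?]] //= [<-] _; exists k0, [::], 0; split=> //; exact: drawn0.
- move=> {}s s0 s1 {}v hr IH p ps e srt.
  have [ps0 [ps' [ps1 [eps e1]]]] : exists ps0 ps' ps1, ps = ps0 ++ ps' ++ ps1 /\ map p ps' = s.
    exists (take (size s0) ps), (take (size s) (drop (size s0) ps)), (drop (size s) (drop (size s0) ps)).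
    rewrite !cat_take_drop; split=> //.
    by rewrite map_take map_drop e drop_size_cat // take_size_cat.
  have srt' : sorted (adjacent true) ps'.
    by move: srt; rewrite eps => /cat_sorted2 [_ /cat_sorted2 []].
  have [k0 [legs [b [h1 h2 h3]]]] := IH p ps' e1 srt'.
  exists k0, legs, b; split=> //.
  have ne : ps' <> [::] by move=> z; apply: (reach_neq0 hr); rewrite -e1 z.
  have sub x : x \in ps' -> x \in ps by rewrite eps !mem_cat => ->; rewrite orbT.
  apply: drawn_grow h1; rewrite ler_nat ltnS.
    have /sub /(adjacent_bounds k0 srt) /andP [//] : head k0 ps' \in ps'.
    by case: (ps') ne => //= x xs _; rewrite mem_head.
  have /sub /(adjacent_bounds k0 srt) /andP [//] : last k0 ps' \in ps'.
  by case: (ps') ne => //= x xs _; rewrite mem_last.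
- move=> {}s j {}v hr IH hrel p ps.
  case/lastP: ps => [|ps q]; first by case: (s).
  rewrite map_rcons => /rcons_inj [e1 e2] srt.
  have srt' : sorted (adjacent true) ps.
    by move: srt; rewrite -cats1 => /cat_sorted2 [].
  have [k0 [legs [b [h1 h2 h3]]]] := IH p ps e1 srt'.
  have [b0 b1 /andP [lx xr] _] := h1; have [a [ba a1 a0 a11]] := pick _ b0 b1.
  have lq : (last k0 ps).+1%:R = q%:R :> R.
    case: (ps) e1 srt => [/= /esym /(reach_neq0 hr) //|x xs] _ /=.
    by rewrite rcons_path => /andP [_ /eqP ->].
  have hq : head k0 (rcons ps q) = head k0 ps.
    by case: (ps) e1 => [/= /esym /(reach_neq0 hr) //|x xs].
  have q1 : q.+1%:R = q%:R + 1 :> R by rewrite -natr1.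
  (* Up between the box and the new ray, over this ray, and down behind it. *)
  have [|||||||||||legs' [b' [h4 h5]]] := @drawn_loop R n k0 legs _ _ b (head k0 ps).+1%:R q.+1%:R
     (q%:R + a) a true q [::] h1 ba a1 (lexx _); rewrite /past /= ?q1 ?lq in lx xr *; geo.
  + exact: off_grid_add.
  + by rewrite -q1; apply: off_grid_add.
  exists k0, legs', b'; rewrite hq last_rcons.
  by have [||g1 g2] := ext p k0 legs legs' [:: q] v [:: j] h2 h3 h5; [rewrite /= e2 | |].
- move=> {}s j {}v hr IH hrel p [|q ps] //= [e2 e1] srt.
  have srt' : sorted (adjacent true) ps by move: srt => /path_sorted.
  have [k0 [legs [b [h1 h2 h3]]]] := IH p ps e1 srt'.
  have [b0 b1 /andP [lx xr] _] := h1; have [a [ba a1 a0 a11]] := pick _ b0 b1.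
  have lq : (head k0 ps).+1%:R = q.+2%:R :> R.
    case: (ps) e1 srt => [/= /esym /(reach_neq0 hr) //|x xs] _ /=.
    by move=> /andP [/eqP -> _].
  have hq : last q ps = last k0 ps.
    by case: (ps) e1 => [/= /esym /(reach_neq0 hr) //|x xs].
  have q2 : q.+2%:R = q%:R + 1 + 1 :> R by rewrite -!natr1.
  have q1 : q.+1%:R = q%:R + 1 :> R by rewrite -natr1.
  have [||||||||||||legs' [b' [h4 h5]]] := @drawn_loop R n k0 legs _ _ b q.+1%:R (last k0 ps).+1%:R
     (q%:R + 1 + 1 - a) a false q [::] h1 ba a1; rewrite /past /= ?q2 ?q1 ?lq ?q2 in lx xr *; geo.
  + have -> : q%:R + 1 + 1 - a = q.+1%:R + (1 - a) by rewrite q1; ring.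
    by apply: off_grid_add; lra.
  + have -> : q%:R + 1 - a = q%:R + (1 - a) by ring.
    by apply: off_grid_add; lra.
  exists k0, legs', b'; rewrite /= -?q1 hq.
  by have [||g1 g2] := ext p k0 legs legs' [:: q] v [:: j] h2 h3 h5; [rewrite /= e2 | |].
- move=> {}s {}v hr IH hc p [|q ps] e srt; first by case: (reach_neq0 hr).
  have [k0 [legs [b [h1 h2 h3]]]] := IH p (q :: ps) e srt.
  have [b0 b1 /andP [lx xr] _] := h1; have [a [ba a1 a0 a11]] := pick _ b0 b1.
  move: h1 lx xr; rewrite [head _ _]/= [last _ _]/= => h1 lx xr.
  have q1 : q.+1%:R = q%:R + 1 :> R by rewrite -natr1.
  (* Up on the left of the box, over all its rays, and down on the right. *)
  have [||||||||||legs' [b' [h4 h5]]] := @drawn_loop R n k0 legs _ _ b q.+1%:R (last q ps).+1%:R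
     (q.+1%:R - a) a true q ps h1 ba a1 (lexx _) (lexx _); rewrite ?q1 in lx xr *; rewrite /past; geo.
  + by [].
  + by rewrite -q1; apply: (@off_grid_past false).
  + exact: (@off_grid_past true).
  exists k0, legs', b'; rewrite /= -?q1.
  by have [||g1 g2] := ext p k0 legs legs' (q :: ps) v s h2 h3 h5.
- move=> {}s {}v hr IH hc p [|q ps] e srt; first by case: (reach_neq0 hr).
  have [k0 [legs [b [h1 h2 h3]]]] := IH p (q :: ps) e srt.
  have [b0 b1 /andP [lx xr] _] := h1; have [a [ba a1 a0 a11]] := pick _ b0 b1.
  move: h1 lx xr; rewrite [head _ _]/= [last _ _]/= => h1 lx xr.
  have rE : rev (q :: ps) = last q ps :: rev (belast q ps) by rewrite lastI rev_rcons.
  have srt' := adjacent_rev srt; rewrite rE in srt'.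
  have lE : last (last q ps) (rev (belast q ps)) = q.
    by rewrite -[LHS]/(last q (last q ps :: rev (belast q ps))) -rE rev_cons last_rcons.
  have m1 : (last q ps).+1%:R = (last q ps)%:R + 1 :> R by rewrite -natr1.
  have m2 : (last q ps).+2%:R = (last q ps)%:R + 1 + 1 :> R by rewrite -!natr1.
  have [||||||||||legs' [b' [h4 h5]]] := @drawn_loop R n k0 legs _ _ b q.+1%:R (last q ps).+1%:R
     (past true a (last q ps)) a false (last q ps) (rev (belast q ps)) h1 ba a1 (lexx _) (lexx _);
     rewrite ?lE /past ?m2 ?m1 in lx xr *; geo.
  + by [].
  + by rewrite -m1; apply: (@off_grid_past true).
  + exact: (@off_grid_past false).
  exists k0, legs', b'; rewrite /= -?m1.
  by have [|||g1 g2] := ext p k0 legs legs' (rev (q :: ps)) v (rev s) h2 h3; rewrite ?map_rev ?e // rE.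
Qed.

Lemma reach_curve s v (p : 'S_n) : reach s v -> s = map p (enum 'I_n) -> ltD 0 v ->
  exists gamma : R -> R * R,
    [/\ admissible n gamma, non_self_crossing gamma,
        monotone_along Q p rel gamma & is_associated_root Q p gamma v].
Proof.
move=> hr e v0.
have srt : sorted (adjacent true) (enum 'I_n).
  have : sorted (fun i j => j == i.+1) (map val (enum 'I_n)).
    rewrite val_enum_ord; case: (n) => // m /=.
    by elim: m 0%N => //= m IH k; rewrite eqxx /=.
  by rewrite sorted_map.
have [k0 [legs [b [h1 h2 h3]]]] := reach_drawn hr (esym e) srt.
have [gamma [g1 g2 g3]] := drawn_curve h1.
exists gamma; split=> //; exists k0, (pmap snd legs); split=> //.
  exact: climbP.
by rewrite reflected_rootE h3; split=> //; left.
Qed.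

End Reach.

(** * Positive roots *)

Section Roots.
Variables (n : nat) (Q : quiver n).
Implicit Types (u v w : 'rV[int]_n) (i j : 'I_n).

(** The value of the simple coroot of i at v. *)
Definition pair v i : int := \sum_j cartan_mx Q i j * v 0 j.

Lemma simple_reflectionE i v : simple_reflection Q i v = v - pair v i *: simple_root i.
Proof.
rewrite /simple_reflection.
under eq_bigr => j _ do rewrite scalerBr scalerA.
rewrite sumrB -row_sum_delta; congr (_ - _).
by rewrite -scaler_suml; congr (_ *: _); apply: eq_bigr => j _; rewrite mulrC.
Qed.

Lemma simple_rootE i j : (simple_root i : 'rV[int]_n) 0 j = (i == j)%:R.
Proof. by rewrite mxE eqxx eq_sym. Qed.

Lemma pairD u v i : pair (u + v) i = pair u i + pair v i.
Proof. by rewrite -big_split /=; apply: eq_bigr => j _; rewrite [(u + v) 0 j]mxE mulrDr. Qed.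

Lemma pairZ a v i : pair (a *: v) i = a * pair v i.
Proof. by rewrite mulr_sumr; apply: eq_bigr => j _; rewrite [(a *: v) 0 j]mxE mulrCA. Qed.

Lemma pair_simple j i : pair (simple_root j) i = cartan_mx Q i j.
Proof.
rewrite /pair (bigD1 j) //= simple_rootE eqxx mulr1 big1 ?addr0 // => m /negbTE ne.
by rewrite simple_rootE eq_sym ne mulr0.
Qed.

Lemma cartan_sym i j : cartan_mx Q i j = cartan_mx Q j i.
Proof. by rewrite !mxE eq_sym; case: eqP => // _; rewrite distrC. Qed.

Lemma cartan_diag i : cartan_mx Q i i = 2.
Proof. by rewrite mxE eqxx. Qed.

(** The symmetric form of the Cartan matrix. On the diagonal it is twice the Tits form, so roots
    have the value 2. *)
Definition form u v : int := \sum_i u 0 i * pair v i.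

Lemma formC u v : form u v = form v u.
Proof.
rewrite /form /pair.
under eq_bigr => i _ do rewrite mulr_sumr.
under [RHS]eq_bigr => i _ do rewrite mulr_sumr.
rewrite exchange_big; apply: eq_bigr => i _; apply: eq_bigr => j _.
by rewrite cartan_sym mulrCA mulrA [RHS]mulrCA mulrA mulrAC.
Qed.

Lemma form_simple i v : form (simple_root i) v = pair v i.
Proof.
rewrite /form (bigD1 i) //= simple_rootE eqxx mul1r big1 ?addr0 // => m /negbTE ne.
by rewrite simple_rootE eq_sym ne mul0r.
Qed.

Lemma formDl u v w : form (u + v) w = form u w + form v w.
Proof. by rewrite -big_split /=; apply: eq_bigr => j _; rewrite mxE mulrDl. Qed.

Lemma formZl a u v : form (a *: u) v = a * form u v.
Proof. by rewrite mulr_sumr; apply: eq_bigr => j _; rewrite mxE mulrA. Qed.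

Lemma form_shift a i v :
  form (v + a *: simple_root i) (v + a *: simple_root i) = form v v + 2 * a * pair v i + 2 * a ^+ 2.
Proof.
rewrite formDl formZl form_simple formC formDl formZl form_simple pairD pairZ pair_simple.
rewrite cartan_diag; ring.
Qed.

Lemma form_reflection i v : form (simple_reflection Q i v) (simple_reflection Q i v) = form v v.
Proof. by rewrite simple_reflectionE -scaleNr form_shift; ring. Qed.

Definition posroot v : Prop := (forall i, 0 <= v 0 i) /\ form v v = 2.

Definition posdef : Prop := forall v, v <> 0 -> 0 < form v v.

Lemma reflect_all_form v us : form (reflect_all Q v us) (reflect_all Q v us) = form v v.
Proof. by elim: us v => //= i us IH v; rewrite IH form_reflection. Qed.

Lemma associated_root_posroot (R : realType) s (gamma : R -> R * R) v :
  is_associated_root Q s gamma v -> posroot v.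
Proof.
move=> [k0 [ks [_ [vE [v0 _]]]]]; split=> [i|]; first by have := v0 i; rewrite mxE.
have e : form (simple_root (s k0)) (simple_root (s k0)) = 2.
  by rewrite form_simple pair_simple cartan_diag.
case: vE => ->; rewrite reflected_rootE; last rewrite -scaleN1r formZl formC formZl mulrA mulrNN !mul1r;
by rewrite reflect_all_form.
Qed.

Lemma posroot_ltD v : posroot v -> ltD 0 v.
Proof.
move=> [v0 v2]; split=> [i|]; first by rewrite mxE.
apply: contrapT => h; have : v = 0.
  apply/rowP => i; rewrite mxE; apply/eqP; rewrite eq_le v0 andbT leNgt.
  by apply/negP => vi; apply: h; exists i; rewrite mxE.
move=> z; move: v2; rewrite z /form big1 // => i _; by rewrite mxE mul0r.
Qed.

Lemma posroot_sub v i : posroot v -> pair v i = 1 -> 0 < v 0 i -> posroot (v - simple_root i).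
Proof.
move=> [v0 v2] p1 vi; split=> [j|].
  rewrite !mxE eqxx /= subr_ge0; case: eqP => [->|_]; [by lia | exact: v0].
by rewrite -scaleN1r form_shift v2 p1.
Qed.

(** The products of [v 0 i] and [pair v i] add up to 2, so one of them is positive. The form at v -
    alpha_i is 4 - 2 [pair v i], which is positive unless v = alpha_i; hence the pairing is 1. *)
Lemma posroot_down v : posdef -> posroot v ->
  (exists i, v = simple_root i) \/ exists i, pair v i = 1 /\ 0 < v 0 i.
Proof.
move=> pd hv; have [v0 v2] := hv.
have [i vi] : exists i, 0 < v 0 i * pair v i.
  apply: contrapT => h; have : form v v <= 0.
    by apply: sumr_le0 => i _; rewrite leNgt; apply/negP => hi; apply: h; exists i.
  by rewrite v2.
have vi0 : 0 < v 0 i.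
  by rewrite lt_neqAle v0 andbT; apply/eqP => e; move: vi; rewrite -e mul0r ltxx.
have pi0 : 0 < pair v i by rewrite -(pmulr_rgt0 _ vi0).
have [->|ne] := pselect (v = simple_root i); first by left; exists i.
right; exists i; split=> //.
have /pd : v - simple_root i <> 0 by move=> /eqP; rewrite subr_eq0 => /eqP.
by rewrite -scaleN1r form_shift v2; lia.
Qed.

Definition height v : nat := (\sum_i `|(v 0%R i : int)|)%N.

(** The induction hypothesis covers all smaller roots, not just those of height one less: in type D
    two simple roots are removed at once. *)
Lemma posroot_ind (P : 'rV[int]_n -> Prop) : posdef -> (forall i, P (simple_root i)) ->
  (forall v, posroot v -> (exists i, pair v i = 1 /\ 0 < v 0 i) ->
     (forall w, posroot w -> leD w v -> w <> v -> P w) -> P v) ->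
  forall v, posroot v -> P v.
Proof.
move=> pd P1 PS v; have [m] := ubnP (height v); elim: m v => // m IH v hm hv.
have [[i ->] //|hi] := posroot_down pd hv.
apply: PS => // w hw wv ne; apply: IH => //; rewrite ltnS in hm; apply: leq_trans hm.
have [i neq] : exists i, w 0 i <> v 0 i.
  by apply: contrapT => h; apply: ne; apply/rowP => i; apply: contrapT => hh; apply: h; exists i.
rewrite /height (bigD1 i) //= [X in (_ < X)%N](bigD1 i) //= -addSn leq_add //.
  by have := wv i; have := hw.1 i; lia.
by apply: leq_sum => j _; have := wv j; have := hw.1 j; lia.
Qed.

Lemma reflection_up v i : pair v i = -1 -> simple_reflection Q i v = v + simple_root i.
Proof. by move=> p; rewrite simple_reflectionE p scaleN1r opprK. Qed.

Lemma reflection_fix v i : pair v i = 0 -> simple_reflection Q i v = v.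
Proof. by move=> p; rewrite simple_reflectionE p scale0r subr0. Qed.

Lemma leD_refl v : leD v v. Proof. by []. Qed.

Lemma ltD_up v i : ltD v (v + simple_root i).
Proof.
split; first by move=> j; rewrite !mxE lerDl; case: eqP.
by exists i; rewrite !mxE !eqxx ltrDl.
Qed.

(* A sweep whose only effect is to raise the coefficient of [i]. *)
Lemma climb_once v s i : uniq s -> i \in s -> pair v i = -1 ->
  (forall x, x \in s -> x != i -> (index x s < index i s)%N -> pair v x = 0) ->
  (forall x, x \in s -> x != i -> (index i s < index x s)%N -> pair (v + simple_root i) x = 0) ->
  climb Q (@leD n) v s /\ reflect_all Q v s = v + simple_root i.
Proof.
move=> us iis pi; case/splitPr: iis us => s1 s2; rewrite cat_uniq /= => /and3P [u1 u2 /andP [u3 u4]].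
have i1 : i \notin s1 by apply: contraNN u2 => h; rewrite h.
move=> h1 h2.
have fix_all w t : (forall x, x \in t -> pair w x = 0) ->
    climb Q (@leD n) w t /\ reflect_all Q w t = w.
  elim: t => //= x t IHt ht; have px : pair w x = 0 by rewrite ht // mem_head.
  rewrite reflection_fix //; have [|g1 g2] := IHt; last by split; [split; [exact: leD_refl|] |].
  by move=> y yt; apply: ht; rewrite in_cons yt orbT.
have idx : index i (s1 ++ i :: s2) = size s1 by rewrite index_cat (negbTE i1) /= eqxx addn0.
have [|c1 r1] := fix_all v s1.
  move=> x xs; apply: h1; rewrite ?mem_cat ?xs //; first by apply: contraNneq i1 => <-.
  by rewrite idx index_cat xs index_mem.
have [|c2 r2] := fix_all (v + simple_root i) s2.
  move=> x xs; have xi : x != i by apply: contraNneq u3 => <-.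
  apply: h2; rewrite ?mem_cat ?in_cons ?xs ?orbT //.
  rewrite idx index_cat ifN; last first.
    by apply: contraNN u2 => h; apply/orP; right; apply/hasP; exists x.
  by rewrite /= eq_sym (negbTE xi) -addn1 leq_add2l.
split.
  apply: climb_cat => //=; rewrite r1 reflection_up //; split=> //.
  exact: (ltD_up _ _).1.
by rewrite reflect_all_cat r1 /= reflection_up.
Qed.

End Roots.

Lemma sub_simple_root n (u : 'rV[int]_n) i :
  leD (u - simple_root i) u /\ u - simple_root i <> u.
Proof.
split; first by have := (ltD_up (u - simple_root i) i).1; rewrite subrK.
move=> /esym /eqP; rewrite -subr_eq0 opprB addrC subrK => /eqP /rowP /(_ i).
by rewrite !mxE !eqxx.
Qed.

(** * Quivers of tree type *)

Section Trees.
Variables (n : nat) (Q : quiver n) (s0 : 'S_n) (par : nat -> nat).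

(* Every label but 0 has a parent with a smaller label. *)
Definition nb : rel 'I_n := fun i j =>
  ((0 < j)%N && (i == par j :> nat)) || ((0 < i)%N && (j == par i :> nat)).

Definition arr (i j : 'I_n) : nat := arrows_between Q (s0 i) (s0 j).

Definition tree_diagram : Prop :=
  (forall j, (0 < j < n)%N -> (par j < j)%N) /\
  (forall i j, (arr i j + arr j i)%N = nb i j).

Hypothesis tree : tree_diagram.
Let par_lt := tree.1.
Let arrE := tree.2.
Implicit Types (i j x y t : 'I_n) (s : seq 'I_n) (v : 'rV[int]_n).

Lemma nb_sym i j : nb i j = nb j i.
Proof. by rewrite /nb orbC. Qed.

Lemma nb_irr i : nb i i = false.
Proof.
rewrite /nb orbb; apply/negbTE/negP => /andP [i0 /eqP e].
by have := @par_lt i; rewrite i0 ltn_ord -e ltnn => /(_ isT).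
Qed.

Lemma arr_dir i j : nb i j -> (arr i j = 1 /\ arr j i = 0)%N \/ (arr i j = 0 /\ arr j i = 1)%N.
Proof. by move=> h; have := arrE i j; rewrite h; lia. Qed.

Lemma arr0 i j : ~~ nb i j -> arr i j = 0%N.
Proof. by move=> /negbTE h; have := arrE i j; rewrite h; lia. Qed.

Lemma cartan_label i j :
  cartan_mx Q (s0 i) (s0 j) = if i == j then 2 else - (nb i j)%:R.
Proof.
rewrite mxE (inj_eq perm_inj); case: eqP => // ne; rewrite mxE -/(arr i j) -/(arr j i).
have := arrE i j; case: (nb i j) => /= e; congr (- _); lia.
Qed.

Lemma pair_label v i :
  pair Q v (s0 i) = 2 * v 0 (s0 i) - \sum_(j | nb i j) v 0 (s0 j).
Proof.
rewrite /pair (reindex_inj (@perm_inj _ s0)) /= (bigD1 i) //= cartan_diag; congr (_ + _).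
rewrite -sumrN [RHS]big_mkcond [LHS]big_mkcond; apply: eq_bigr => j _.
rewrite cartan_label eq_sym; case: eqP => [->|_] /=; first by rewrite nb_irr.
by case: (nb i j); rewrite ?mulN1r ?mulNr ?mul0r ?oppr0.
Qed.

Definition root_at i : 'rV[int]_n := simple_root (s0 i).

Lemma root_atE i j : (root_at i) 0 (s0 j) = (i == j)%:R.
Proof. by rewrite simple_rootE (inj_eq perm_inj). Qed.

Lemma pair_root_at i j : pair Q (root_at i) (s0 j) = if i == j then 2 else - (nb i j)%:R.
Proof. by rewrite pair_simple cartan_label eq_sym nb_sym. Qed.

(** Connectedness in a rooted tree: a top element [t], and with every other element also its
    parent. *)
Definition conn s : Prop := exists2 t, t \in s &
  forall x, x \in s -> x != t -> (0 < x)%N /\ exists2 y, y \in s & y = par x :> nat.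

Definition attach s j : Prop := j \notin s /\
  exists i, [/\ i \in s, nb i j & forall x, x \in s -> nb x j -> x = i].

(** In an admissible order no arrow points to the left, so j goes to the right end unless it has an
    arrow into [s]. *)
Definition join s j := if all (fun x => arr j x == 0%N) s then rcons s j else j :: s.

Definition arr_sorted s := pairwise (fun i j => arr j i == 0%N) s.

Lemma mem_join s j x : (x \in join s j) = (x == j) || (x \in s).
Proof. by rewrite /join; case: ifP => _; rewrite ?mem_rcons in_cons. Qed.

Lemma join_uniq s j : j \notin s -> uniq (join s j) = uniq s.
Proof. by move=> h; rewrite /join; case: ifP => _; rewrite ?rcons_uniq /= h. Qed.

(** If j goes to the left because of an arrow to x, then x is its only neighbour in [s], and no
    arrow leads back from x. *)
Lemma join_sorted s j : attach s j -> arr_sorted s -> arr_sorted (join s j).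
Proof.
move=> [_ [i [is_ nij uni]]] ss; rewrite /join; case: ifP => [al|/negbT /allPn [x xs ax]].
  rewrite /arr_sorted in ss *; rewrite -cats1 pairwise_cat ss /= andbT.
  by apply/allrelP => x y xs; rewrite mem_seq1 => /eqP ->; apply: (allP al).
rewrite /arr_sorted /= -/(arr_sorted s) ss andbT; apply/allP => y ys.
have [nyj|/arr0 -> //] := boolP (nb y j).
have yx : y = x.
  rewrite (uni y) // (uni x) //; apply: contraNT ax; rewrite nb_sym => h; by rewrite arr0.
by have := arr_dir nyj; rewrite yx; move: ax; case: (arr j x) => // ? _; case=> -[] // ->.
Qed.

(** Either the neighbour i is the parent of j, or j is the parent of i. In the second case the
    parent of i is missing from [s], so i is the top, and j becomes the new top. *)
Lemma join_conn s j : attach s j -> conn s -> conn (join s j).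
Proof.
move=> [js [i [is_ nij uni]]] [t ts ht]; move: (nij); rewrite /nb => /orP [] /andP [p0 /eqP ep].
  exists t; first by rewrite mem_join ts orbT.
  move=> x; rewrite mem_join => /predU1P [-> _|xs xt].
    by split=> //; exists i => //; rewrite mem_join is_ orbT.
  by have [h [y ys e]] := ht x xs xt; split=> //; exists y => //; rewrite mem_join ys orbT.
have it : i = t.
  apply/eqP; apply: contraNT js => /(ht _ is_) [_ [y ys e]].
  by rewrite (_ : j = y) //; apply: val_inj => /=; rewrite e ep.
exists j; first by rewrite mem_join eqxx.
move=> x; rewrite mem_join => /predU1P [->|xs _]; first by rewrite eqxx.
have [->|xt] := eqVneq x t.
  by rewrite -it; split=> //; exists j => //; rewrite mem_join eqxx.
by have [h [y ys e]] := ht x xs xt; split=> //; exists y => //; rewrite mem_join ys orbT.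
Qed.

(* The parent of the top of [s] can be attached, or else the least label outside [s]. *)
Lemma conn_attach s : conn s -> (exists j, j \notin s) -> exists j, attach s j.
Proof.
move=> [t ts ht] [j js].
have tmin x : x \in s -> (t <= x)%N.
  have [m] := ubnP (val x); elim: m x => // m IH x xm xs.
  have [->//|/(ht _ xs) [x0 [y ys e]]] := eqVneq x t.
  have yx : (y < x)%N by rewrite e par_lt // x0 ltn_ord.
  by apply: leq_trans (ltnW yx); apply: IH => //; apply: leq_trans yx _; rewrite -ltnS.
have [t0|t0] := posnP t.
  case: (@arg_minnP _ j (fun x => x \notin s) val js) => x xs xmin.
  have x0 : (0 < x)%N.
    rewrite lt0n; apply: contraNneq xs => x0; rewrite (_ : x = t) //.
    by apply: val_inj; rewrite /= x0 t0.
  have px : (par x < x)%N by rewrite par_lt // x0 ltn_ord.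
  pose y := Ordinal (ltn_trans px (ltn_ord x)).
  have ys : y \in s by apply: contraT => /xmin; rewrite leqNgt px.
  exists x; split=> //; exists y; split=> //; first by rewrite /nb x0 eqxx.
  move=> z zs /orP [] /andP [z0 /eqP ez]; first exact: val_inj.
  have zt : z != t by apply: contraTneq z0 => ->; rewrite t0.
  have [_ [w ws ew]] := ht _ zs zt.
  by case/negP: xs; rewrite (_ : x = w) //; apply: val_inj; rewrite /= ez ew.
have pt : (par t < t)%N by rewrite par_lt // t0 ltn_ord.
pose p := Ordinal (ltn_trans pt (ltn_ord t)).
have ps : p \notin s by apply/negP => /tmin /=; rewrite leqNgt pt.
exists p; split=> //; exists t; split=> //; first by rewrite /nb t0 eqxx orbT.
move=> x xs /orP [] /andP [x0 /eqP ex].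
  have /par_lt : (0 < p < n)%N by rewrite x0 ltn_ord.
  by rewrite -ex ltnNge (leq_trans (ltnW pt) (tmin _ xs)).
apply/eqP; apply: contraNT ps => /(ht _ xs) [_ [y ys e]].
by rewrite (_ : p = y) //; apply: val_inj; rewrite /= e -ex.
Qed.

Section Climbing.
Variable rel : 'rV[int]_n -> 'rV[int]_n -> Prop.

Definition ok s v : Prop :=
  [/\ reach Q rel (map s0 s) v, uniq s, arr_sorted s & conn s].

Lemma ok1 i : ok [:: i] (root_at i).
Proof.
split=> //; first exact: reach_start.
by exists i; rewrite ?mem_head // => x; rewrite mem_seq1 => ->.
Qed.

Lemma ok_grow s j v : ok s v -> attach s j -> ok (join s j) v.
Proof.
move=> [h1 h2 h3 h4] at_; split; rewrite ?join_uniq //; [| by case: at_ | exact: join_sorted | exact: join_conn].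
rewrite /join; case: ifP => _; last by have := reach_grow [:: s0 j] [::] h1; rewrite cats0.
by rewrite -cats1 map_cat; exact: (reach_grow [::] [:: s0 j] h1).
Qed.

Lemma ok_cross s j v : ok s v -> attach s j -> rel v (simple_reflection Q (s0 j) v) ->
  ok (join s j) (simple_reflection Q (s0 j) v).
Proof.
move=> [h1 h2 h3 h4] at_ hr; split; rewrite ?join_uniq //; [| by case: at_ | exact: join_sorted | exact: join_conn].
rewrite /join; case: ifP => _; last exact: reach_cross_l.
by rewrite map_rcons; apply: reach_cross_r.
Qed.

Lemma ok_sweep (d : bool) s v : let us := map s0 (if d then s else rev s) in
  ok s v -> climb Q rel v us -> ok s (reflect_all Q v us).
Proof.
move=> us [h1 h2 h3 h4]; rewrite {}/us; case: d => hc; split=> //; first exact: reach_sweep_r.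
by rewrite map_rev in hc *; apply: reach_sweep_l.
Qed.

(** The missing vertices are placed without crossing their rays, which completes the order and
    leaves the root alone. *)
Lemma ok_full s v : ok s v -> exists s', ok s' v /\ forall x, x \in s'.
Proof.
have [m] := ubnP (n - size s); elim: m s => // m IH s hm hok.
have [_ us _ cs] := hok.
have [[j js]|al] := pselect (exists j, j \notin s); last first.
  by exists s; split=> // x; apply: contraT => xs; case: al; exists x.
have [i ai] := conn_attach cs (ex_intro _ j js).
apply: (IH (join s i)); last exact: ok_grow.
have sz : (size (join s i)) = (size s).+1 by rewrite /join; case: ifP; rewrite ?size_rcons.
have : (size (join s i) <= n)%N.
  have /card_uniqP <- : uniq (join s i) by rewrite join_uniq //; case: ai.
  by rewrite -[X in (_ <= X)%N]card_ord max_card.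
by move: hm; rewrite sz; lia.
Qed.

Lemma full_order s : uniq s -> arr_sorted s -> (forall x, x \in s) ->
  exists p : 'S_n, P_ Q p /\ map s0 s = map p (enum 'I_n).
Proof.
move=> us ss al.
have sz : size s = n.
  have -> : size s = size (enum 'I_n).
    by apply: perm_size; apply: uniq_perm => //; [exact: enum_uniq | move=> x; rewrite mem_enum al].
  by rewrite size_enum_ord.
have nth_inj : injective (fun i : 'I_n => nth i s i).
  move=> i j /eqP; rewrite (set_nth_default i j) ?sz //.
  by rewrite nth_uniq ?sz // => /eqP /val_inj.
pose p : 'S_n := (perm nth_inj * s0)%g.
have pE i : p i = s0 (nth i s i) by rewrite permM permE.
exists p; split.
  move=> a b ba [x [e1 e2]].
  have /(pairwiseP a) : arr_sorted s by [].
  move=> /(_ b a); rewrite !inE sz => /(_ (ltn_ord b) (ltn_ord a) ba).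
  rewrite /arr (set_nth_default b) ?sz // [nth a s b](set_nth_default b) ?sz // (set_nth_default a b) ?sz //.
  rewrite -!pE /arrows_between => /eqP /card0_eq /(_ x).
  by rewrite !inE e1 e2 !eqxx.
have -> : map p (enum 'I_n) = map s0 (map (fun i : 'I_n => nth i s i) (enum 'I_n)).
  by elim: (enum _) => //= x l ->; rewrite pE.
congr map.
case: (s) sz {pE p nth_inj us ss al} => [|x s'] sz.
  by apply/esym/size0nil; rewrite size_map size_enum_ord -sz.
apply: (@eq_from_nth _ x); first by rewrite size_map size_enum_ord.
move=> i; rewrite sz => isz; rewrite (nth_map x) ?size_enum_ord // nth_enum_ord //.
by apply: set_nth_default; rewrite sz.
Qed.

End Climbing.
End Trees.

Definition realized (R : realType) n (Q : quiver n) (rel : 'rV[int]_n -> 'rV[int]_n -> Prop)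
    (v : 'rV[int]_n) : Prop :=
  exists2 p : 'S_n, P_ Q p & exists gamma : R -> R * R,
    [/\ admissible n gamma, non_self_crossing gamma,
        monotone_along Q p rel gamma & is_associated_root Q p gamma v].

(** * Coordinates along a labelled tree *)

Section Labels.
Variables (n : nat) (Q : quiver n) (s0 : 'S_n) (par : nat -> nat).
Hypothesis tree : tree_diagram Q s0 par.
Implicit Types (i j x y t : 'I_n) (s : seq 'I_n) (u v w : 'rV[int]_n).
Local Notation nb := (nb par).
Local Notation root_at := (root_at s0).

(** Indexed by all natural numbers, with the default 0 beyond the last label, so that sums along an
    arm can be manipulated without ordinals. *)
Definition coef v (m : nat) : int := if insub m is Some i then v 0 (s0 i) else 0.

Lemma coef_ord v i : coef v i = v 0 (s0 i).
Proof. by rewrite /coef valK. Qed.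

Lemma coef_out v m : (n <= m)%N -> coef v m = 0.
Proof. by move=> h; rewrite /coef insubF // ltnNge h. Qed.

Lemma coef_ge0 v m : posroot Q v -> 0 <= coef v m.
Proof. by move=> [v0 _]; rewrite /coef; case: insub. Qed.

Lemma coef_inj u v : (forall m, (m < n)%N -> coef u m = coef v m) -> u = v.
Proof.
move=> h; apply/rowP => i; have := h ((s0^-1)%g i) (ltn_ord _).
by rewrite !coef_ord permKV.
Qed.

Lemma coef_eq0 v : (forall m, (m < n)%N -> coef v m = 0) -> v = 0.
Proof.
move=> h; apply: coef_inj => m mn; rewrite h //.
by rewrite /coef; case: insub => // x; rewrite mxE.
Qed.

(** Every edge joins a label to its parent, so it is counted once, at the child. *)
Lemma form_label v : form Q v v =
  2 * (\sum_(0 <= m < n) coef v m ^+ 2)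
  - 2 * (\sum_(0 <= m < n | (0 < m)%N) coef v m * coef v (par m)).
Proof.
have par_lt := tree.1.
rewrite /form (reindex_inj (@perm_inj _ s0)) /=.
under eq_bigr => i _ do rewrite (pair_label tree) mulrBr.
rewrite sumrB; congr (_ - _).
  rewrite big_mkord mulr_sumr; apply: eq_bigr => i _.
  by rewrite coef_ord; ring.
have split_nb i j : nb i j ->
   ((0 < j)%N && (i == par j :> nat)) != ((0 < i)%N && (j == par i :> nat)).
  rewrite /nb; case: andP => [[j0 /eqP e1]|_]; case: andP => [[i0 /eqP e2]|_] //= _.
  have := par_lt j; have := par_lt i; rewrite i0 j0 !ltn_ord -e1 -e2 => /(_ isT) h1 /(_ isT) h2.
  by move: (ltn_trans h1 h2); rewrite ltnn.
pose c i j : int := v 0 (s0 i) * v 0 (s0 j).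
have step : \sum_(i < n) \sum_(j < n) (if nb i j then c i j else 0) =
    \sum_(i < n) \sum_(j < n) (if (0 < j)%N && (i == par j :> nat) then c i j else 0) +
    \sum_(i < n) \sum_(j < n) (if (0 < i)%N && (j == par i :> nat) then c i j else 0).
  rewrite -big_split; apply: eq_bigr => i _; rewrite -big_split; apply: eq_bigr => j _ /=.
  have := split_nb i j; rewrite /nb.
  by case: (X in X || _); case: (X in _ || X) => //= h; rewrite ?addr0 ?add0r //; have := h isT.
have -> : \sum_(i < n) v 0 (s0 i) * (\sum_(j | nb i j) v 0 (s0 j)) =
    \sum_(i < n) \sum_(j < n) (if nb i j then c i j else 0).
  by apply: eq_bigr => i _; rewrite mulr_sumr big_mkcond.
rewrite step [X in X + _ = _]exchange_big /=.
have -> : \sum_(j < n) \sum_(i < n) (if (0 < j)%N && (i == par j :> nat) then c i j else 0) =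
          \sum_(i < n) \sum_(j < n) (if (0 < i)%N && (j == par i :> nat) then c i j else 0).
  by apply: eq_bigr => j _; apply: eq_bigr => i _; rewrite /c mulrC.
have dbl (a : int) : a + a = 2 * a by ring.
rewrite dbl; congr (_ * _).
rewrite [RHS]big_mkcond big_mkord; apply: eq_bigr => i _.
case: ifP => i0; last by rewrite big1.
have pl : (par i < n)%N by apply: ltn_trans (par_lt _ _) (ltn_ord i); rewrite i0 ltn_ord.
rewrite (bigD1 (Ordinal pl)) //= eqxx big1 ?addr0; last first.
  by move=> j /eqP jn; case: eqP => // e; case: jn; exact: val_inj.
by rewrite /c coef_ord -[par i]/(val (Ordinal pl)) coef_ord.
Qed.

(** The list is exactly the support of v; this turns a pairing into information about neighbours in
    the list. *)
Definition okS rel s v : Prop := ok Q s0 par rel s v /\ forall x, (x \in s) = (v 0 (s0 x) != 0).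

Lemma sum1_unique (P : pred 'I_n) (F : 'I_n -> int) : (forall x, 0 <= F x) ->
  \sum_(x | P x) F x = 1 -> exists x, [/\ P x, F x = 1 & forall y, P y -> y != x -> F y = 0].
Proof.
move=> F0 e; have [x Px Fx] : exists2 x, P x & F x != 0.
  apply: contrapT => h; move: e; rewrite big1 // => x Px; apply/eqP; apply: contraT => hx.
  by case: h; exists x.
exists x; move: e; rewrite (bigD1 x) //=; set S := \sum_(_ | _) _ => e.
have S0 : 0 <= S by apply: sumr_ge0.
have Fx1 : F x = 1 by have := F0 x; move: Fx e S0; lia.
split=> // y Py yx; have : S = 0 by lia.
by move=> /eqP; rewrite psumr_eq0 // => /allP /(_ y); rewrite mem_index_enum Py yx => /(_ isT) /eqP.
Qed.

(** The root w = v - alpha_j vanishes at j and has pairing -1 there, so its coefficients at the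
    neighbours of j add up to 1. Being nonnegative integers, exactly one of them is nonzero, which
    makes j attachable. *)
Lemma thin_step rel s v j : (forall u i, rel u (u + simple_root i)) ->
  posroot Q v -> pair Q v (s0 j) = 1 -> v 0 (s0 j) = 1 ->
  okS rel s (v - root_at j) -> okS rel (join Q s0 s j) v.
Proof.
move=> hrel hv pv vj [hok sup]; set w := v - root_at j in hok sup.
have w0 x : 0 <= w 0 (s0 x) by apply: (posroot_sub hv pv _).1; rewrite vj.
have wj : w 0 (s0 j) = 0 by rewrite !mxE -/(root_at j) -[X in _ - X]/(_) vj !eqxx.
have pw : pair Q w (s0 j) = -1.
  by rewrite pairD pv -scaleN1r pairZ (pair_root_at tree) eqxx.
have js : j \notin s by rewrite sup wj eqxx.
have at_ : attach par s j.
  have := pair_label tree w j; rewrite pw wj mulr0 sub0r => /oppr_inj /esym.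
  move=> /(sum1_unique w0) [x [jx wx uni]]; split=> //; exists x; split.
  - by rewrite sup wx.
  - by rewrite nb_sym.
  - by move=> y; rewrite sup nb_sym => wy jy; apply/eqP; apply: contraNT wy => /(uni _ jy) ->.
have rE : simple_reflection Q (s0 j) w = v by rewrite reflection_up // subrK.
have [h1 h2 h3 h4] : ok Q s0 par rel (join Q s0 s j) v.
  have := ok_cross tree hok at_; rewrite rE; apply.
  by rewrite -[X in rel _ X](subrK (root_at j)); apply: hrel.
split=> // x; rewrite mem_join sup; case: eqP => [->|/eqP xj]; first by rewrite vj.
by rewrite !mxE eqxx /= (inj_eq perm_inj) (negbTE xj) subr0.
Qed.

Lemma okS1 rel i : okS rel [:: i] (root_at i).
Proof.
split; first exact: ok1.
by move=> x; rewrite root_atE mem_seq1 eq_sym; case: (i == x).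
Qed.

(* If all coefficients are at most 1, a root grows one vertex at a time. *)
Lemma thin_okS rel : (forall u i, rel u (u + simple_root i)) -> posdef Q ->
  (forall v m, posroot Q v -> coef v m <= 1) -> forall v, posroot Q v -> exists s, okS rel s v.
Proof.
move=> hrel pd thin; apply: posroot_ind => // [i|v hv [i [pi vi]] IH].
  by exists [:: ((s0^-1)%g i)]; have := okS1 rel ((s0^-1)%g i); rewrite /root_at permKV.
pose j := (s0^-1)%g i; have ij : i = s0 j by rewrite permKV.
have vi1 : v 0 i = 1 by have := thin v j hv; rewrite coef_ord -ij; lia.
have hw := posroot_sub hv pi vi.
have [le ne] := sub_simple_root v i.
have [s hs] := IH _ hw le ne.
by exists (join Q s0 s j); apply: thin_step; rewrite -?ij // /root_at -ij.
Qed.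

Lemma ok_realized (R : realType) rel s v : ok Q s0 par rel s v -> posroot Q v ->
  realized R Q rel v.
Proof.
move=> hok hv; have [s' [[h1 h2 h3 _] al]] := ok_full tree hok.
have [p [hp e]] := full_order h2 h3 al.
by exists p => //; apply: reach_curve h1 e (posroot_ltD hv).
Qed.

End Labels.

(** * Spirals *)

Section Exploration.
Variables (k : nat) (adj : nat -> seq nat) (ori : nat -> nat -> bool).
Implicit Types (u : seq nat) (s us : seq nat) (a b : nat).

Local Open Scope nat_scope.

Definition nsum u a := sumn [seq nth 0 u b | b <- adj a].

(** A reflection replaces a coefficient by the sum at its neighbours minus itself; a step that would
    decrease it is rejected, so the subtraction is never truncated. *)
Fixpoint nclimb u us : option (seq nat) :=
  if us is a :: us' then
    if 2 * nth 0 u a <= nsum u a then nclimb (set_nth 0 u a (nsum u a - nth 0 u a)) us' else None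
  else Some u.

Definition njoin s a := if all (fun x => ~~ ori a x) s then rcons s a else a :: s.

Definition nattach s a := (a \notin s) && (count (fun b => b \in s) (adj a) == 1).

Definition keep_order s (o : option (seq nat)) : seq (seq nat * seq nat) :=
  if o is Some u then [:: (s, u)] else [::].

(** A vertex attached at the end towards which the sweeps run is crossed at once; one attached at
    the other end is only enclosed, and is first crossed by a later sweep. *)
Definition attach_dir (d : bool) (q : seq nat * seq nat) a : seq (seq nat * seq nat) :=
  if nattach q.1 a then
    let s := njoin q.1 a in
    if (last 0 s == a) == d then keep_order s (nclimb q.2 [:: a]) else [:: (s, q.2)]
  else [::].

Definition sweep_dir (d : bool) (q : seq nat * seq nat) : seq (seq nat * seq nat) :=
  keep_order q.1 (nclimb q.2 (if d then q.1 else rev q.1)).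

(* Attach the vertices of [rest] in this order, sweeping in direction [d] in between; only states
   below [w] that move are kept. *)
Fixpoint spirals (fuel : nat) (w : seq nat) (d : bool) (rest : seq nat) (q : seq nat * seq nat) :
    seq (seq nat * seq nat) :=
  if fuel is f.+1 then
    if all2 leq q.2 w then
      q :: (if rest is a :: rest' then flatten [seq spirals f w d rest' q' | q' <- attach_dir d q a]
            else [::])
        (* Prunes the search: in the diagrams considered, fewer than four connected vertices form a
           path, whose roots have no coefficient above 1. *)
        ++ (if 4 <= size q.1 then
              flatten [seq spirals f w d rest q' | q' <- sweep_dir d q & q'.2 != q.2]
            else [::])
    else [::]
  else [::].

Definition unit_vec a := [seq nat_of_bool (b == a) | b <- iota 0 k].

(** Breadth-first order of the support of [w]; the search attaches the vertices in this order. *)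
Fixpoint spread (fuel i : nat) (w acc : seq nat) : seq nat :=
  if fuel is f.+1 then
    spread f i.+1 w (acc ++ [seq b <- adj (nth 0 acc i) | (b \notin acc) && (nth 0 w b != 0)])
  else acc.

Definition spiral_state (w : seq nat) (q : seq nat * seq nat) :=
  (q.2 == w) && all (fun b => (b \in q.1) == (nth 0 w b != 0)) (iota 0 k).

Definition has_spiral (w : seq nat) : bool :=
  has (fun a => has (fun d =>
    (* The fuel 12 bounds the number of attachments and sweeps in one spiral. *)
    has (spiral_state w) (spirals 12 w d (behead (spread k 0 w [:: a])) ([:: a], unit_vec a)))
    [:: true; false]) (iota 0 k).

End Exploration.

Section ExplorationSound.
Variables (n : nat) (Q : quiver n) (s0 : 'S_n) (par : nat -> nat).
Hypothesis tree : tree_diagram Q s0 par.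
Variables (k : nat) (adj : nat -> seq nat) (ori : nat -> nat -> bool) (e : nat -> 'I_n).
Hypothesis e_inj : forall a b, (a < k)%N -> (b < k)%N -> e a = e b -> a = b.
Hypothesis adjP : forall a, (a < k)%N -> uniq (adj a) /\ forall b, b \in adj a -> (b < k)%N.
Hypothesis nbE : forall a b, (a < k)%N -> (b < k)%N -> nb par (e a) (e b) = (b \in adj a).
Hypothesis oriE : forall a b, (a < k)%N -> (b < k)%N -> arr Q s0 (e a) (e b) = ori a b :> nat.
Local Notation ok := (ok Q s0 par (@leD n)).
Local Notation root_at := (root_at s0).
Implicit Types (u : seq nat) (s us : seq nat) (a b : nat).

Definition vec u : 'rV[int]_n := \sum_(a < k) (nth 0%N u a)%:Z *: root_at (e a).

Lemma vec_e u a : (a < k)%N -> (vec u) 0 (s0 (e a)) = (nth 0%N u a)%:Z.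
Proof.
move=> ak; rewrite summxE (bigD1 (Ordinal ak)) //= mxE root_atE eqxx mulr1.
rewrite big1 ?addr0 // => b ba; rewrite mxE root_atE.
case: eqP => [/e_inj h|_]; last by rewrite mulr0.
by case/eqP: ba; apply: val_inj => /=; apply: h.
Qed.

Lemma pair_vec u a : (a < k)%N ->
  pair Q (vec u) (s0 (e a)) = 2 * (nth 0%N u a)%:Z - (nsum adj u a)%:Z.
Proof.
move=> ak; have [ua la] := adjP ak.
have -> : pair Q (vec u) (s0 (e a)) = \sum_(b < k) (nth 0%N u b)%:Z * pair Q (root_at (e b)) (s0 (e a)).
  rewrite /vec; elim/big_rec2: _ => [|b x w _ <-]; last by rewrite pairD pairZ.
  by rewrite -(scale0r (0 : 'rV[int]_n)) pairZ mul0r.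
rewrite (bigD1 (Ordinal ak)) //= (pair_root_at tree) eqxx mulrC; congr (_ + _).
have -> : (nsum adj u a)%:Z = \sum_(b <- adj a) (nth 0%N u b)%:Z.
  rewrite /nsum; elim: (adj a) => [|b l IH]; first by rewrite big_nil.
  by rewrite big_cons /= PoszD IH.
have -> : \sum_(b <- adj a) (nth 0%N u b)%:Z = \sum_(0 <= b < k | b \in adj a) (nth 0%N u b)%:Z.
  rewrite -[RHS]big_filter; apply: perm_big; apply: uniq_perm => //.
    by rewrite filter_uniq // iota_uniq.
  move=> b; rewrite mem_filter mem_index_iota /= andbC.
  by case: (boolP (b \in adj a)) => [/la ->|]; rewrite ?andbF.
rewrite big_mkord -sumrN [RHS]big_mkcond [LHS]big_mkcond; apply: eq_bigr => b _ /=.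
rewrite -val_eqE /=; case: eqP => [->|/eqP ba] /=.
  by rewrite -nbE // (nb_irr tree).
rewrite (pair_root_at tree) ifN; last first.
  by apply: contraNneq ba => /e_inj -> //.
rewrite (nb_sym par) nbE // ; case: (_ \in _); by rewrite ?mulrN1 ?mulr0 ?oppr0.
Qed.

Lemma vec_set u a c : (a < k)%N -> vec (set_nth 0%N u a c) = vec u + (c%:Z - (nth 0%N u a)%:Z) *: root_at (e a).
Proof.
move=> ak; rewrite /vec (bigD1 (Ordinal ak)) //= [X in _ = X + _](bigD1 (Ordinal ak)) //=.
rewrite nth_set_nth /= eqxx scalerBl [RHS]addrC addrA subrK; congr (_ + _).
apply: eq_bigr => b ba; rewrite nth_set_nth /= -val_eqE /= in ba *; by rewrite (negbTE ba).
Qed.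

Lemma reflection_vec u a : (a < k)%N -> (2 * nth 0%N u a <= nsum adj u a)%N ->
  simple_reflection Q (s0 (e a)) (vec u) = vec (set_nth 0 u a (nsum adj u a - nth 0 u a))%N.
Proof.
move=> ak h; rewrite simple_reflectionE pair_vec // vec_set // -scaleNr; congr (_ + _ *: _); lia.
Qed.

Lemma nclimb_sound us u w : (forall a, a \in us -> (a < k)%N) -> nclimb adj u us = Some w ->
  climb Q (@leD n) (vec u) (map s0 (map e us)) /\ reflect_all Q (vec u) (map s0 (map e us)) = vec w.
Proof.
elim: us u => [|a us IH] u hus /=; first by case=> <-.
case: ifP => // h hw; have ak : (a < k)%N by apply: hus; rewrite mem_head.
have [|h1 h2] := IH _ _ hw; first by move=> b hb; apply: hus; rewrite in_cons hb orbT.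
rewrite reflection_vec //; split=> //; split=> //.
rewrite vec_set // => i; rewrite !mxE lerDl mulr_ge0 //; by move: h; lia.
Qed.

Definition sound (q : seq nat * seq nat) : Prop :=
  (forall a, a \in q.1 -> (a < k)%N) /\ ok (map e q.1) (vec q.2).

Lemma mem_map_e s a : (a < k)%N -> (forall b, b \in s -> (b < k)%N) -> (e a \in map e s) = (a \in s).
Proof.
move=> ak hs; apply/mapP/idP => [[b bs /e_inj ->]|h] //; last by exists a.
exact: hs.
Qed.

Lemma sweep_dir_sound d q q' : sound q -> q' \in sweep_dir adj d q -> sound q'.
Proof.
case: q => s u [sk hok]; rewrite /sweep_dir.
case E : (nclimb _ _ _) => [w|] //=; rewrite mem_seq1 => /eqP ->; split=> //.
have [|h1 h2] := nclimb_sound _ E; first by move=> a; case: (d); rewrite ?mem_rev; apply: sk.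
have := @ok_sweep _ _ _ _ _ d _ (vec u) hok; case: (d) h1 h2 => h1 h2; first by rewrite -h2; apply.
by rewrite -map_rev -h2; apply.
Qed.

Lemma attach_dir_sound d q a q' : (a < k)%N -> sound q -> q' \in attach_dir adj ori d q a -> sound q'.
Proof.
move=> ak; case: q => s u [sk hok]; have {}sk : forall a, a \in s -> (a < k)%N := sk.
have {}hok : ok (map e s) (vec u) := hok.
rewrite /attach_dir; case: ifP => // /andP [as_ cnt].
have [ua la] := adjP ak.
have at_ : attach par (map e s) (e a).
  split; first by rewrite mem_map_e.
  have : has (fun b => b \in s) (adj a) by rewrite has_count (eqP cnt).
  case/hasP => b ba bs; exists (e b); split.
  - by rewrite mem_map_e // sk.
  - by rewrite nb_sym nbE // la.
  - move=> _ /mapP [c cs ->]; rewrite nb_sym nbE // ?sk // => ca; congr e.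
    have : size [seq b <- adj a | b \in s] = 1%N by rewrite size_filter (eqP cnt).
    have : c \in [seq b <- adj a | b \in s] by rewrite mem_filter cs ca.
    have : b \in [seq b <- adj a | b \in s] by rewrite mem_filter bs ba.
    by case: [seq b <- _ | _] => [|x [|? ?]] //; rewrite !mem_seq1 => /eqP -> /eqP ->.
have jE : join Q s0 (map e s) (e a) = map e (njoin ori s a).
  rewrite /join /njoin all_map; have -> : all (preim e (fun x => arr Q s0 (e a) x == 0%N)) s = all (fun x => ~~ ori a x) s.
    by apply: eq_in_all => b bs /=; rewrite (oriE ak (sk b bs)); case: (ori a b).
  by case: ifP => _; rewrite ?map_rcons.
have jk b : b \in njoin ori s a -> (b < k)%N.
  rewrite /njoin; case: ifP => _; rewrite ?mem_rcons in_cons => /predU1P [-> //|]; exact: sk.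
case: ifP => _; last first.
  by rewrite mem_seq1 => /eqP ->; split=> //=; rewrite -jE; apply: ok_grow.
case E : (nclimb _ _ _) => [w|] //; rewrite mem_seq1 => /eqP ->; split=> //.
have [|[h1 _] h2] := nclimb_sound _ E; first by move=> b; rewrite mem_seq1 => /eqP ->.
by rewrite /= -jE -h2; apply: ok_cross.
Qed.

Lemma spirals_sound fuel w d rest q q' : (forall a, a \in rest -> (a < k)%N) -> sound q ->
  q' \in spirals adj ori fuel w d rest q -> sound q'.
Proof.
elim: fuel rest q => //= f IH rest q hr hq; case: ifP => // _.
rewrite in_cons mem_cat => /or3P [/eqP -> //||].
  case: rest hr => // a rest hr /flatten_mapP [q1 /attach_dir_sound h1].
  apply: IH; first by move=> b br; apply: hr; rewrite in_cons br orbT.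
  by apply: h1 => //; apply: hr; rewrite mem_head.
case: ifP => // _ /flatten_mapP [q1]; rewrite mem_filter => /andP [_ /sweep_dir_sound h1].
by apply: IH => //; apply: h1.
Qed.

Lemma spread_lt fuel i w acc : (0 < k)%N -> (forall a, a \in acc -> (a < k)%N) ->
  forall a, a \in spread adj fuel i w acc -> (a < k)%N.
Proof.
move=> k0; elim: fuel i acc => //= f IH i acc h; apply: IH => a; rewrite mem_cat => /orP [/h //|].
rewrite mem_filter => /andP [_]; suff /adjP [_ ha] : (nth 0%N acc i < k)%N by apply: ha.
by have [/(mem_nth 0%N) /h //|hi] := ltnP i (size acc); rewrite nth_default.
Qed.

Lemma vec_unit a : (a < k)%N -> vec (unit_vec k a) = root_at (e a).
Proof.
move=> ak; rewrite /vec (bigD1 (Ordinal ak)) //= big1 ?addr0 => [|b ba].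
  by rewrite /unit_vec (nth_map 0%N) ?size_iota // nth_iota // eqxx scale1r.
rewrite /unit_vec (nth_map 0%N) ?size_iota // nth_iota //= add0n.
by rewrite -val_eqE /= in ba; rewrite (negbTE ba) scale0r.
Qed.

Lemma has_spiral_sound w : has_spiral k adj ori w ->
  exists s, [/\ ok (map e s) (vec w), forall a, a \in s -> (a < k)%N
    & forall a, (a < k)%N -> (e a \in map e s) = (nth 0%N w a != 0%N)].
Proof.
case/hasP => a; rewrite mem_iota add0n => /andP [_ ak] /hasP [d _] /hasP [q hq /andP [/eqP <- sup]].
have [||sk hok] := spirals_sound _ _ hq.
- move=> b bs; have h : forall c, c \in [:: a] -> (c < k)%N by move=> c; rewrite mem_seq1 => /eqP ->.
  by apply: (spread_lt (leq_ltn_trans (leq0n a) ak) h); exact: mem_behead bs.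
- split; first by move=> b; rewrite mem_seq1 => /eqP ->.
  by rewrite vec_unit //; apply: ok1.
exists q.1; split=> // b bk; rewrite mem_map_e //.
by apply/eqP; apply: (allP sup); rewrite mem_iota.
Qed.

End ExplorationSound.

(** * Types A and D *)

Section ShiftedSums.
Implicit Types (f : nat -> int) (m : nat).

(** By [path_form] the form of a path is [steps f m + f m ^+ 2]. Over the integers x <= x ^+ 2, so a
    squared increment bounds the increment itself, and this controls the coefficients of roots. *)
Definition steps f m : int := f 0%N ^+ 2 + \sum_(0 <= i < m) (f i.+1 - f i) ^+ 2.

Lemma steps_recr f m : steps f m.+1 = steps f m + (f m.+1 - f m) ^+ 2.
Proof. by rewrite /steps big_nat_recr //= addrA. Qed.

Lemma sqr_ge (x : int) : x <= x ^+ 2.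
Proof. nia. Qed.

Lemma steps_ge f m : f m <= steps f m.
Proof.
elim: m => [|m IH]; first by rewrite /steps big_geq // addr0 sqr_ge.
by rewrite steps_recr; have := sqr_ge (f m.+1 - f m); lia.
Qed.

Lemma steps_gap f m i : (i <= m)%N -> steps f i + (f i - f m) <= steps f m.
Proof.
elim: m => [|m IH]; first by rewrite leqn0 => /eqP ->; lia.
rewrite leq_eqVlt => /predU1P [->|]; first by lia.
by rewrite ltnS steps_recr => /IH; have := sqr_ge (f m - f m.+1); lia.
Qed.

Lemma steps_mono f i m : (i <= m)%N -> steps f i <= steps f m.
Proof.
elim: m => [|m IH]; first by rewrite leqn0 => /eqP ->.
rewrite leq_eqVlt => /predU1P [-> //|]; rewrite ltnS steps_recr => /IH.
by have := sqr_ge0 (f m.+1 - f m); lia.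
Qed.

Lemma steps_ge0 f m : 0 <= steps f m.
Proof.
apply: le_trans (steps_mono f (leq0n m)).
by rewrite /steps big_geq // addr0 sqr_ge0.
Qed.

Lemma steps_eq0 f m i : steps f m = 0 -> (i <= m)%N -> f i = 0.
Proof.
move=> e im; have s0 : steps f i = 0 by apply/eqP; rewrite eq_le steps_ge0 -e steps_mono.
elim: i {im} s0 => [|i IH]; first by rewrite /steps big_geq // addr0; nia.
rewrite steps_recr => s1; have h1 := steps_ge0 f i; have h2 := sqr_ge0 (f i.+1 - f i).
have : f i = 0 by apply: IH; lia.
by move=> fi; rewrite fi subr0 in s1 h2; nia.
Qed.

(** Equality forces x ^+ 2 = x for the first value and for every increment. *)
Lemma steps_tight f m : steps f m = f m ->
  (f 0%N = 0 \/ f 0%N = 1) /\ forall i, (i < m)%N -> f i.+1 = f i \/ f i.+1 = f i + 1.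
Proof.
elim: m => [|m IH].
  rewrite /steps big_geq // addr0 => h; split=> //.
  by have : f 0%N = 0 \/ f 0%N = 1 by nia.
rewrite steps_recr => h; have h1 := steps_ge f m; have h2 := sqr_ge (f m.+1 - f m).
have [|g1 g2] := IH; first by lia.
split=> // i; rewrite ltnS leq_eqVlt => /predU1P [->|/g2 //].
have : (f m.+1 - f m) ^+ 2 = f m.+1 - f m by lia.
by move: (f m.+1 - f m) => x hx; nia.
Qed.

Lemma sum_shift f (par : nat -> nat) m :
  \sum_(0 <= i < m.+1 | (0 < i)%N) f i * f (par i) = \sum_(0 <= i < m) f i.+1 * f (par i.+1).
Proof.
rewrite big_mkcond big_nat_recl //= add0r; apply: eq_bigr => i _ //.
Qed.

Lemma path_form f m :
  2 * (\sum_(0 <= i < m.+1) f i ^+ 2) - 2 * (\sum_(0 <= i < m) f i.+1 * f i)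
  = steps f m + f m ^+ 2.
Proof.
elim: m => [|m IH].
  by rewrite /steps big_nat1 !big_geq //; ring.
rewrite [X in 2 * X - _]big_nat_recr // [X in _ - 2 * X]big_nat_recr // steps_recr.
by move: (\sum_(0 <= i < m.+1) _) (\sum_(0 <= i < m) _) IH => /= S T IH; lia.
Qed.

End ShiftedSums.

Section TypeA.
Variables (m : nat) (Q : quiver m.+1).
Hypothesis hA : type_A Q.

Lemma type_A_tree : exists s0, tree_diagram Q s0 predn.
Proof.
case: hA => _ [s0 h]; exists s0; split; first by case.
move=> i j; rewrite /arr h /path_edge /nb; congr nat_of_bool; lia.
Qed.

Lemma type_A_form s0 (v : 'rV[int]_m.+1) : tree_diagram Q s0 predn ->
  form Q v v = steps (coef s0 v) m + coef s0 v m ^+ 2.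
Proof. by move=> tree; rewrite (form_label tree) sum_shift path_form. Qed.

Lemma type_A_posdef : posdef Q.
Proof.
have [s0 tree] := type_A_tree; move=> v v0; rewrite (type_A_form v tree).
have h1 := steps_ge0 (coef s0 v) m; have h2 := sqr_ge0 (coef s0 v m).
rewrite lt_neqAle addr_ge0 // andbT; apply/eqP => e; apply: v0.
apply: (coef_eq0 (s0 := s0)) => i; rewrite ltnS => im.
by rewrite (steps_eq0 _ im) //; lia.
Qed.

Lemma type_A_okS : exists s0, tree_diagram Q s0 predn /\
  forall v, posroot Q v -> exists s, okS Q s0 predn (@ltD _) s v.
Proof.
have [s0 tree] := type_A_tree; exists s0; split=> //.
apply: (thin_okS tree) type_A_posdef _; first exact: ltD_up.
move=> v i hv; have [im|mi] := leqP i m; last by rewrite coef_out.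
(* Twice the coefficient at i is at most [steps] plus the last coefficient, hence at most the form,
   which is 2. *)
have := hv.2; rewrite (type_A_form v tree).
have := steps_gap (coef s0 v) im; have := steps_ge (coef s0 v) i.
have := sqr_ge (coef s0 v m); lia.
Qed.

End TypeA.

Section TypeD.
Variables (m : nat) (Q : quiver m.+3).
Hypothesis m0 : (0 < m)%N.

(* The labels are 0, ..., m on the long arm, m being the branch vertex, and the two short arms
   m + 1 and m + 2. *)
Definition parD j := if j == m.+2 then m else j.-1.

Lemma type_D_tree : type_D Q -> exists s0, tree_diagram Q s0 parD.
Proof.
case=> _ [s0 h]; exists s0; rewrite /parD; split.
  by move=> j; case: eqP => [->|]; lia.
move=> i j; rewrite /arr h /branch_edge /nb; congr nat_of_bool.
have := ltn_ord i; have := ltn_ord j; rewrite !subSS subn0 /=.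
move: (nat_of_ord i) (nat_of_ord j) => a b.
by case: (eqVneq b m.+2) => [->|hb]; case: (eqVneq a m.+2) => [->|ha]; lia.
Qed.

Variable s0 : 'S_m.+3.
Hypothesis tree : tree_diagram Q s0 parD.
Local Notation c := (coef s0).
Implicit Types (v w : 'rV[int]_m.+3).

(** With a, y, z the coefficients at the branch vertex and the short arms, a^2 - 2 a (y + z) + 2 y^2
    + 2 z^2 = (a - y - z)^2 + (y - z)^2. *)
Lemma type_D_form v :
  form Q v v = steps (c v) m + (c v m - c v m.+1 - c v m.+2) ^+ 2 + (c v m.+1 - c v m.+2) ^+ 2.
Proof.
rewrite (form_label tree) sum_shift.
rewrite [X in 2 * X - _]big_nat_recr // [X in 2 * (X + _) - _]big_nat_recr //.
rewrite [X in _ - 2 * X]big_nat_recr // [X in _ - 2 * (X + _)]big_nat_recr //=.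
have -> : \sum_(0 <= i < m) c v i.+1 * c v (parD i.+1) = \sum_(0 <= i < m) c v i.+1 * c v i.
  by apply: eq_big_nat => i /andP [_ im]; rewrite /parD ifN //; apply/eqP; lia.
have -> : parD m.+1 = m by rewrite /parD; case: eqP.
have -> : parD m.+2 = m by rewrite /parD eqxx.
have := path_form (c v) m; move: (\sum_(0 <= i < m.+1) _) (\sum_(0 <= i < m) _) => S T; lia.
Qed.

Lemma type_D_posdef : posdef Q.
Proof.
move=> v v0; rewrite type_D_form.
have h1 := steps_ge0 (c v) m.
set p := _ - _ - _; set q := c v m.+1 - _.
have h2 := sqr_ge0 p; have h3 := sqr_ge0 q.
rewrite ltNge; apply/negP => e; apply: v0.
have s1 : steps (c v) m = 0 by lia.
have cm := steps_eq0 s1 (leqnn m).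
have p0 : p = 0 by nia.
have q0 : q = 0 by nia.
have [y0 z0] : c v m.+1 = 0 /\ c v m.+2 = 0 by rewrite /p cm in p0; rewrite /q in q0; split; lia.
apply: (coef_eq0 (s0 := s0)) => i i3.
have [im|mi] := leqP i m; first exact: steps_eq0 s1 im.
have : i = m.+1 \/ i = m.+2 by lia.
by case=> ->.
Qed.

End TypeD.

(** * Sweeps that raise one or two coefficients *)

Section Sweeps.
Variables (n : nat) (Q : quiver n) (s0 : 'S_n) (par : nat -> nat).
Hypothesis tree : tree_diagram Q s0 par.
Implicit Types (i j x y : 'I_n) (s : seq 'I_n) (u v w : 'rV[int]_n).
Local Notation nb := (nb par).
Local Notation arr := (arr Q s0).
Local Notation root_at := (root_at s0).

Lemma pair_nat v i (l : seq nat) : uniq l -> (forall a, a \in l -> (a < n)%N) ->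
  (forall x : 'I_n, nb i x = (val x \in l)) ->
  pair Q v (s0 i) = 2 * coef s0 v i - \sum_(a <- l) coef s0 v a.
Proof.
move=> ul hl nl; rewrite (pair_label tree) coef_ord; congr (_ - _).
have -> : \sum_(a <- l) coef s0 v a = \sum_(0 <= a < n | a \in l) coef s0 v a.
  rewrite -[RHS]big_filter; apply: perm_big; apply: uniq_perm => //.
    by rewrite filter_uniq // iota_uniq.
  move=> b; rewrite mem_filter mem_index_iota /= andbC.
  by case: (boolP (b \in l)) => [/hl ->|]; rewrite ?andbF.
by rewrite big_mkord; apply: eq_big => x; rewrite ?nl // coef_ord.
Qed.

Lemma arr_before s x y : arr_sorted Q s0 s -> x \in s -> y \in s -> arr x y != 0%N ->
  (index x s < index y s)%N.
Proof.
move=> ss xs ys axy; rewrite ltnNge leq_eqVlt; apply/negP => /predU1P [e|lt].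
  have exy : x = y by rewrite -(nth_index x xs) -(nth_index x ys) e.
  by move: axy; rewrite exy (arr0 tree) // (nb_irr tree).
have /(pairwiseP x) h : arr_sorted Q s0 s by [].
have := h (index y s) (index x s).
by rewrite !inE !index_mem !nth_index // (negbTE axy) => /(_ ys xs lt).
Qed.

Lemma index_rev_lt s x y : uniq s -> x \in s -> y \in s -> (index x s < index y s)%N ->
  (index y (rev s) < index x (rev s))%N.
Proof.
have e z : uniq s -> z \in s -> index z (rev s) = (size s - (index z s).+1)%N.
  move=> us zs; have zl : (index z s < size s)%N by rewrite index_mem.
  rewrite -{1}(nth_index z zs) -{1}[s]revK nth_rev size_rev // index_uniq ?size_rev ?rev_uniq //.
  by rewrite ltn_subrL /= (leq_ltn_trans _ zl).
move=> us xs ys lt; rewrite !e //; apply: ltn_sub2l => //.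
by apply: leq_ltn_trans lt _; rewrite index_mem.
Qed.

(** The neighbours of i have to come after i in the sweep: before i is raised they have pairing 1
    and would be lowered, afterwards they have pairing 0. *)
Lemma sweep_once (d : bool) s w i : uniq s -> arr_sorted Q s0 s -> i \in s ->
  pair Q w (s0 i) = -1 ->
  (forall x, x \in s -> x != i -> pair Q (w + root_at i) (s0 x) = 0) ->
  (forall x, x \in s -> nb i x -> if d then arr i x != 0%N else arr x i != 0%N) ->
  let us := map s0 (if d then s else rev s) in
  climb Q (@leD n) w us /\ reflect_all Q w us = w + root_at i.
Proof.
move=> us ss is_ pi h1 h2 l; apply: climb_once => //.
- by rewrite map_inj_uniq; [case: d {h2 l}; rewrite ?rev_uniq | exact: perm_inj].
- by rewrite mem_map; [case: d {h2 l}; rewrite ?mem_rev | exact: perm_inj].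
- move=> y; rewrite {}/l => /mapP [x xs ->]; rewrite !(index_map (@perm_inj _ s0)) (inj_eq perm_inj) => xi lt.
  have {}xs : x \in s by move: xs; case: (d); rewrite ?mem_rev.
  have : ~~ nb i x.
    apply/negP => /(h2 x xs); move: lt; case: (d) => lt ax.
      by have := ltn_trans lt (arr_before ss is_ xs ax); rewrite ltnn.
    by have := ltn_trans lt (index_rev_lt us xs is_ (arr_before ss xs is_ ax)); rewrite ltnn.
  move=> /negbTE nix; have := h1 x xs xi.
  by rewrite pairD (pair_root_at tree) eq_sym (negbTE xi) nix oppr0 addr0.
- move=> y; rewrite {}/l => /mapP [x xs ->]; rewrite (inj_eq perm_inj) => xi _; apply: h1 => //.
  by move: xs; case: (d); rewrite ?mem_rev.
Qed.

Lemma sub_rootE u i x : (u - root_at i) 0 (s0 x) = u 0 (s0 x) - (i == x)%:R.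
Proof. by rewrite -(root_atE s0) [LHS]mxE; congr (_ + _); rewrite mxE. Qed.

(* [v] arises by raising first the new vertex [j] and then its neighbour [i]. *)
Lemma raise_two s v i j p :
  okS Q s0 par (@leD n) s (v - root_at i - root_at j) ->
  pair Q v (s0 i) = 1 -> pair Q v (s0 j) = 0 -> v 0 (s0 j) = 1 -> 1 < v 0 (s0 i) ->
  nb i j -> nb i p -> (forall x, x \in s -> nb i x -> x = p) ->
  (forall x, x \in s -> nb x j -> x = i) ->
  (forall x, x \in s -> x != i -> pair Q v (s0 x) = 0) ->
  exists s', okS Q s0 par (@leD n) s' v.
Proof.
move=> [hok sup] pi pj vj vi nij nip uni unj pv.
have ij : i != j by apply: contraTneq nij => ->; rewrite (nb_irr tree).
set w2 := v - root_at i in hok sup; set w := w2 - root_at j in hok sup.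
have w2E x : w2 0 (s0 x) = v 0 (s0 x) - (i == x)%:R by rewrite sub_rootE.
have wE x : w 0 (s0 x) = v 0 (s0 x) - (i == x)%:R - (j == x)%:R.
  by rewrite sub_rootE w2E.
have js : j \notin s by rewrite sup wE vj (negbTE ij) eqxx.
have is_ : i \in s by rewrite sup wE eqxx [j == i]eq_sym (negbTE ij); apply/eqP; lia.
have [_ us ss cs] := hok.
have at_ : attach par s j by split=> //; exists i.
have pw2 x : pair Q w2 (s0 x) = pair Q v (s0 x) - (if i == x then 2 else - (nb i x)%:R).
  by rewrite /w2 pairD -scaleN1r pairZ mulN1r (pair_root_at tree).
have pw2i : pair Q w2 (s0 i) = -1 by rewrite pw2 pi eqxx.
have pwj : pair Q w (s0 j) = -1.
  by rewrite /w pairD -scaleN1r pairZ mulN1r (pair_root_at tree) eqxx pw2 (negbTE ij) nij pj.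
have rj : simple_reflection Q (s0 j) w = w2 by rewrite reflection_up // subrK.
have w2v : w2 + root_at i = v by rewrite subrK.
have jle : leD w w2 by have := (ltD_up w (s0 j)).1; rewrite -/(root_at j) subrK.
have supv x : (x \in join Q s0 s j) = (v 0 (s0 x) != 0).
  rewrite mem_join sup wE [x == j]eq_sym; case: eqP => [<-|_] /=; first by rewrite vj.
  case: (eqVneq i x) => [<-|_]; rewrite !subr0 //.
  by rewrite (_ : v 0 (s0 i) - 1 != 0) 1?(_ : v 0 (s0 i) != 0) //; apply/eqP; move: vi; lia.
have ok2 : ok Q s0 par (@leD n) (join Q s0 s j) w2.
  by have := ok_cross tree hok at_; rewrite rj; apply.
have [_ us1 ss1 cs1] := ok2.
(* The sweep runs in the direction in which i comes before p. *)
pose d := arr i p != 0%N.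
have hp : if d then arr i p != 0%N else arr p i != 0%N.
  by rewrite /d; have [[-> ->]|[-> ->]] := arr_dir tree nip.
(* If j lies on the same side of i as p, it is crossed on its own, and the sweep over the longer
   list meets i before j. Otherwise j is only enclosed, at the end where the sweep starts, and a
   single sweep raises first j and then i. *)
have [same|diff] := boolP ((arr i j != 0%N) == d).
  have hj : if d then arr i j != 0%N else arr j i != 0%N.
    by move: same; have [[-> ->]|[-> ->]] := arr_dir tree nij; case: (d).
  have [|||h1 h2] := @sweep_once d (join Q s0 s j) w2 i us1 ss1 _ pw2i.
  - by rewrite mem_join is_ orbT.
  - by move=> x; rewrite w2v mem_join => /predU1P [-> //|xs xi]; apply: pv.
  - by move=> x; rewrite mem_join => /predU1P [-> //|xs] /(uni x xs) ->.
  exists (join Q s0 s j); split=> //.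
  by have := @ok_sweep _ _ _ _ _ d _ _ ok2 h1; rewrite h2 w2v.
have [||h1 h2] := @sweep_once d s w2 i us ss is_ pw2i.
- by move=> x xs xi; rewrite w2v; apply: pv.
- by move=> x xs /(uni x xs) ->.
have okg := ok_grow tree hok at_.
exists (join Q s0 s j); split=> //.
have e : (if d then join Q s0 s j else rev (join Q s0 s j)) = j :: (if d then s else rev s).
  rewrite /join; have [aj|[aj0 aj1]] := arr_dir tree nij.
    have dF : d = false by move: diff; rewrite aj.1; case: (d).
    rewrite dF ifT ?rev_rcons //; apply/allP => x xs.
    have [/(unj x xs) ->|nxj] := boolP (nb x j); first by rewrite aj.2.
    by rewrite (arr0 tree) // nb_sym.
  have dT : d by move: diff; rewrite aj0; case: (d).
  by rewrite dT ifF //; apply/negbTE/allPn; exists i; rewrite ?aj1.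
have := @ok_sweep _ _ _ _ _ d _ _ okg; rewrite e /= rj h2 w2v; apply; split=> //.
Qed.

End Sweeps.

(* The four vertices around the branch vertex [m], which gets the index 1. *)
Definition starD (m a : nat) : nat := nth 0%N [:: m.-1; m; m.+1; m.+2] a.
Definition adj_star (a : nat) : seq nat := nth [::] [:: [:: 1]; [:: 3; 2; 0]; [:: 1]; [:: 1]]%N a.

Lemma lt4P (P : nat -> Prop) : P 0%N -> P 1%N -> P 2%N -> P 3%N -> forall a, (a < 4)%N -> P a.
Proof. by move=> ? ? ? ? [|[|[|[|a]]]]. Qed.

Lemma starD_nb m a b : (0 < m)%N -> (a < 4)%N -> (b < 4)%N ->
  ((0 < starD m b) && (starD m a == parD m (starD m b)))%N ||
  ((0 < starD m a) && (starD m b == parD m (starD m a)))%N = (b \in adj_star a).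
Proof.
have E c d : (c == d :> nat) = (c <= d <= c)%N by rewrite eqn_leq.
case: m => // m _ a4 b4; move: a a4 b b4.
by apply: lt4P; apply: lt4P; rewrite /adj_star /= ?inE /starD /parD /= !E; do ?case: ifP => ?; lia.
Qed.

Definition star_ori (o1 o2 o3 : bool) (a b : nat) : bool :=
  match a, b with
  | 0, 1 => o1 | 1, 0 => ~~ o1 | 1, 2 => o2 | 2, 1 => ~~ o2 | 1, 3 => o3 | 3, 1 => ~~ o3
  | _, _ => false
  end%N.

Lemma star_spiral o1 o2 o3 : has_spiral 4 adj_star (star_ori o1 o2 o3) [:: 1; 2; 1; 1]%N.
Proof. by case: o1; case: o2; case: o3; vm_compute. Qed.

(** * Roots with a coefficient 2 in type D *)

Section TypeDRoots.
Variables (m : nat) (Q : quiver m.+3).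
Hypothesis m0 : (0 < m)%N.
Variable s0 : 'S_m.+3.
Hypothesis tree : tree_diagram Q s0 (parD m).
Local Notation c := (coef s0).
Local Notation lab := (@inord m.+2).
Implicit Types (v w : 'rV[int]_m.+3).

Definition nbD (a : nat) : seq nat :=
  if (a < m)%N then (if a is a'.+1 then [:: a'; a.+1] else [:: 1%N])
  else if a == m then [:: m.-1; m.+1; m.+2] else [:: m].

Lemma nbD_mem (i x : 'I_m.+3) : nb (parD m) i x = ((x : nat) \in nbD i).
Proof.
rewrite /nb /nbD /parD; have := ltn_ord i; have := ltn_ord x; rewrite /=.
move: (nat_of_ord i) (nat_of_ord x) => a b hb ha.
have E d d' : (d == d' :> nat) = (d <= d' <= d)%N by rewrite eqn_leq.
by case: a ha => [|a] ha; do !case: ifP => ?; rewrite ?inE /= ?E in ha *; lia.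
Qed.

Lemma nbD_arm a : (0 < a < m)%N -> nbD a = [:: a.-1; a.+1].
Proof. by case: a => // a /andP [_ am]; rewrite /nbD am. Qed.

Lemma pairD_nb v (i : 'I_m.+3) : pair Q v (s0 i) = 2 * c v i - \sum_(a <- nbD i) c v a.
Proof.
apply: (pair_nat tree); last exact: nbD_mem.
  rewrite /nbD; case: ifP => _; [case: (val i) => // a | case: ifP => _ //];
  by rewrite /= !inE; lia.
move=> a; rewrite /nbD; have := ltn_ord i; rewrite /=.
move: (nat_of_ord i) => b hb; case: ifP => hm.
  by case: b hb hm => [|b] hb hm; rewrite !inE; lia.
by case: ifP => _; rewrite !inE; lia.
Qed.

Lemma pair_first v : pair Q v (s0 ord0) = 2 * c v 0%N - c v 1%N.
Proof. by rewrite pairD_nb /nbD m0 big_seq1. Qed.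

Lemma pair_arm v a : (a.+1 < m)%N ->
  pair Q v (s0 (lab a.+1)) = 2 * c v a.+1 - c v a - c v a.+2.
Proof.
move=> am; rewrite pairD_nb inordK; last by lia.
by rewrite /nbD am !big_cons big_nil addr0 opprD addrA.
Qed.

Lemma pair_branch v :
  pair Q v (s0 (lab m)) = 2 * c v m - c v m.-1 - c v m.+1 - c v m.+2.
Proof.
rewrite pairD_nb inordK; last by lia.
by rewrite /nbD ltnn eqxx !big_cons big_nil addr0 !opprD !addrA.
Qed.

Lemma pair_short v a : a = m.+1 \/ a = m.+2 -> pair Q v (s0 (lab a)) = 2 * c v a - c v m.
Proof.
move=> h; rewrite pairD_nb inordK; last by lia.
by rewrite /nbD ifF ?ifF ?big_seq1 //; lia.
Qed.

(** The form gives 2 = [steps] + p^2 + q^2, and [steps] is at least the coefficient a at the branch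
    vertex; so a <= 2, and a = 2 forces p = q = 0. By [steps_gap] twice an arm coefficient is at
    most 2 + a, so a coefficient above 1 on the arm forces a = 2. *)
Lemma type_D_coef v : posroot Q v ->
  [/\ 0 <= c v m.+1 <= 1, 0 <= c v m.+2 <= 1 & forall i, (i <= m)%N -> 1 < c v i ->
    [/\ c v m.+1 = 1, c v m.+2 = 1, c v m = 2 & steps (c v) m = c v m]].
Proof.
move=> hv; have := hv.2; rewrite (type_D_form m0 tree).
have := coef_ge0 s0 m.+1 hv; have := coef_ge0 s0 m.+2 hv; have := coef_ge0 s0 m hv.
have := steps_ge (c v) m; have gap := @steps_gap (c v) m; have st := steps_ge (c v).
move: gap; move: (steps (c v) m) (c v m) (c v m.+1) (c v m.+2) => S a y z gap Sa a0 z0 y0 e.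
have : exists p q, [/\ p = a - y - z, q = y - z & 2 = S + p ^+ 2 + q ^+ 2] by exists (a - y - z), (y - z).
case=> p [q [ep eq {}e]]; have p0 := sqr_ge0 p; have q0 := sqr_ge0 q.
have hp : -1 <= p <= 1 by apply/andP; split; nia.
have hq : -1 <= q <= 1 by apply/andP; split; nia.
have a2 : a <= 2 by lia.
have tight : a = 2 -> [/\ S = 2, p = 0 & q = 0] by move=> a2'; split; nia.
have y1 : y <= 1 by rewrite leNgt; apply/negP => y2; have [|] := tight; lia.
have z1 : z <= 1 by rewrite leNgt; apply/negP => z2; have [|] := tight; lia.
split; [by rewrite y0 | by rewrite z0 |] => i im ci.
have := gap i im; have := st i => h1 h2.
have a2' : a = 2 by lia.
by have [] := tight a2'; split; lia.
Qed.

Lemma type_D_mono v i j : posroot Q v -> steps (c v) m = c v m -> (i <= j <= m)%N -> c v i <= c v j.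
Proof.
move=> hv st /andP [ij jm]; have [_ inc] := steps_tight st.
elim: j ij jm => [|j IH]; first by rewrite leqn0 => /eqP ->.
rewrite leq_eqVlt => /predU1P [-> //|ij] jm.
by have := IH ij (ltnW jm); have := inc j jm; lia.
Qed.

(* The highest root of the subdiagram of type D4 around the branch vertex. *)
Lemma type_D_star v : posroot Q v -> c v m = 2 -> c v m.-1 = 1 -> c v m.+1 = 1 -> c v m.+2 = 1 ->
  (forall i, (i < m.-1)%N -> c v i = 0) -> exists s, okS Q s0 (parD m) (@leD _) s v.
Proof.
move=> hv cm cm1 cy cz c0.
pose e a := lab (starD m a).
have starlt a : (starD m a < m.+3)%N.
  by case: a => [|[|[|[|a]]]]; rewrite /starD /= ?nth_nil //; lia.
have eE a : val (e a) = starD m a by rewrite /e /= inordK.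
have e_inj a b : (a < 4)%N -> (b < 4)%N -> e a = e b -> a = b.
  move=> a4 b4 /(congr1 val); rewrite !eE; move: a a4 b b4; do 2! (apply: lt4P; rewrite /starD /=); lia.
have adjP a : (a < 4)%N -> uniq (adj_star a) /\ forall b, b \in adj_star a -> (b < 4)%N.
  by move: a; apply: lt4P; split=> // b; rewrite !inE; lia.
have nbE a b : (a < 4)%N -> (b < 4)%N -> nb (parD m) (e a) (e b) = (b \in adj_star a).
  by move=> a4 b4; rewrite /nb !eE starD_nb.
have [g both] : exists g : nat -> bool, forall b, (b < 4)%N -> b \in adj_star 1 ->
    arr Q s0 (e 1%N) (e b) = g b :> nat /\ arr Q s0 (e b) (e 1%N) = ~~ g b :> nat.
  exists (fun b => arr Q s0 (e 1%N) (e b) != 0%N) => b b4 hb.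
  by have [|[-> ->]|[-> ->]] := @arr_dir _ _ _ _ tree (e 1%N) (e b); rewrite ?nbE.
have oriE a b : (a < 4)%N -> (b < 4)%N ->
    arr Q s0 (e a) (e b) = star_ori (~~ g 0%N) (g 2%N) (g 3%N) a b :> nat.
  move=> a4 b4; move: a a4 b b4; apply: lt4P; apply: lt4P; rewrite /star_ori ?negbK;
    first [by apply: (both _ _ _).1 | by apply: (both _ _ _).2 | by rewrite (arr0 tree) ?nbE].
have [s [hok s4 sup]] := has_spiral_sound tree e_inj adjP nbE oriE (star_spiral _ _ _).
exists (map e s).
have ve a : (a < 4)%N -> v 0 (s0 (e a)) = (nth 0%N [:: 1; 2; 1; 1]%N a)%:Z.
  by move: a; apply: lt4P; rewrite -coef_ord eE.
have out (x : 'I_m.+3) : ~ (exists2 a, (a < 4)%N & x = e a) -> (x < m.-1)%N.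
  move=> h; rewrite ltnNge; apply/negP => mx; apply: h.
  exists (x - m.-1)%N; first by have := ltn_ord x; lia.
  apply: val_inj; rewrite eE /starD.
  have : (x < m.+3)%N by [].

  rewrite -[val x]/(nat_of_ord x); move: (nat_of_ord x) mx => y mx xm.
  have : y = (m.-1 + 0)%N \/ y = (m.-1 + 1)%N \/ y = (m.-1 + 2)%N \/ y = (m.-1 + 3)%N by lia.
  by case=> [->|[->|[->|->]]]; rewrite addKn /=; lia.
have vE : vec s0 4 e [:: 1; 2; 1; 1]%N = v.
  apply: (coef_inj (s0 := s0)) => i i3; rewrite -[i]/(val (Ordinal i3)) !coef_ord.
  have [[a a4 ->]|/[dup] na /out h] := pselect (exists2 a, (a < 4)%N & Ordinal i3 = e a).
    by rewrite vec_e // ve.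
  rewrite -[RHS](coef_ord s0) c0 // /vec summxE big1 // => a _; rewrite mxE root_atE.
  by case: eqP => [ea|]; [case: na; exists a | rewrite mulr0].
rewrite -vE; split=> // x; rewrite vE.
have [[a a4 ->]|/[dup] na /out h] := pselect (exists2 a, (a < 4)%N & x = e a).
  by rewrite sup // ve.
rewrite -(coef_ord s0) c0 // eqxx; apply/negP => /mapP [a ha ea]; apply: na.
by exists a => //; apply: s4.
Qed.

(** A root with a coefficient 2 reads 0...0 1...1 2...2 along the arm, with 1 and 1 on the short
    arms. If there are several ones on the arm, the outermost is removed. If there is only one, the
    first 2 and the 1 before it are lowered together, except when that 2 is at the branch vertex,
    where the root is the one of [type_D_star]. *)
Lemma type_D_okS v : posroot Q v -> exists s, okS Q s0 (parD m) (@leD _) s v.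
Proof.
move: v; apply: (posroot_ind (type_D_posdef m0 tree)) => [i|v hv [i0 [pi vi]] IH].
  by exists [:: ((s0^-1)%g i)]; have := okS1 Q s0 (parD m) (@leD _) ((s0^-1)%g i); rewrite /root_at permKV.
have thin j : pair Q v (s0 j) = 1 -> c v j = 1 -> exists s, okS Q s0 (parD m) (@leD _) s v.
  move=> pj; rewrite coef_ord => vj.
  have [le ne] := sub_simple_root v (s0 j).
  have [|s hs] := IH _ _ le ne; first by apply: posroot_sub; rewrite ?vj.
  by exists (join Q s0 s j); apply: thin_step => // u x; exact: (ltD_up _ _).1.
pose i := (s0^-1)%g i0; have ei : i0 = s0 i by rewrite permKV.
rewrite ei in pi vi; rewrite -(coef_ord s0) in vi.
have [ci|ci] : c v i = 1 \/ 1 < c v i by lia.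
  exact: thin pi ci.
have [/andP [y0 y1] /andP [z0 z1] hbig] := type_D_coef hv.
have im : (i <= m)%N.
  rewrite leqNgt; apply/negP => mi.
  have : i = m.+1 :> nat \/ i = m.+2 :> nat by have := ltn_ord i; move: mi; lia.
  by case=> e; rewrite e in ci; lia.
have [cy cz cm st] := hbig i im ci.
have mono := type_D_mono hv st.
have ci2 : c v i = 2 by have := mono i m; rewrite im leqnn => /(_ isT); lia.
have [h0 inc] := steps_tight st.
have i_pos : (0 < i)%N.
  by rewrite lt0n; apply/eqP => e; rewrite e in ci2; lia.
pose j := lab i.-1.
have jE : j = i.-1 :> nat by rewrite /j /= inordK; lia.
have labE (x : 'I_m.+3) a : x = a :> nat -> x = lab a by move=> <-; rewrite inord_val.
have le2 a : (i <= a <= m)%N -> c v a = 2.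
  by case/andP=> ia am; have := mono i a; have := mono a m; rewrite ia am leqnn => /(_ isT) h1 /(_ isT) h2; lia.
have prevE : c v i.-1 = 1.
  have [im'|mi'] := ltnP i m.
    have := pair_arm v (a := i.-1); rewrite prednK // inord_val pi ci2 => /(_ im').
    by rewrite (le2 i.+1) ?leqnSn //; lia.
  have e : i = m :> nat by apply/eqP; rewrite eqn_leq im.
  by have := pair_branch v; rewrite -(labE i m e) pi cm cy cz e; lia.
have le1 a : (a < i)%N -> 0 <= c v a <= 1.
  move=> ai; have := mono a i.-1; rewrite prevE (coef_ge0 _ _ hv) => -> //.
  by apply/andP; split; move: ai im i_pos; lia.
(* The outermost 1 is followed by another 1, so its pairing is 2 - 1 - 0 = 1. *)
have [[a [ai a1]]|flat] := pselect (exists a, (a < i.-1)%N /\ c v a = 1).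
  have ex : exists a, (a < i.-1)%N && (c v a == 1) by exists a; rewrite ai a1 eqxx.
  case: (ex_minnP ex) => {ai a1} a /andP [ai /eqP a1] amin.
  have a1' : c v a.+1 = 1.
    have := mono a a.+1; have := le1 a.+1; rewrite a1.
    by move=> /(_ ltac:(lia)) h1 /(_ ltac:(lia)) h2; lia.
  apply: (thin (lab a)); last by rewrite inordK // ltnS; lia.
  case: a ai a1 a1' amin => [|a] ai a1 a1' amin.
    by rewrite -(_ : ord0 = lab 0) ?pair_first ?a1 ?a1' //; apply: labE.
  rewrite pair_arm ?a1 ?a1'; last by lia.
  have : c v a <> 1 by move=> e; have := amin a; rewrite e eqxx; lia.
  by have := le1 a; lia.
(* From here on v reads 0...0 1 2...2 along the arm, with the 1 at j. *)
have {}flat a : (a < i.-1)%N -> c v a = 0.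
  move=> ai; have : c v a <> 1 by move=> e; case: flat; exists a.
  by have := le1 a; lia.
have [im'|mi'] := ltnP i m; last first.
  have e : i = m :> nat by apply/eqP; rewrite eqn_leq im.
  have em : i.-1 = m.-1 by rewrite e.
  by rewrite em in prevE flat; apply: type_D_star.
have pj : pair Q v (s0 j) = 0.
  have [i1|i1] := posnP i.-1.
    rewrite (_ : j = ord0); last by apply: val_inj; rewrite /= jE i1.
    have e1 : i = 1%N :> nat by lia.
    by rewrite pair_first; rewrite e1 in prevE ci2; rewrite prevE ci2.
  have := pair_arm v (a := i.-2); rewrite prednK // -/j prednK // ci2 prevE flat; last by rewrite prednK.
  by move=> -> //; exact: ltnW.
pose p := lab i.+1.
have pE : p = i.+1 :> nat by rewrite /p inordK //; lia.
have nij : nb (parD m) i j by rewrite nbD_mem nbD_arm ?i_pos // jE mem_head.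
have nip : nb (parD m) i p.
  by rewrite nbD_mem nbD_arm ?i_pos // pE !inE eqxx orbT.
have ij : i != j by apply: contraTneq nij => ->; rewrite (nb_irr tree).
have vj : v 0 (s0 j) = 1 by rewrite -(coef_ord s0) jE prevE.
have vi2 : v 0 (s0 i) = 2 by rewrite -(coef_ord s0).
have hw2 : posroot Q (v - root_at s0 i) by apply: posroot_sub; rewrite // vi2.
have hw : posroot Q (v - root_at s0 i - root_at s0 j).
  apply: (posroot_sub hw2); last by rewrite sub_rootE vj (negbTE ij).
  by rewrite pairD -scaleN1r pairZ mulN1r (pair_root_at tree) (negbTE ij) nij pj.
have [le1' _] := sub_simple_root v (s0 i).
have [le2' ne2] := sub_simple_root (v - root_at s0 i) (s0 j).
have [||s hs] := IH _ hw.
- by move=> x; apply: le_trans (le2' x) (le1' x).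
- by move=> /rowP e; apply: ne2; apply/rowP => x; apply/eqP; rewrite eq_le le2' /=; apply: le_trans (le1' x) _; rewrite -[X in X <= _]e.
have inS x : (x \in s) = (c v x - (i == x)%:R - (j == x)%:R != 0) by rewrite hs.2 !sub_rootE coef_ord.
have big (x : 'I_m.+3) : x \in s -> (i <= x)%N.
  rewrite inS leqNgt; apply: contraNN => xi.
  have [xj|/eqP xj] := eqVneq (x : nat) i.-1.
    have jx : j = x by apply: val_inj; rewrite /= jE xj.
    by rewrite xj prevE -jx (negbTE ij) eqxx.
  rewrite flat; last by move: xi xj; lia.
  by case: (eqVneq i x) xi => [<-|_ _]; [rewrite ltnn | case: (eqVneq j x) xj => [<-|//]; rewrite jE].
apply: (raise_two tree hs) nij nip _ _ _ => //.
- by rewrite vi2.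
- move=> x /big ix; rewrite nbD_mem nbD_arm ?i_pos // !inE => /orP [] /eqP e; apply: val_inj => /=.
    by move: e ix i_pos; rewrite /=; lia.
  by rewrite pE.
- move=> x /big ix; rewrite nb_sym nbD_mem jE => h; apply: val_inj.
  have [i1|i1] := posnP i.-1.
    by move: h; rewrite i1 /nbD m0 inE => /eqP; rewrite /=; lia.
  move: h; rewrite nbD_arm; last by apply/andP; split=> //; lia.
  by rewrite !inE prednK // => /orP [] /eqP //= e; lia.
move=> x /big ix xi; have {xi ix}ix : (i < x)%N by rewrite ltn_neqAle ix andbT eq_sym.
have [xm|mx] := leqP x m; last first.
  rewrite (labE x x) // pair_short; last by have := ltn_ord x; lia.
  have : x = m.+1 :> nat \/ x = m.+2 :> nat by have := ltn_ord x; lia.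
  by case=> ->; rewrite cm ?cy ?cz.
have [xm'|mx'] := ltnP x m.
  have := pair_arm v (a := x.-1); rewrite prednK ?inord_val; last by lia.
  by move=> -> //; rewrite !le2 //; lia.
have e : x = m :> nat by lia.
by rewrite (labE x m e) pair_branch cm cy cz le2 //; lia.
Qed.

End TypeDRoots.

(** * Polygons in integer coordinates *)

Section Polygons.
Variables (R : realType) (m : nat).
Local Notation pt := (R * R)%type.
Local Notation n := m.+1.
Implicit Types (K : set pt) (x y c : nat) (b : nat * nat * nat * nat).

(* Axis-parallel polygons in integer coordinates, scaled by 16: the rays lie over the multiples of
   16 and start at height 16.  The list [cs] holds the coordinates that change, alternately
   ordinates and abscissas; [h] tells whether an abscissa is next. *)
Definition disjoint_box b b' : bool :=
  let: (l, r, d, u) := b in let: (l', r', d', u') := b' in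
  [|| r < l', r' < l, u < d' | u' < d]%N.

(** Ray k stands over 16 (k + 1), so the first ray to the right of x has the index [x %/ 16]. *)
Definition crossed x c : seq nat :=
  if (x < c)%N then iota (x %/ 16) (c %/ 16 - x %/ 16) else rev (iota (c %/ 16) (x %/ 16 - c %/ 16)).

(** [prev] is the box of the last leg, [old] lists those before it. The new leg avoids [old]; it is
    perpendicular to the last leg and meets it only at their common end. Above height 16 it has to
    cross a ray, since [run_route] deals with nonempty runs. *)
Fixpoint walk (h : bool) x y (prev : nat * nat * nat * nat) (old : seq (nat * nat * nat * nat))
    (cs : seq nat) : option (seq nat) :=
  if cs is c :: cs' then
    let: (x', y') := if h then (c, y) else (x, c) in
    let b := (minn x x', maxn x x', minn y y', maxn y y') in
    let ks := if h && (16 < y)%N then crossed x c else [::] in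
    if [&& (x != x') || (y != y'), all (disjoint_box b) old &
        if h then (y < 16)%N || [&& 16 < y, x %% 16 != 0, c %% 16 != 0, ks != [::] & all (gtn n) ks]%N
        else (x %% 16 != 0)%N || (y <= 16)%N && (c < 16)%N]
    then omap (cat ks) (walk (~~ h) x' y' b (prev :: old) cs') else None
  else if (x == 0%N) && (y == 0%N) then Some [::] else None.

Definition spot x y : pt := (x%:R / 16, y%:R / 16).

Definition boxed b : set pt := let: (l, r, d, u) := b in
  [set z | l%:R / 16 <= z.1 <= r%:R / 16 /\ d%:R / 16 <= z.2 <= u%:R / 16].

Lemma disjoint_boxed b b' z : disjoint_box b b' -> boxed b z -> ~ boxed b' z.
Proof.
case: b => [[[l r] d] u]; case: b' => [[[l' r'] d'] u'].
rewrite /disjoint_box => /or4P h [/andP [a1 a2] /andP [a3 a4]] [/andP [b1 b2] /andP [b3 b4]].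
by case: h; rewrite -(ltr_nat R); lra.
Qed.

Arguments boxed : simpl never.

Lemma segm_boxed x y x' y' z : segm (spot x y) (spot x' y') z ->
  boxed (minn x x', maxn x x', minn y y', maxn y y') z.
Proof.
move=> [l /andP [l0 l1] ->]; rewrite /boxed /= -!minEnat -!maxEnat !natr_min !natr_max.
have t (p q : R) : Num.min p q / 16 <= p / 16 + l * (q / 16 - p / 16) <= Num.max p q / 16.
  by case: (lerP p q) => pq; apply/andP; split; nra.
by split; apply: t.
Qed.

Lemma route_weaken K K0 A (s : seq (pt * option 'I_n)) : route K0 A s ->
  (forall z, trace A s z -> K z -> K0 z) -> route K A s.
Proof.
elim: s K K0 A => [|[B o] s IH] K K0 A //= [h1 h2 h3] sub; split=> //.
  by move=> z zAB zA Kz; apply: (h2 z zAB zA); apply: (sub z _ Kz); left.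
by apply: IH h3 _ => z zs [Kz|?]; [left; apply: (sub z _ Kz); right | right].
Qed.

Definition boxes (bs : seq (nat * nat * nat * nat)) : set pt :=
  [set z | exists2 b, b \in bs & boxed b z].

Lemma boxes_cons b bs z : boxes (b :: bs) z <-> boxed b z \/ boxes bs z.
Proof.
split=> [[b']|[h|[b' b'bs h]]].
- by rewrite in_cons => /predU1P [->|h1 h2]; [left | right; exists b'].
- by exists b; rewrite ?mem_head.
- by exists b'; rewrite // in_cons b'bs orbT.
Qed.

Lemma path_iota_inord p q : (p + q < m.+1)%N ->
  path (adjacent true) (@inord m p) (map (@inord m) (iota p.+1 q)) /\
  last (@inord m p) (map (@inord m) (iota p.+1 q)) = inord (p + q).
Proof.
elim: q p => [|q IH] p h /=; first by rewrite addn0.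
have [|-> ->] := IH p.+1; first by lia.
by rewrite andbT addnS addSn /adjacent !inordK //; lia.
Qed.

Lemma iota_rcons p q : iota p q.+1 = rcons (iota p q) (p + q).
Proof. by rewrite -addn1 iotaD cats1. Qed.

Lemma path_rev_iota_inord p q : (p + q < m.+1)%N ->
  path (adjacent false) (@inord m (p + q)) (map (@inord m) (rev (iota p q))) /\
  last (@inord m (p + q)) (map (@inord m) (rev (iota p q))) = inord p.
Proof.
elim: q => [|q IH] h; first by rewrite addn0.
have [|h1 h2] := IH; first by lia.
rewrite iota_rcons rev_rcons /= h1 h2 andbT addnS.
by rewrite /adjacent !inordK //; lia.
Qed.

Lemma crossed_run x c : (x %% 16 != 0)%N -> (c %% 16 != 0)%N -> crossed x c != [::] ->
  all (gtn n) (crossed x c) -> let d := (x < c)%N in exists (k : 'I_n) ks (a : R),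
  [/\ map inord (crossed x c) = k :: ks, path (adjacent d) k ks, 0 < a < 1,
      (if d then k%:R < (x%:R / 16 : R) < k.+1%:R else k.+1%:R < (x%:R / 16 : R) < k.+2%:R) : Prop
    & past d a (last k ks) = c%:R / 16].
Proof.
move=> hx hc; have := divn_eq x 16; have := divn_eq c 16; have := @ltn_pmod x 16 isT; have := @ltn_pmod c 16 isT.
rewrite /crossed.
set p := (x %/ 16)%N; set r := (x %% 16)%N; set p' := (c %/ 16)%N; set r' := (c %% 16)%N.
move=> r16 r'16 ec ex; have r0 : (0 < r)%N by rewrite lt0n.
have r'0 : (0 < r')%N by rewrite lt0n.
have exR : x%:R = p%:R * 16 + r%:R :> R by rewrite ex natrD natrM.
have ecR : c%:R = p'%:R * 16 + r'%:R :> R by rewrite ec natrD natrM.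
rewrite exR ecR => {exR ecR}; rewrite -!(ltr_nat R) in r16 r'16 r0 r'0.
case: ltnP => xc; rewrite ?all_rev => ne al /=.
  case E : (p' - p)%N ne al => [|q] //= _ /andP [pm /allP al].
  have pq : (p + q < n)%N.
    by case: q E al => [|q] E al; [rewrite addn0 | apply: al; rewrite mem_iota; lia].
  have [h1 h2] := path_iota_inord pq.
  have ep : p'%:R = (p + q)%:R + 1 :> R by rewrite natr1; congr (_%:R); lia.
  exists (inord p), (map inord (iota p.+1 q)), (r'%:R / 16); split=> //.
  - by apply/andP; split; lra.
  - by rewrite inordK // -[p.+1%:R]natr1; apply/andP; split; lra.
  - by rewrite /past h2 inordK // -[(p + q).+1%:R]natr1 ep; lra.
case E : (p - p')%N ne al => [|q] // _; rewrite iota_rcons rev_rcons all_rcons => /andP [pq _] /=.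
have [h1 h2] := path_rev_iota_inord pq.
have ep : p%:R = (p' + q)%:R + 1 :> R by rewrite natr1; congr (_%:R); lia.
(* Moving left, the last ray crossed stands over p' + 1, and the leg ends 1 - r'/16 beyond it. *)
exists (inord (p' + q)), (map inord (rev (iota p' q))), (1 - r'%:R / 16); split=> //.
- by apply/andP; split; lra.
- by rewrite inordK // -[(p' + q).+2%:R]natr1 -[(p' + q).+1%:R]natr1 ep; apply/andP; split; lra.
- rewrite /past h2 inordK; last by apply: leq_ltn_trans pq; apply: leq_addr.
  by rewrite -[p'.+1%:R]natr1; lra.
Qed.

(** The hypothesis on [prev] says that the last leg is perpendicular to the next one; at the start,
    [prev] is a point. *)
Lemma walk_route h x y prev old cs ks : walk h x y prev old cs = Some ks ->
  (forall z, boxed prev z -> if h then z.1 = x%:R / 16 else z.2 = y%:R / 16) ->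
  exists legs : seq (pt * option 'I_n), [/\ route (boxes (prev :: old)) (spot x y) legs,
    last (spot x y) (map fst legs) = base_point R & pmap snd legs = map inord ks].
Proof.
elim: cs h x y prev old ks => [|c cs IH] h x y prev old ks /=.
  case: andP => // -[/eqP -> /eqP ->] [<-] _; exists [::]; split=> //.
  by rewrite /= /spot mul0r.
case E : (if h then _ else _) => [x' y'].
set b := (minn x x', _, _, _); set ks0 := (if h && (16 < y)%N then _ else _).
case: and3P => // -[ne /allP dis hc]; case E' : walk => [ks1|] //= [<-] hprev.
have {IH} [|legs [r1 r2 r3]] := IH _ _ _ _ _ _ E'.
  move=> z; rewrite /b; case: (h) E => -[<- <-] /=; rewrite ?minnn ?maxnn => -[/andP [a1 a2] /andP [a3 a4]].
    by apply/eqP; rewrite eq_le a3 a4.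
  by apply/eqP; rewrite eq_le a1 a2.
have avoid z : boxed b z -> boxes (prev :: old) z -> z = spot x y.
  move=> zb /boxes_cons [zp|[b' /dis]]; last by move=> /disjoint_boxed /(_ zb).
  move: zb (hprev z zp); rewrite /b; case: (h) E => -[<- <-] /=; rewrite ?minnn ?maxnn => -[/andP [a1 a2] /andP [a3 a4]] e.
    by apply: pt_eq => //; apply/eqP; rewrite eq_le a3 a4.
  by apply: pt_eq => //; apply/eqP; rewrite eq_le a1 a2.
have [first [f1 f2 f3 f4]] : exists first : seq (pt * option 'I_n),
   [/\ route (boxes (prev :: old)) (spot x y) first, trace (spot x y) first `<=` boxed b,
     last (spot x y) (map fst first) = spot x' y' & pmap snd first = map inord ks0].
  have spot_ne : spot x y <> spot x' y'.
    move=> [/eqP e1 /eqP e2]; move: ne; rewrite -!(eqr_nat R).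
    by move: e1 e2; rewrite !(inj_eq (mulIf _)) // => -> ->.
  have single : leg_ok (spot x y) (spot x' y') (None : option 'I_n) ->
    let s := [:: (spot x' y', None : option 'I_n)] in
    [/\ route (boxes (prev :: old)) (spot x y) s, trace (spot x y) s `<=` boxed b & last (spot x y) (map fst s) = spot x' y'].
    move=> ok /=; split=> //.
      by split=> // z /segm_boxed zb nz /(avoid z zb).
    by move=> z [/segm_boxed //|->]; apply: segm_boxed; apply: segmR.
  have pos (a : nat) : 0 <= a%:R / 16 :> R by rewrite divr_ge0.
  have low (a : nat) : (a < 16)%N -> a%:R / 16 < 1 :> R by rewrite -(ltr_nat R); lra.
  have low' (a : nat) : (a <= 16)%N -> a%:R / 16 <= 1 :> R by rewrite -(ler_nat R); lra.
  clear E' r1 r2 r3; subst ks0; case: h E hc hprev => -[? ?] /= hc hprev; subst x' y'.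
    have [y16|y16] := leqP y 16.
      have {hc y16}y16 : (y < 16)%N by move: hc y16; lia.
      have [|f1 f2 f3] := single; last by exists [:: (spot c y, None)].
      by apply: leg_low => //; rewrite pos ?low ?ltW ?low.
    move: hc; rewrite y16 ltnNge (ltnW y16) /= => /and4P [hx hc ne' al].
    have [k [ks' [a [-> pth /andP [a0 a1] hk e]]]] := crossed_run hx hc ne' al.
    have y1 : 1 < y%:R / 16 :> R by move: y16; rewrite -(ltr_nat R); lra.
    have [f1 f2 f3 f4] := run_route (x := x%:R / 16) y1 a0 a1 hk pth; rewrite e in f2 f3 f4.
    have f5 : trace (spot x y) (run (x < c)%N a (y%:R / 16) (k :: ks')) `<=` boxed b.
      move=> z /f2 [z2 z1]; rewrite /b /boxed /= minnn maxnn z2 lexx; split=> //.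
      by move: z1; case: ltnP => xc; rewrite ?(minn_idPl (ltnW xc)) ?(maxn_idPr (ltnW xc)) ?(minn_idPr xc) ?(maxn_idPl xc).
    exists (run (x < c)%N a (y%:R / 16) (k :: ks')); split=> //; last exact: pmap_run.
    apply: route_weaken f1 _ => z /f5 zb /(avoid z zb) -> _.
    by case: (x < c)%N => /=.
  have [|f1 f2 f3] := single; last by exists [:: (spot x c, None)].
  case/orP: hc => [hx|/andP [y16 c16]].
    apply: leg_vertical => //; first by move=> e; apply: spot_ne; rewrite /spot e.
    move=> i e; move/negP: hx; apply.
    have /eqP : x%:R = (i * 16)%:R :> R by rewrite natrM -e; lra.
    by rewrite eqr_nat => /eqP ->; rewrite modnMl.
  by apply: leg_low => //; rewrite pos ?low ?low'.
exists (first ++ legs); split.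
- apply: (@route_cat _ _ _ (boxes (b :: prev :: old))) => //.
  + by move=> z hz; apply/boxes_cons; right.
  + by move=> z /f2 hz; apply/boxes_cons; left.
  + by rewrite f3.
- by rewrite map_cat last_cat f3.
- by rewrite pmap_cat f4 r3 map_cat.
Qed.

End Polygons.

(** * Roots realized by explicit polygons *)

Section PolygonSound.
Variables (R : realType) (m : nat).
Local Notation n := m.+1.
Variables (Q : quiver n) (s0 : 'S_n) (par : nat -> nat).
Hypothesis tree : tree_diagram Q s0 par.
Variables (adj : nat -> seq nat) (ori : nat -> nat -> bool).
Hypothesis adjP : forall a, (a < n)%N -> uniq (adj a) /\ forall b, b \in adj a -> (b < n)%N.
Hypothesis nbE : forall a b, (a < n)%N -> (b < n)%N ->
  nb par (@inord m a) (@inord m b) = (b \in adj a).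
Hypothesis oriE : forall a b, (a < n)%N -> (b < n)%N ->
  arr Q s0 (@inord m a) (@inord m b) = ori a b :> nat.

(* [q]: the labels in the order of the marked points, the index of the first marked point, and the
   polygon. *)
Definition polygon_ok (w : seq nat) (q : seq nat * nat * seq nat) : bool :=
  let: (order, st, cs) := q in
  if [&& perm_eq order (iota 0 n), pairwise (fun a b => ~~ ori b a) order & (st < n)%N] then
    if walk m false (16 * st.+1) 16 (16 * st.+1, 16 * st.+1, 16, 16)%N [::] cs is Some ks then
      all (gtn n) ks &&
      (nclimb adj (unit_vec n (nth 0%N order st)) [seq nth 0%N order k | k <- ks] == Some w)
    else false
  else false.

Lemma polygon_realized w q : polygon_ok w q -> ltD 0 (vec s0 n (@inord m) w) ->
  realized R Q (@leD n) (vec s0 n (@inord m) w).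
Proof.
case: q => [[order st] cs]; rewrite /polygon_ok; case: and3P => // -[ord srt stn]; set x := (16 * st.+1)%N.
case E : walk => [ks|] // /andP [/allP ksn /eqP hcl] wpos.
have inord_inj a b : (a < n)%N -> (b < n)%N -> @inord m a = @inord m b -> a = b.
  by move=> an bn /(congr1 val); rewrite /= !inordK.
have uo : uniq order by rewrite (perm_uniq ord) iota_uniq.
have on a : a \in order = (a < n)%N by rewrite (perm_mem ord) mem_iota.
have so : size order = n by rewrite (perm_size ord) size_iota.
have nthn k : (nth 0%N order k < n)%N.
  by have [kn|kn] := ltnP k n; [rewrite -on mem_nth ?so | rewrite nth_default ?so].
have [||l1|p [hp pE]] := @full_order _ Q s0 (map (@inord m) order).
- by rewrite map_inj_in_uniq // => a b; rewrite !on; apply: inord_inj.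
- rewrite /arr_sorted pairwise_map; apply: (@sub_in_pairwise _ (mem order)) srt; last exact/allP.
  by move=> a b; rewrite !on => an bn /negbTE h /=; rewrite oriE // h.
- by rewrite -[l1]inord_val map_f // on.
have pk k : (k < n)%N -> p (inord k) = s0 (inord (nth 0%N order k)).
  move=> kn; have /(congr1 (fun l => nth (s0 ord0) l k)) := pE.
  rewrite (nth_map ord0) ?size_map ?so // (nth_map 0%N) ?so // => ->.
  rewrite (nth_map ord0) ?size_enum_ord // -[X in nth _ _ X](inordK kn) nth_ord_enum //.
have [|h1 h2] := nclimb_sound tree inord_inj adjP nbE _ hcl; first by move=> a /mapP [k _ ->].
rewrite vec_unit // in h1 h2.
have stE : simple_root (p (inord st)) = root_at s0 (inord (nth 0%N order st)) by rewrite pk.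
have ksE : map p (map inord ks) = map s0 (map inord [seq nth 0%N order k | k <- ks]).
  by rewrite -!map_comp; apply/eq_in_map => k /ksn kn /=; rewrite pk.
have [|legs [r1 r2 r3]] := @walk_route R m _ _ _ _ _ _ _ E.
  by move=> z [_ /andP [z1 z2]]; apply/eqP; rewrite eq_le z1 z2.
have spotE : spot R x 16 = marked_point R (@inord m st).
  by rewrite /spot /marked_point inordK // /x natrM; apply: pt_eq => /=; lra.
rewrite spotE in r1 r2.
have [gamma [g1 g2 g3]] := route_curve (route_sub (sub0set _) r1) r2.
exists p => //; exists gamma; split=> //.
  exists (inord st), (map inord ks); split; first by rewrite -r3.
  by apply: climbP; rewrite stE ksE.
exists (inord st), (map inord ks); split; first by rewrite -r3.
by rewrite reflected_rootE stE ksE h2; split=> //; left.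
Qed.

End PolygonSound.

(** * Types E6 and E7 *)

Section TypeE.
Local Open Scope nat_scope.
Variable k : nat.

Definition parE (a : nat) : nat := if a == k.-1 then 2 else a.-1.

(** The decreasing order of the neighbours matters to the search: it fixes the order in which
    [spread] visits them. *)
Definition adjE (a : nat) : seq nat :=
  [seq b <- rev (iota 0 k) | ((0 < b) && (a == parE b)) || ((0 < a) && (b == parE a))].

(* [nth false bs b]: the edge between [parE b] and [b] is oriented towards [b]. *)
Definition orE (bs : seq bool) (a b : nat) : bool :=
  ((0 < b) && (a == parE b) && nth false bs b) || ((0 < a) && (b == parE a) && ~~ nth false bs a).

Fixpoint bitseqs l : seq (seq bool) :=
  if l is l'.+1 then [seq b :: bs | b <- [:: true; false], bs <- bitseqs l'] else [:: [::]].

Lemma mem_bitseqs bs : bs \in bitseqs (size bs).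
Proof.
elim: bs => //= b bs IH; rewrite cats0 mem_cat.
by case: b; rewrite (map_f _ IH) ?orbT.
Qed.

Definition raised (ws : seq (seq nat)) : seq (seq nat) :=
  undup (ws ++ [seq set_nth 0 w a (nth 0 w a).+1 | w <- ws, a <- [seq a <- iota 0 k | 2 * nth 0 w a + 1 == nsum adjE w a]]).

(** The roots of height at most l + 1. The highest roots of E6 and E7 have heights 11 and 17, which
    explains the values 10 and 16 of l below. *)
Definition root_list (l : nat) : seq (seq nat) := iter l raised [seq unit_vec k a | a <- iota 0 k].

(** A certificate of completeness: a list that contains the simple roots and is closed under raising
    contains all positive roots. *)
Definition closed_list (ws : seq (seq nat)) : bool :=
  all (fun w => all (fun a => (2 * nth 0 w a + 1 == nsum adjE w a) ==>
    (set_nth 0 w a (nth 0 w a).+1 \in ws)) (iota 0 k)) ws &&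
  all (fun a => unit_vec k a \in ws) (iota 0 k).

(** Coefficient 1 and pairing 2 - 1 = 1, the situation of [thin_step]. *)
Definition thin_at (w : seq nat) (a : nat) : bool := (nth 0 w a == 1) && (nsum adjE w a == 1).

(** Polygons are accepted for roots of full support only, as [type_E_realized] requires. The
    conditional spares call-by-value evaluation the polygons whenever a spiral exists. *)
Definition drawable (qs : seq (seq nat * nat * seq nat)) (w : seq nat) (bs : seq bool) : bool :=
  if has_spiral k adjE (orE bs) w then true else
  all (fun a => nth 0 w a != 0) (iota 0 k) && has (polygon_ok k.-1 adjE (orE bs) w) qs.

(* The first entry of an orientation is irrelevant. *)
Definition drawable_list (qs : seq (seq nat * nat * seq nat)) (ws : seq (seq nat)) : bool :=
  all (fun w => if has (thin_at w) (iota 0 k) then true else all (fun bs => drawable qs w (true :: bs)) (bitseqs k.-1)) ws.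

End TypeE.

(* Reflects a polygon with seven marked points in the line x = 4, except for the last leg, which
   still ends at the base point. *)
Definition mirror (q : seq nat * nat * seq nat) : seq nat * nat * seq nat :=
  let: (order, st, cs) := q in
  (rev order, 6 - st, [seq if odd a && (a.+1 < size cs) then 128 - nth 0 cs a else nth 0 cs a | a <- iota 0 (size cs)])%N.

(* Found by computer search.  Up to reversing all arrows, these realize the roots of E7 (for certain
   orientations only (1,2,3,3,2,1,1) and (1,2,3,2,2,1,1)) for which no spiral exists. *)
Definition polygons : seq (seq nat * nat * seq nat) := ([::
  ([:: 5; 4; 3; 6; 2; 1; 0], 6, [:: 15; 98; 21; 15; 15; 28; 20; 51; 15; 78; 18; 97; 12; 30; 18;
    49; 15; 33; 17; 31; 13; 81; 17; 79; 14; 50; 19; 29; 0; 0]);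
  ([:: 5; 4; 3; 0; 6; 2; 1], 0, [:: 15; 28; 20; 51; 14; 94; 18; 98; 15; 113; 19; 93; 15; 63; 20;
    114; 11; 30; 18; 49; 15; 33; 17; 31; 12; 97; 17; 95; 13; 50; 19; 29; 0; 0]);
  ([:: 1; 0; 5; 6; 4; 3; 2], 4, [:: 15; 92; 20; 115; 10; 14; 18; 65; 13; 94; 18; 113; 15; 97; 17;
    95; 12; 17; 17; 15; 11; 114; 19; 93; 14; 79; 21; 116; 0; 0]);
  ([:: 0; 5; 4; 3; 1; 6; 2], 2, [:: 15; 61; 19; 67; 14; 113; 17; 111; 15; 79; 18; 114; 13; 66; 18;
    62; 14; 15; 20; 115; 12; 65; 17; 63; 0; 0]);
  ([:: 3; 5; 4; 6; 2; 1; 0], 3, [:: 15; 77; 19; 113; 10; 14; 18; 49; 13; 79; 17; 81; 12; 33; 17;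
    15; 11; 97; 18; 78; 14; 50; 19; 13; 0; 0]);
  ([:: 3; 0; 5; 4; 6; 2; 1], 5, [:: 13; 18; 18; 14; 10; 114; 19; 31; 15; 62; 18; 66; 15; 94; 18;
    113; 11; 15; 17; 17; 12; 97; 17; 95; 14; 65; 17; 63; 14; 19; 19; 13; 0; 0]);
  ([:: 3; 1; 0; 6; 2; 5; 4], 5, [:: 15; 110; 18; 114; 8; 14; 18; 18; 11; 82; 18; 78; 14; 31; 17;
    33; 15; 63; 19; 83; 10; 17; 17; 15; 9; 113; 17; 111; 14; 84; 20; 30; 13; 79; 17; 81; 12; 19;
    19; 13; 0; 0]);
  ([:: 3; 5; 4; 0; 1; 6; 2], 1, [:: 15; 46; 18; 50; 12; 18; 18; 14; 9; 114; 18; 79; 15; 111; 17;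
    113; 10; 15; 17; 17; 11; 63; 19; 115; 8; 13; 19; 19; 13; 49; 17; 47; 14; 20; 20; 12; 0; 0]);
  ([:: 4; 3; 5; 6; 2; 1; 0], 3, [:: 15; 77; 19; 113; 10; 13; 19; 50; 13; 79; 17; 81; 12; 15; 17;
    17; 15; 49; 18; 14; 11; 97; 18; 78; 14; 51; 20; 12; 0; 0]);
  ([:: 4; 3; 0; 5; 6; 2; 1], 5, [:: 13; 34; 19; 13; 10; 114; 19; 47; 15; 94; 18; 113; 11; 14; 18;
    33; 15; 17; 17; 15; 12; 97; 17; 95; 14; 35; 20; 12; 0; 0]);
  ([:: 1; 0; 6; 4; 5; 3; 2], 4, [:: 15; 66; 18; 62; 12; 94; 18; 114; 9; 15; 17; 17; 15; 47; 17;
    49; 10; 113; 17; 95; 11; 50; 18; 14; 8; 115; 19; 93; 13; 63; 17; 65; 14; 92; 20; 116; 0; 0]);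
  ([:: 4; 5; 0; 3; 1; 6; 2], 1, [:: 15; 18; 18; 14; 12; 62; 18; 66; 13; 114; 18; 79; 15; 111; 17;
    113; 14; 67; 19; 61; 13; 15; 17; 17; 14; 47; 20; 115; 12; 65; 17; 63; 0; 0]);
  ([:: 3; 4; 5; 6; 2; 1; 0], 3, [:: 15; 77; 19; 113; 10; 14; 18; 33; 13; 79; 17; 81; 12; 17; 17;
    15; 11; 97; 18; 78; 14; 49; 19; 13; 0; 0]);
  ([:: 0; 3; 4; 5; 6; 2; 1], 4, [:: 15; 93; 19; 114; 10; 15; 18; 49; 13; 95; 17; 97; 12; 33; 17;
    31; 11; 113; 18; 94; 14; 65; 19; 14; 0; 0]);
  ([:: 1; 0; 3; 4; 5; 6; 2], 5, [:: 15; 109; 19; 115; 10; 14; 18; 65; 13; 111; 17; 113; 12; 49;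
    17; 47; 15; 17; 17; 15; 11; 114; 18; 110; 14; 81; 19; 13; 0; 0]);
  ([:: 3; 4; 0; 1; 5; 6; 2], 1, [:: 15; 18; 18; 14; 11; 115; 20; 47; 15; 61; 19; 67; 15; 110; 18;
    114; 12; 15; 17; 17; 13; 63; 17; 65; 13; 113; 17; 111; 14; 66; 18; 62; 14; 33; 19; 13; 0; 0]);
  ([:: 5; 4; 6; 2; 1; 0; 3], 2, [:: 15; 61; 19; 114; 10; 14; 18; 33; 13; 63; 17; 65; 12; 17; 17;
    15; 11; 113; 17; 111; 15; 81; 18; 62; 14; 34; 19; 13; 0; 0]);
  ([:: 0; 5; 4; 6; 2; 1; 3], 4, [:: 14; 114; 19; 15; 15; 46; 18; 50; 15; 78; 18; 113; 15; 81; 17;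
    79; 14; 49; 17; 47; 0; 0]);
  ([:: 1; 0; 6; 2; 5; 4; 3], 4, [:: 15; 94; 18; 114; 12; 66; 18; 62; 14; 15; 17; 17; 15; 47; 19;
    67; 13; 113; 17; 95; 14; 68; 20; 14; 13; 63; 17; 65; 0; 0]);
  ([:: 5; 4; 0; 1; 6; 2; 3], 0, [:: 15; 30; 18; 34; 13; 114; 18; 63; 15; 95; 17; 113; 14; 47; 19;
    115; 12; 33; 17; 31; 0; 0]);
  ([:: 4; 5; 6; 2; 1; 0; 3], 2, [:: 15; 61; 19; 114; 12; 15; 17; 17; 13; 63; 17; 65; 14; 113; 17;
    111; 15; 81; 18; 62; 14; 33; 18; 14; 0; 0]);
  ([:: 0; 4; 5; 6; 2; 1; 3], 3, [:: 15; 77; 19; 114; 12; 15; 17; 33; 13; 79; 17; 81; 15; 113; 18;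
    78; 14; 49; 18; 14; 0; 0]);
  ([:: 1; 0; 4; 5; 6; 2; 3], 4, [:: 15; 93; 19; 114; 10; 14; 18; 49; 13; 95; 17; 97; 12; 17; 17;
    15; 11; 113; 18; 94; 14; 65; 19; 13; 0; 0]);
  ([:: 4; 0; 1; 5; 6; 2; 3], 0, [:: 11; 114; 20; 31; 15; 45; 19; 51; 15; 94; 18; 113; 12; 47; 17;
    49; 13; 97; 17; 95; 14; 50; 18; 46; 14; 17; 17; 15; 0; 0])])%N.

(** Reversing all arrows reverses the admissible orders, so mirror images serve the opposite
    orientations. *)
Definition all_polygons := polygons ++ map mirror polygons.

Lemma closed_E6 : closed_list 6 (root_list 6 10).
Proof. by vm_compute. Qed.

Lemma closed_E7 : closed_list 7 (root_list 7 16).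
Proof. by vm_compute. Qed.

Lemma drawable_E6 : drawable_list 6 [::] (root_list 6 10).
Proof. by vm_compute. Qed.

Lemma drawable_E7 : drawable_list 7 all_polygons (root_list 7 16).
Proof. by vm_compute. Qed.

Section TypeESound.
Variables (m : nat) (Q : quiver m.+1).
Hypothesis m3 : (2 < m)%N.
Local Notation n := m.+1.

Lemma type_E_tree : has_diagram Q (branch_edge n 2) -> exists s0, tree_diagram Q s0 (parE n).
Proof.
case=> s0 h; exists s0; rewrite /parE; split.
  by move=> j; case: eqP => [->|_] /=; lia.
move=> i j; rewrite /arr h /branch_edge /nb; congr nat_of_bool.
have := ltn_ord i; have := ltn_ord j; rewrite /=.
move: (nat_of_ord i) (nat_of_ord j) => a b.
by case: (eqVneq b m) => [->|hb]; case: (eqVneq a m) => [->|ha]; lia.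
Qed.

Variable s0 : 'S_n.
Hypothesis tree : tree_diagram Q s0 (parE n).
Local Notation e := (@inord m).
Local Notation root_at := (root_at s0).
Let adj := adjE n.
Let bits : seq bool := true :: [seq arr Q s0 (e (parE n b)) (e b) != 0%N | b <- iota 1 m].

Let nbE a b : (a < n)%N -> (b < n)%N -> nb (parE n) (e a) (e b) = (b \in adj a).
Proof.
move=> an bn; rewrite /nb !inordK // mem_filter mem_rev mem_iota /= bn andbT.
by [].
Qed.

Let adjP a : (a < n)%N -> uniq (adj a) /\ forall b, b \in adj a -> (b < n)%N.
Proof.
move=> an; split; first by rewrite filter_uniq // rev_uniq iota_uniq.
by move=> b; rewrite mem_filter mem_rev mem_iota => /andP [].
Qed.

Let ori_bits a b : (a < n)%N -> (b < n)%N -> arr Q s0 (e a) (e b) = orE n bits a b :> nat.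
Proof.
move=> an bn.
have bitE c : (0 < c < n)%N -> nth false bits c = (arr Q s0 (e (parE n c)) (e c) != 0%N).
  by case: c => // c /andP [_ cn]; rewrite /bits /= (nth_map 0%N) ?size_iota // nth_iota.
have par_lt c : (0 < c < n)%N -> (parE n c < c)%N := tree.1 c.
rewrite /orE; have [nab|nab] := boolP (nb (parE n) (e a) (e b)); last first.
  rewrite (arr0 tree nab); move: nab; rewrite /nb !inordK // negb_or.
  by move=> /andP [/negbTE -> /negbTE ->].
have := arr_dir tree nab; move: nab; rewrite /nb !inordK // => /orP [] /andP [h0 /eqP h].
  have hb : (0 < b < n)%N by rewrite h0.
  have lt := par_lt b hb; rewrite -h in lt.
  rewrite [X in _ || X](_ : _ = false); last first.
    by apply/negbTE/negP => /andP [/andP [a0 /eqP e1]]; have := par_lt a; rewrite a0 an -e1 => /(_ isT); lia.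
  by rewrite orbF bitE // -h h0 eqxx /=; case=> -[-> _].
have ha : (0 < a < n)%N by rewrite h0.
have lt := par_lt a ha; rewrite -h in lt.
rewrite [X in X || _](_ : _ = false); last first.
  by apply/negbTE/negP => /andP [/andP [b0 /eqP e1]]; have := par_lt b; rewrite b0 bn -e1 => /(_ isT); lia.
by rewrite /= bitE // -h h0 eqxx /=; case=> -[-> ->].
Qed.

Let inord_inj a b : (a < n)%N -> (b < n)%N -> e a = e b -> a = b.
Proof. by move=> an bn /(congr1 val); rewrite /= !inordK. Qed.

Local Notation vec := (vec s0 n e).

Lemma closed_roots ws : posdef Q -> closed_list n ws ->
  forall v, posroot Q v -> exists2 w, w \in ws & v = vec w.
Proof.
move=> pd /andP [/allP up /allP units]; apply: posroot_ind => // [i|v hv [i0 [pi vi]] IH].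
  pose i1 := (s0^-1)%g i; exists (unit_vec n i1); first by apply: units; rewrite mem_iota add0n ltn_ord.
  by rewrite (vec_unit s0) // inord_val /root_at permKV.
pose i := (s0^-1)%g i0; have ei : i0 = s0 i by rewrite permKV.
have [le ne] := sub_simple_root v i0.
have [w ws_w we] := IH _ (posroot_sub hv pi vi) le ne.
have pw : pair Q (vec w) (s0 (e i)) = -1.
  by rewrite -we pairD -scaleN1r pairZ pair_simple ei inord_val cartan_diag -ei pi.
rewrite (pair_vec tree inord_inj adjP nbE) // in pw.
exists (set_nth 0%N w i (nth 0%N w i).+1).
  have /allP /(_ (i : nat)) := up _ ws_w; rewrite mem_iota add0n ltn_ord => /(_ isT) /implyP; apply.
  by apply/eqP; move: pw; rewrite /adj; lia.
rewrite (vec_set s0) // -we inord_val /root_at -ei.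
by rewrite (_ : _ - _ = 1 :> int) ?scale1r ?subrK //; lia.
Qed.

(** A root drawn by a polygon offers nothing to continue from, but it has full support. Removing a
    thin vertex leaves a root without full support, so in the inductive step the smaller root always
    comes with an [okS] list. *)
Lemma type_E_realized (R : realType) ws qs : posdef Q -> closed_list n ws -> drawable_list n qs ws ->
  forall v, posroot Q v -> realized R Q (@leD n) v.
Proof.
move=> pd cl /allP dr.
suff main v : posroot Q v -> (exists s, okS Q s0 (parE n) (@leD n) s v) \/
    realized R Q (@leD n) v /\ forall i, v 0 i != 0.
  by move=> v hv; have [[s [hs _]]|[]//] := main v hv; exact: (ok_realized tree R hs).
move: v; apply: posroot_ind => // [i|v hv _ IH].
  left; exists [:: ((s0^-1)%g i)].
  by have := okS1 Q s0 (parE n) (@leD n) ((s0^-1)%g i); rewrite /root_at permKV.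
have [w ww ev] := closed_roots pd cl hv.
have vE a : (a < n)%N -> v 0 (s0 (e a)) = (nth 0%N w a)%:Z.
  by move=> an; rewrite ev (vec_e _ inord_inj).
have := dr _ ww; case: hasP => [[a]|_].
  rewrite mem_iota => /andP [_ an] /andP [/eqP wa /eqP pa] _.
  have pv : pair Q v (s0 (e a)) = 1 by rewrite ev (pair_vec tree inord_inj adjP nbE) // pa wa.
  have va : v 0 (s0 (e a)) = 1 by rewrite vE // wa.
  have [le ne] := sub_simple_root v (s0 (e a)).
  have [|[s hs]|[_ /(_ (s0 (e a)))]] := IH _ _ le ne; first by apply: posroot_sub; rewrite ?va.
    left; exists (join Q s0 s (e a)); apply: thin_step => // u x; exact: (ltD_up _ _).1.
  by rewrite sub_rootE va !eqxx.
have bs : bits = true :: behead bits by [].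
move=> /allP /(_ (behead bits)); rewrite -bs /drawable.
have -> : behead bits \in bitseqs n.-1.
  by have := mem_bitseqs (behead bits); rewrite /bits /= size_map size_iota.
move=> /(_ isT); case: ifP => [sp _|_ /andP [/allP full /hasP [q _ hq]]].
  left; have [s [hok sn sup]] := has_spiral_sound tree inord_inj adjP nbE ori_bits sp.
  exists (map e s); rewrite ev; split=> // x.
  by rewrite -[x]inord_val sup // (vec_e _ inord_inj).
right; split; last first.
  move=> i; have := full ((s0^-1)%g i : nat); rewrite mem_iota /= ltn_ord => /(_ isT) h.
  by rewrite -[i](permKV s0) -[(s0^-1)%g i]inord_val vE.
have := polygon_realized R tree adjP nbE ori_bits hq.
by rewrite -ev; apply; apply: posroot_ltD hv.
Qed.

End TypeESound.

(** The first component is the weight minus one, so every weight is positive. *)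
Lemma weighted_squares_eq0 (l : seq (nat * int)) :
  \sum_(x <- l) (x.1.+1)%:Z * x.2 ^+ 2 <= 0 -> all (fun x => x.2 == 0) l.
Proof.
have nn (x : nat * int) : 0 <= (x.1.+1)%:Z * x.2 ^+ 2 by rewrite mulr_ge0 ?sqr_ge0.
move=> h; have /eqP : \sum_(x <- l) (x.1.+1)%:Z * x.2 ^+ 2 = 0.
  by apply/eqP; rewrite eq_le h sumr_ge0.
rewrite psumr_eq0 // => /allP al; apply/allP => x /al /=.
by rewrite mulf_eq0 sqrf_eq0.
Qed.

(* Completing squares from the ends of the arms towards the branch vertex 2. *)
Lemma type_E6_posdef (Q : quiver 6) s0 : tree_diagram Q s0 (parE 6) -> posdef Q.
Proof.
move=> tree v v0; rewrite (form_label tree) ltNge; apply/negP.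
rewrite [X in _ - 2 * X]big_mkcond !big_nat_recr //= !big_geq // !add0r.
rewrite -[parE 6 1]/0%N -[parE 6 2]/1%N -[parE 6 3]/2%N -[parE 6 4]/3%N -[parE 6 5]/2%N.
move: (@coef_eq0 _ s0 v); move: (coef s0 v) => c c_eq0 h; apply: v0; apply: c_eq0.
(* This sum is six times the form; after the squares of the three arms, [c 2 ^+ 2] remains. *)
have /weighted_squares_eq0 /and5P [/eqP e1 /eqP e2 /eqP e3 /eqP e4 /and3P [/eqP e5 /eqP e6 _]] :
    \sum_(x <- [:: (2%N, 2 * c 0%N - c 1%N); (0%N, 3 * c 1%N - 2 * c 2%N); (2%N, 2 * c 4%N - c 3%N);
      (0%N, 3 * c 3%N - 2 * c 2%N); (2%N, 2 * c 5%N - c 2%N); (0%N, c 2%N)]) (x.1.+1)%:Z * x.2 ^+ 2 <= 0.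
  rewrite !big_cons big_nil /=.
  move: h; rewrite -(pmulr_rle0 _ (_ : 0 < 6)) //; apply: le_trans; rewrite le_eqVlt; apply/orP; left.
  by apply/eqP; ring.
by clear h; move: e1 e2 e3 e4 e5 e6 => /= e1 e2 e3 e4 e5 e6; case=> [|[|[|[|[|[|a]]]]]] // _; lia.
Qed.

Lemma type_E7_posdef (Q : quiver 7) s0 : tree_diagram Q s0 (parE 7) -> posdef Q.
Proof.
move=> tree v v0; rewrite (form_label tree) ltNge; apply/negP.
rewrite [X in _ - 2 * X]big_mkcond !big_nat_recr //= !big_geq // !add0r.
rewrite -[parE 7 1]/0%N -[parE 7 2]/1%N -[parE 7 3]/2%N -[parE 7 4]/3%N -[parE 7 5]/4%N -[parE 7 6]/2%N.
move: (@coef_eq0 _ s0 v); move: (coef s0 v) => c c_eq0 h; apply: v0; apply: c_eq0.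
(* This sum is twelve times the form; again [c 2 ^+ 2] remains after the squares of the arms. *)
have /weighted_squares_eq0 /and5P [/eqP e1 /eqP e2 /eqP e3 /eqP e4 /and4P [/eqP e5 /eqP e6 /eqP e7 _]] :
    \sum_(x <- [:: (5%N, 2 * c 0%N - c 1%N); (1%N, 3 * c 1%N - 2 * c 2%N); (5%N, 2 * c 5%N - c 4%N);
      (1%N, 3 * c 4%N - 2 * c 3%N); (0%N, 4 * c 3%N - 3 * c 2%N); (5%N, 2 * c 6%N - c 2%N); (0%N, c 2%N)])
      (x.1.+1)%:Z * x.2 ^+ 2 <= 0.
  rewrite !big_cons big_nil /=.
  move: h; rewrite -(pmulr_rle0 _ (_ : 0 < 12)) //; apply: le_trans; rewrite le_eqVlt; apply/orP; left.
  by apply/eqP; ring.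
by clear h; move: e1 e2 e3 e4 e5 e6 e7 => /= e1 e2 e3 e4 e5 e6 e7; case=> [|[|[|[|[|[|[|a]]]]]]] // _; lia.
Qed.

Lemma type_A_realized (R : realType) n (Q : quiver n) : type_A Q ->
  posdef Q /\ forall v, posroot Q v -> realized R Q (@ltD n) v.
Proof.
case: n Q => [|m] Q hA; first by case: hA.
split=> [|v hv]; first exact: type_A_posdef.
have [s0 [tree h]] := type_A_okS hA; have [s [hs _]] := h v hv.
exact: (ok_realized tree R hs hv).
Qed.

Lemma type_D_realized (R : realType) n (Q : quiver n) : type_D Q ->
  posdef Q /\ forall v, posroot Q v -> realized R Q (@leD n) v.
Proof.
case: n Q => [|[|[|m]]] Q hD; try by case: hD.
have m0 : (0 < m)%N by case: hD.
have [s0 tree] := type_D_tree m0 hD.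
split=> [|v hv]; first exact: (type_D_posdef m0 tree).
have [s [hs _]] := type_D_okS m0 tree hv.
exact: (ok_realized tree R hs hv).
Qed.

Lemma type_E6_realized (R : realType) n (Q : quiver n) : type_E6 Q ->
  posdef Q /\ forall v, posroot Q v -> realized R Q (@leD n) v.
Proof.
case=> en; subst n => hE; have [s0 tree] := type_E_tree (isT : (2 < 5)%N) hE.
have pd := type_E6_posdef tree.
by split=> //; exact: (type_E_realized (m := 5) isT tree R pd closed_E6 drawable_E6).
Qed.

Lemma type_E7_realized (R : realType) n (Q : quiver n) : type_E7 Q ->
  posdef Q /\ forall v, posroot Q v -> realized R Q (@leD n) v.
Proof.
case=> en; subst n => hE; have [s0 tree] := type_E_tree (isT : (2 < 6)%N) hE.
have pd := type_E7_posdef tree.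
by split=> //; exact: (type_E_realized (m := 6) isT tree R pd closed_E7 drawable_E7).
Qed.

(** * Representations *)

Section Families.
Variables (K : fieldType) (I : finType) (p q : I -> nat).

(** All entries of a family of matrices in one finite function, so that families form a vector space
    with a dimension. *)
Definition coords : Type := {ffun {i : I & ('I_(p i) * 'I_(q i))%type} -> K^o}.

HB.instance Definition _ := Vector.on coords.

Definition encode (f : forall i, 'M[K]_(p i, q i)) : coords :=
  [ffun t => f (tag t) (tagged t).1 (tagged t).2].

Definition decode (v : coords) (i : I) : 'M[K]_(p i, q i) :=
  \matrix_(x, y) v (Tagged (fun i => ('I_(p i) * 'I_(q i))%type) (x, y)).

Lemma encodeK f i : decode (encode f) i = f i.
Proof. by apply/matrixP => x y; rewrite mxE ffunE. Qed.

Lemma decodeK v : encode (decode v) = v.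
Proof. by apply/ffunP => -[i [x y]]; rewrite ffunE mxE. Qed.

Lemma decodeD a u v i : decode (a *: u + v) i = a *: decode u i + decode v i.
Proof. by apply/matrixP => x y; rewrite !mxE ffunE ffunE. Qed.

Lemma encodeD a f g : encode (fun i => a *: f i + g i) = a *: encode f + encode g.
Proof. by apply/ffunP => t; rewrite !ffunE !mxE. Qed.

Lemma eq_encode f g : (forall i, f i = g i) -> encode f = encode g.
Proof. by move=> h; apply/ffunP => t; rewrite !ffunE h. Qed.

Lemma dim_coords : (\dim {: coords} = \sum_i p i * q i)%N.
Proof.
rewrite dimvf /dim /= muln1 card_tagged sumnE big_map big_enum /=.
by apply: eq_bigr => i _; rewrite card_prod !card_ord.
Qed.

End Families.

(** * Hom and Ext from a two-term complex *)

Section Cochains.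
Variables (K : fieldType) (n : nat) (Q : quiver n).
Implicit Types (M N L X Y : qrep K Q) (i : 'I_n) (a : arrow Q).

Definition qarrows M N := forall a : arrow Q, 'M[K]_(qdim M (src a), qdim N (tgt a)).

Definition coboundary M N (f : qfamily M N) : qarrows M N :=
  fun a => qmap M a *m f (tgt a) - f (src a) *m qmap N a.

(* [Ext^1(M, N) = 0], computed as the cokernel of [coboundary]. *)
Definition noext M N : Prop :=
  forall h : qarrows M N, exists f : qfamily M N, forall a, h a = coboundary f a.

Local Notation C0 M N := (coords K (qdim M) (qdim N)).
Local Notation C1 M N :=
  (coords K (fun a : arrow Q => qdim M (src a)) (fun a : arrow Q => qdim N (tgt a))).

Definition coboundary_map M N (v : C0 M N) : C1 M N := encode (coboundary (decode v)).

Lemma coboundary_map_linear M N : linear (@coboundary_map M N).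
Proof.
move=> c u v; rewrite /coboundary_map -encodeD; apply: eq_encode => a.
rewrite /coboundary !decodeD !mulmxDr !mulmxDl -!scalemxAr -!scalemxAl scalerBr opprD.
by rewrite !addrA; congr (_ + _); rewrite -!addrA; congr (_ + _); rewrite addrC.
Qed.

HB.instance Definition _ M N :=
  GRing.isLinear.Build K (C0 M N) (C1 M N) *:%R (@coboundary_map M N) (@coboundary_map_linear M N).

Definition hom_space M N : {vspace C0 M N} := lker (linfun (@coboundary_map M N)).

Lemma mem_hom_space M N v : (v \in hom_space M N) <-> qhom (decode v).
Proof.
rewrite memv_ker lfunE; split=> [/eqP h a|h].
  apply/eqP; rewrite -subr_eq0; have := encodeK (coboundary (decode v)) a.
  rewrite -[encode _]/(coboundary_map v) h /coboundary => <-.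
  by apply/eqP/matrixP => x y; rewrite !mxE ffunE.
by apply/eqP/ffunP => t; rewrite !ffunE /coboundary h subrr mxE.
Qed.

Lemma qhom_mem M N (f : qfamily M N) : qhom f -> encode f \in hom_space M N.
Proof. by move=> hf; apply/mem_hom_space => a; rewrite !encodeK. Qed.

Definition euler M N : int :=
  (\sum_i qdim M i * qdim N i)%N%:Z - (\sum_(a : arrow Q) qdim M (src a) * qdim N (tgt a))%N%:Z.

(** Rank-nullity: the dimensions of kernel and cokernel of the coboundary differ by [euler M N]. *)
Lemma dim_hom_space M N : (\dim (hom_space M N))%:Z >= euler M N /\
  ((\dim (hom_space M N))%:Z <= euler M N <-> noext M N).
Proof.
have := limg_ker_dim (linfun (@coboundary_map M N)) fullv.
rewrite capfv dim_coords -/(hom_space M N).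
have := dimvS (subvf (limg (linfun (@coboundary_map M N)))); rewrite dim_coords /euler.
set L := limg _; set e1 := (\sum_(a : arrow Q) _)%N; set e0 := (\sum_i _)%N; set d := \dim (hom_space M N).
move=> le dd.
have -> : (d%:Z <= e0%:Z - e1%:Z) = (L == fullv).
  rewrite eqEdim subvf dim_coords /= -/e1; move: (\dim L) le dd; clearbody e0 e1 d => l le dd.
  by apply/idP/idP; lia.
split; first by move: (\dim L) le dd; clearbody e0 e1 d => l; lia.
split=> [/eqP full h|h].
  have : encode h \in L by rewrite full memvf.
  case/memv_imgP => v _; rewrite lfunE => ev; exists (decode v) => a.
  by rewrite -[LHS]encodeK ev encodeK.
apply/eqP/vspaceP => w; rewrite memvf; have [f hf] := h (decode w).
have -> : w = linfun (@coboundary_map M N) (encode f).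
  rewrite lfunE /= /coboundary_map -[LHS]decodeK; apply: eq_encode => a.
  by rewrite hf /coboundary !encodeK.
exact: memv_img (memvf _).
Qed.

End Cochains.

Section EulerForm.
Variables (K : fieldType) (n : nat) (Q : quiver n).

(** Without 2-cycles one of the two arrow counts is 0, which removes the absolute value. *)
Lemma cartan_arrows i j : cartan_mx Q i j =
  (if i == j then 2 else 0) - (arrows_between Q i j)%:Z - (arrows_between Q j i)%:Z.
Proof.
have none (x y : 'I_n) (a : arrow Q) : src a = x -> tgt a = y -> arrows_between Q y x = 0%N.
  move=> sx ty; apply: eq_card0 => b; rewrite !inE; apply/negP => /andP [/eqP sb /eqP tb].
  by have := no_2cycle a b; rewrite sx ty sb tb !eqxx.
have zero x y : arrows_between Q x y = 0%N \/ arrows_between Q y x = 0%N.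
  have [/card0_eq h|] := posnP (arrows_between Q x y); first by left; apply: eq_card0.
  by rewrite /arrows_between => /card_gt0P [a]; rewrite inE => /andP [/eqP sa /eqP ta]; right; apply: none sa ta.
rewrite !mxE; case: eqP => [->|_]; first by case: (zero j j) => ->; rewrite !subr0.
by case: (zero i j) => ->; rewrite ?subr0 ?sub0r ?normrN ger0_norm //; lia.
Qed.

Lemma sum_arrows (F : 'I_n -> 'I_n -> int) :
  \sum_(a : arrow Q) F (src a) (tgt a) = \sum_i \sum_j (arrows_between Q i j)%:Z * F i j.
Proof.
rewrite pair_big /= (partition_big (fun a : arrow Q => (src a, tgt a)) xpredT) //=.
apply: eq_bigr => -[i j] _ /=; rewrite /arrows_between.
rewrite (eq_bigr (fun=> F i j)); last by move=> a /eqP [-> ->].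
by rewrite sumr_const -mulr_natl natz; congr (Posz _ * _); apply: eq_card => a; rewrite !inE -pair_eqE.
Qed.

Lemma form_dim_vector (M : qrep K Q) : form Q (dim_vector M) (dim_vector M) = 2 * euler M M.
Proof.
pose d i : int := (qdim M i)%:Z.
have -> : euler M M = \sum_i d i * d i - \sum_(a : arrow Q) d (src a) * d (tgt a).
  by rewrite /euler !(big_morph Posz PoszD (erefl 0%:Z)); congr (_ - _); apply: eq_bigr.
rewrite (sum_arrows (fun i j => d i * d j)) /form mulrBr.
pose A i j := (arrows_between Q i j)%:Z * (d i * d j).
transitivity (\sum_i \sum_j ((if i == j then 2 else 0) * (d i * d j) - A i j - A j i)).
  apply: eq_bigr => i _; rewrite mxE /pair mulr_sumr; apply: eq_bigr => j _.
  by rewrite cartan_arrows [dim_vector M 0 j]mxE /A /d; ring.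
have -> : \sum_i \sum_j ((if i == j then 2 else 0) * (d i * d j) - A i j - A j i) =
   \sum_i \sum_j (if i == j then 2 else 0) * (d i * d j) - \sum_i \sum_j A i j - \sum_i \sum_j A j i.
  by rewrite -!sumrB; apply: eq_bigr => i _; rewrite -!sumrB.
rewrite [X in _ - _ - X]exchange_big /= -addrA -opprD; congr (_ - _); last by rewrite /A; ring.
rewrite mulr_sumr; apply: eq_bigr => i _; rewrite (bigD1 i) //= eqxx big1 ?addr0 // => j ji.
by rewrite eq_sym (negbTE ji) mul0r.
Qed.

End EulerForm.

(** * Idempotents and direct summands *)

Section Splitting.
Variables (K : fieldType) (n : nat) (Q : quiver n).
Implicit Types (M N L X Y : qrep K Q) (i : 'I_n) (a : arrow Q).

Definition comp M N L (f : qfamily M N) (g : qfamily N L) : qfamily M L := fun i => f i *m g i.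
Definition idf M : qfamily M M := fun i => 1%:M.

Lemma qhom_comp M N L (f : qfamily M N) (g : qfamily N L) : qhom f -> qhom g -> qhom (comp f g).
Proof. by move=> hf hg a; rewrite /comp mulmxA hf -mulmxA hg mulmxA. Qed.

Lemma qhom_id M : qhom (idf M).
Proof. by move=> a; rewrite mulmx1 mul1mx. Qed.

Lemma qhomB M N (f g : qfamily M N) : qhom f -> qhom g -> qhom (fun i => f i - g i).
Proof. by move=> hf hg a; rewrite mulmxBr mulmxBl hf hg. Qed.

Definition idempotent M (e : qfamily M M) : Prop := qhom e /\ forall i, e i *m e i = e i.

Lemma idempotentC M (e : qfamily M M) : idempotent e -> idempotent (fun i => 1%:M - e i).
Proof.
move=> [he ee]; split; first exact: qhomB (@qhom_id M) he.
by move=> i; rewrite mulmxBl mul1mx mulmxBr mulmx1 ee subrr subr0.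
Qed.

Lemma image_factor M (f : qfamily M M) : qhom f ->
  exists N (p : qfamily M N) (s : qfamily N M), [/\ qhom p, qhom s, forall i, p i *m s i = f i &
    forall i, [/\ row_full (p i), row_free (s i) & qdim N i = \rank (f i)]].
Proof.
move=> hf.
have [d [s [p [ps p1 s1 dE]]]] : exists (d : 'I_n -> nat) (s : forall i, 'M[K]_(d i, qdim M i))
   (p : forall i, 'M[K]_(qdim M i, d i)),
   [/\ forall i, p i *m s i = f i, forall i, row_full (p i), forall i, row_free (s i)
     & forall i, d i = \rank (f i)].
  exists (fun i => \rank (f i)), (fun i => row_base (f i)), (fun i => col_base (f i)).
  by split=> // i; [exact: mulmx_base | exact: col_base_full | exact: row_base_free].
have hs a : pinvmx (p (src a)) *m qmap M a *m p (tgt a) *m s (tgt a) = s (src a) *m qmap M a.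
  by rewrite -mulmxA ps -mulmxA hf -ps !mulmxA mulVpmx // mul1mx.
exists (@QRep K n Q d (fun a => pinvmx (p (src a)) *m qmap M a *m p (tgt a))), p, s.
split=> // a /=; apply: (row_free_inj (s1 (tgt a))).
by rewrite -[RHS]mulmxA hs -mulmxA ps mulmxA ps; exact: hf.
Qed.

Lemma split_idempotent M (e : qfamily M M) : idempotent e ->
  exists N (s : qfamily N M) (r : qfamily M N), [/\ qhom s, qhom r,
    forall i, s i *m r i = 1%:M & forall i, r i *m s i = e i].
Proof.
move=> [he ee]; have [N [r [s [hr hs rs h]]]] := image_factor he.
exists N, s, r; split=> // i; have [r1 s1 _] := h i.
apply: (row_free_inj s1); apply: (row_full_inj r1).
by rewrite mul1mx mulmxA mulmxA rs -mulmxA rs ee.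
Qed.

Lemma indecomposable_idempotent M : indecomposable M <->
  ~ qzero M /\ forall e : qfamily M M, idempotent e -> (forall i, e i = 0) \/ (forall i, e i = 1%:M).
Proof.
split=> -[nz h]; split=> //.
  move=> e he; have [N1 [s1 [r1 [hs1 hr1 sr1 rs1]]]] := split_idempotent he.
  have [N2 [s2 [r2 [hs2 hr2 sr2 rs2]]]] := split_idempotent (idempotentC he).
  have [|z|z] := h N1 N2.
  - exists (fun i => row_mx (r1 i) (r2 i)), (fun i => col_mx (s1 i) (s2 i)).
    have cross i : s1 i *m r2 i = 0 /\ s2 i *m r1 i = 0.
      have e1 : s1 i *m e i = s1 i by rewrite -rs1 mulmxA sr1 mul1mx.
      have e2 : e i *m r1 i = r1 i by rewrite -rs1 -mulmxA sr1 mulmx1.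
      have e3 : (1%:M - e i) *m r2 i = r2 i by rewrite -rs2 -mulmxA sr2 mulmx1.
      have e4 : s2 i *m (1%:M - e i) = s2 i by rewrite -rs2 mulmxA sr2 mul1mx.
      split; first by rewrite -e3 mulmxBl mul1mx mulmxBr mulmxA e1 subrr.
      by rewrite -e4 mulmxBr mulmx1 mulmxBl -mulmxA e2 subrr.
    split=> [a|a|i|i].
    + by rewrite /= mul_mx_row mul_row_block !mulmx0 addr0 add0r hr1 hr2.
    + apply: (etrans (mul_block_col (qmap N1 a) 0 0 (qmap N2 a) _ _)).
      by rewrite !mul0mx addr0 add0r hs1 hs2 mul_col_mx.
    + by rewrite mul_row_col rs1 rs2 addrC subrK.
    + by rewrite mul_col_row sr1 sr2 !(cross i).1 !(cross i).2 -scalar_mx_block.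
  - left=> i; rewrite -rs1; apply/matrixP => x y; rewrite !mxE big1 // => z0 _.
    by suff : (z0 < 0)%N by []; rewrite -(z i) ltn_ord.
  - right=> i; apply/esym/eqP; rewrite -subr_eq0 -rs2; apply/eqP.
    apply/matrixP => x y; rewrite !mxE big1 // => z0 _.
    by suff : (z0 < 0)%N by []; rewrite -(z i) ltn_ord.
move=> N1 N2 [f [g [hf hg fg gf]]].
(* The projection to the first summand, to be transported to M. *)
pose u i : 'M[K]_(qdim N1 i + qdim N2 i) := block_mx 1%:M 0 0 0.
have uu i : u i *m u i = u i by rewrite mulmx_block !mulmx0 !mul0mx !addr0 mulmx1.
have gufg i : g i *m (f i *m u i *m g i) *m f i = u i.
  by rewrite -!mulmxA gf mulmx1 mulmxA gf mul1mx.
have one0 d : 1%:M = 0 :> 'M[K]_d -> d = 0%N.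
  by case: d => // d /matrixP /(_ 0 0) /eqP; rewrite !mxE oner_eq0.
have [|e0|e1] := h (fun i => f i *m u i *m g i).
- have hu : @qhom K n Q (qsum N1 N2) (qsum N1 N2) u.
    by move=> a; rewrite /= !mulmx_block !mulmx0 !mul0mx !addr0 mulmx1 mul1mx.
  split; first exact: qhom_comp (qhom_comp hf hu) hg.
  by move=> i; rewrite -!mulmxA [g i *m _]mulmxA gf mul1mx [u i *m (u i *m _)]mulmxA uu.
- left=> i; have : u i = 0 by rewrite -(gufg i) e0 mulmx0 mul0mx.
  by rewrite /u -block_mx0 => /eq_block_mx [/one0].
right=> i; have : u i = 1%:M by rewrite -(gufg i) e1 mulmx1 gf.
by rewrite /u scalar_mx_block => /eq_block_mx [_ _ _ /esym /one0].
Qed.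

End Splitting.

(** * Indecomposable representations are bricks *)

Lemma sum_leq_eq (I : finType) (A B : I -> nat) : (forall i, A i <= B i)%N ->
  (\sum_i B i <= \sum_i A i)%N -> forall i, A i = B i.
Proof.
move=> le sum i; apply/eqP; rewrite eqn_leq le /=.
move: sum; rewrite (bigD1 i) //= [X in (_ <= X)%N](bigD1 i) //=.
have : (\sum_(j | j != i) A j <= \sum_(j | j != i) B j)%N by exact: leq_sum.
by set S := (\sum_(j | _) A j)%N; set T := (\sum_(j | _) B j)%N; lia.
Qed.

Section Bricks.
Variables (K : fieldType) (n : nat) (Q : quiver n).
Implicit Types (M N L X Y : qrep K Q) (i : 'I_n) (a : arrow Q).

Lemma kernel_factor M (f : qfamily M M) : qhom f ->
  exists N (u : qfamily N M), [/\ qhom u, forall i, row_free (u i), forall i, u i *m f i = 0,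
    forall i d (A : 'M[K]_(d, qdim M i)), A *m f i = 0 -> A *m pinvmx (u i) *m u i = A
    & forall i, qdim N i = (qdim M i - \rank (f i))%N].
Proof.
move=> hf.
have [d [u [u1 uf uk dE]]] : exists (d : 'I_n -> nat) (u : forall i, 'M[K]_(d i, qdim M i)),
   [/\ forall i, row_free (u i), forall i, u i *m f i = 0,
    forall i d (A : 'M[K]_(d, qdim M i)), A *m f i = 0 -> A *m pinvmx (u i) *m u i = A
    & forall i, d i = (qdim M i - \rank (f i))%N].
  exists (fun i => \rank (kermx (f i))), (fun i => row_base (kermx (f i))).
  split=> [i|i|i m A Af|i]; first exact: row_base_free.
  - by apply/eqP; rewrite -sub_kermx eq_row_base.
  - by apply: mulmxKpV; rewrite eq_row_base sub_kermx Af.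
  - exact: mxrank_ker.
exists (@QRep K n Q d (fun a => u (src a) *m qmap M a *m pinvmx (u (tgt a)))), u.
by split=> // a /=; apply: uk; rewrite -mulmxA hf mulmxA uf mul0mx.
Qed.

(** Path algebras are hereditary, so Ext^1 is right exact: a cochain on the subrepresentation M
    extends to N, and what bounds it there is restricted back along [j]. *)
Lemma noext_sub M N L (j : qfamily M N) : qhom j -> (forall i, row_free (j i)) -> noext N L -> noext M L.
Proof.
move=> hj j1 ext h; have [f hf] := ext (fun a => pinvmx (j (src a)) *m h a).
exists (comp j f) => a; rewrite /coboundary /comp mulmxA hj -!mulmxA -mulmxBr.
by have := hf a; rewrite /coboundary => <-; rewrite mulmxA mulmxVp // mul1mx.
Qed.

(* The pushout of [0 -> N -> M -> L -> 0] along [g] splits. *)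
Lemma extend_hom M N L X (u : qfamily N M) (p : qfamily M L) (g : qfamily N X) :
  qhom u -> qhom p -> qhom g -> (forall i, row_free (u i)) -> (forall i, row_full (p i)) ->
  (forall i, u i *m p i = 0) ->
  (forall i d (A : 'M[K]_(d, qdim M i)), A *m p i = 0 -> A *m pinvmx (u i) *m u i = A) ->
  noext L X -> exists r : qfamily M X, qhom r /\ forall i, u i *m r i = g i.
Proof.
move=> hu hp hg u1 p1 up uk ext.
have [s sp] : exists s : qfamily L M, forall i, s i *m p i = 1%:M.
  by exists (fun i => pinvmx (p i)) => i; exact: mulVpmx.
(* The cocycle of the extension, for the linear section [s]. Its image under [g] is a coboundary. *)
have [z zE] : exists z : qarrows L N, forall a,
    z a *m u (tgt a) = qmap L a *m s (tgt a) - s (src a) *m qmap M a.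
  exists (fun a => (qmap L a *m s (tgt a) - s (src a) *m qmap M a) *m pinvmx (u (tgt a))) => a.
  by apply: uk; rewrite mulmxBl -!mulmxA sp mulmx1 hp mulmxA sp mul1mx subrr.
have [f hf] := ext (fun a => z a *m g (tgt a)).
have [c cu] : exists c : qfamily M N, forall i, c i *m u i = 1%:M - p i *m s i.
  exists (fun i => (1%:M - p i *m s i) *m pinvmx (u i)) => i.
  by apply: uk; rewrite mulmxBl mul1mx -mulmxA sp mulmx1 subrr.
(* The map that is [g] on N and [f] on the linear complement given by [s]; bounding the cocycle
   makes it a homomorphism. *)
pose r i := c i *m g i + p i *m f i.
have ur i : u i *m r i = g i.
  have uc : u i *m c i = 1%:M.
    by apply: (row_free_inj (u1 i)); rewrite -mulmxA cu mulmxBr mulmx1 mulmxA up mul0mx subr0 mul1mx.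
  by rewrite mulmxDr !mulmxA uc mul1mx up mul0mx addr0.
have sr i : s i *m r i = f i.
  have sc : s i *m c i = 0.
    apply: (row_free_inj (u1 i)); rewrite -mulmxA cu mulmxBr mulmx1 mulmxA sp mul1mx subrr.
    by rewrite mul0mx.
  by rewrite mulmxDr !mulmxA sc mul0mx add0r sp mul1mx.
exists r; split=> // a.
have one : qmap M a = c (src a) *m u (src a) *m qmap M a + p (src a) *m s (src a) *m qmap M a.
  by rewrite cu -mulmxDl subrK mul1mx.
rewrite {1}one mulmxDl.
have -> : c (src a) *m u (src a) *m qmap M a *m r (tgt a) = c (src a) *m g (src a) *m qmap X a.
  by rewrite -[_ *m u _ *m _]mulmxA -hu -!mulmxA ur hg.
have -> : p (src a) *m s (src a) *m qmap M a *m r (tgt a) = p (src a) *m f (src a) *m qmap X a.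
  have e : s (src a) *m qmap M a *m r (tgt a) = f (src a) *m qmap X a.
    have -> : s (src a) *m qmap M a = qmap L a *m s (tgt a) - z a *m u (tgt a).
      by rewrite zE opprB addrC subrK.
    rewrite mulmxBl -!mulmxA sr ur; have := hf a; rewrite /coboundary => ->.
    by rewrite opprB addrC subrK.
  by rewrite -!mulmxA; congr (_ *m _); rewrite mulmxA e.
by rewrite -mulmxDl.
Qed.

Definition total_rank M N (f : qfamily M N) : nat := (\sum_i \rank (f i))%N.

Definition nonzero M N (f : qfamily M N) : Prop := exists i, f i != 0.

Lemma nonzeroPn M N (f : qfamily M N) : ~ nonzero f -> forall i, f i = 0.
Proof. by move=> h i; apply/eqP; apply: contraT => fi; case: h; exists i. Qed.

Lemma min_rank M N (P : qfamily M N -> Prop) : (exists f, P f) ->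
  exists2 f, P f & forall g, P g -> (total_rank f <= total_rank g)%N.
Proof.
move=> [f0 hf0]; have ex : exists r, `[< exists2 f, P f & total_rank f = r >].
  by exists (total_rank f0); apply/asboolP; exists f0.
case: (ex_minnP ex) => r /asboolP [f hf <-] h; exists f => // g hg.
by apply: h; apply/asboolP; exists g.
Qed.

Definition brick M : Prop :=
  forall f : qfamily M M, qhom f -> nonzero f -> forall i, f i \in unitmx.

Section MinimalEndomorphism.
Variables (M : qrep K Q) (f : qfamily M M).
Hypothesis idem : forall e : qfamily M M, idempotent e -> (forall i, e i = 0) \/ (forall i, e i = 1%:M).
Hypotheses (hf : qhom f) (f0 : nonzero f).
Hypothesis fmin : forall g : qfamily M M, qhom g -> nonzero g -> (total_rank f <= total_rank g)%N.

(** By minimality the square of f has the same rank as f, so f is invertible on its image, and the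
    image splits off through the idempotent p w s. This idempotent is nonzero, hence the identity;
    so f, and with it every nonzero endomorphism, has full rank. *)
Lemma min_rank_square : nonzero (comp f f) -> brick M.
Proof.
move=> ff; have [N [p [s [hp hs ps h]]]] := image_factor hf.
have rk : forall i, \rank (f i *m f i) = \rank (f i).
  by apply: sum_leq_eq => [i|]; [exact: mxrankM_maxl | exact: fmin (qhom_comp hf hf) ff].
have u i : s i *m p i \in unitmx.
  have [_ _ d] := h i; rewrite -row_free_unit /row_free eqn_leq rank_leq_row {1}d -rk -ps.
  by rewrite -mulmxA (leq_trans (mxrankM_maxr _ _)) // mulmxA mxrankM_maxl.
have [w wE] : exists w : qfamily N N, forall i, w i = invmx (s i *m p i) by exists (fun i => invmx (s i *m p i)).
have wl i : w i *m (s i *m p i) = 1%:M by rewrite wE mulVmx.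
have wr i : s i *m p i *m w i = 1%:M by rewrite wE mulmxV.
have hw : qhom w.
  move=> a; have hsp := qhom_comp hs hp a; rewrite /comp in hsp.
  by rewrite -[LHS]mul1mx -(wl (src a)) -[LHS]mulmxA [_ *m (qmap N a *m _)]mulmxA -hsp -[_ *m w _]mulmxA wr mulmx1.
have [|e0|e1] := idem (e := fun i => p i *m w i *m s i).
- split; first exact: qhom_comp (qhom_comp hp hw) hs.
  move=> i; rewrite -!mulmxA; congr (_ *m _); congr (_ *m _).
  by rewrite [p i *m (_ *m s i)]mulmxA [s i *m (_ *m _)]mulmxA [s i *m _]mulmxA wr mul1mx.
- case: f0 => i; rewrite -ps; suff -> : p i = 0 by rewrite mul0mx eqxx.
  by rewrite -[p i]mulmx1 -(wl i) !mulmxA e0 mul0mx.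
move=> g hg g0 i; rewrite -row_free_unit /row_free; apply/eqP.
move: i; apply: sum_leq_eq => [i|]; first exact: rank_leq_row.
apply: leq_trans (fmin hg g0); apply: leq_sum => i _; have [_ _ <-] := h i.
rewrite -[X in (X <= _)%N](mxrank1 K) -(e1 i) -mulmxA.
by apply: leq_trans (mxrankM_maxl _ _) (rank_leq_col _).
Qed.

(** The image I of f lies in its kernel L. Some indecomposable summand N of L contains a copy of I.
    If N had no self-extensions, then Ext(I, N) = 0, so the projection from L to N would extend to
    M, and N would be a proper summand of M. *)
Lemma min_rank_nilpotent : ~ nonzero (comp f f) ->
  (forall N, (\sum_i qdim N i < \sum_i qdim M i)%N -> indecomposable N -> noext N N) -> False.
Proof.
move=> /nonzeroPn ff IH; have [I [p [s [hp hs ps h]]]] := image_factor hf.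
have [L [u [hu u1 uf uk dL]]] := kernel_factor hf.
have sf i : s i *m f i = 0.
  have [p1 _ _] := h i; apply: (row_full_inj p1).
  by rewrite mulmxA ps mulmx0; exact: ff.
have up i : u i *m p i = 0.
  have [_ s1 _] := h i; apply: (row_free_inj s1).
  by rewrite -mulmxA ps uf mul0mx.
have s0 : nonzero s.
  apply: contrapT => /nonzeroPn z; case: f0 => i; by rewrite -ps z mulmx0 eqxx.
have [t [tE ht]] : exists t : qfamily I L, (forall i, t i *m u i = s i) /\ qhom t.
  have [t tE] : exists t : qfamily I L, forall i, t i *m u i = s i.
    by exists (fun i => s i *m pinvmx (u i)) => i; apply: uk.
  exists t; split=> // a; apply: (row_free_inj (u1 (tgt a))).
  by rewrite -!mulmxA tE hs -tE -mulmxA -hu mulmxA.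
(* A summand of L of minimal size among those in which I has a nonzero component. *)
have [|e [he te] emin] := @min_rank L L (fun e => idempotent e /\ nonzero (comp t e)).
  exists (idf L); split; first by split=> [|i]; [exact: qhom_id | rewrite mulmx1].
  by have [i si] := s0; exists i; apply: contraNneq si; rewrite /comp /idf mulmx1 -tE => ->; rewrite mul0mx.
have [N [v [r [hv hr vr rv]]]] := split_idempotent he.
have full (g : qfamily N N) : idempotent g -> nonzero (comp t (comp (comp r g) v)) -> forall i, g i = 1%:M.
  move=> [hg gg] nz; have gi : forall i, \rank (g i) = qdim N i.
    apply: sum_leq_eq => [i|]; first exact: rank_leq_row.
    apply: (@leq_trans (total_rank e)).
      apply: leq_sum => i _; rewrite -[X in (X <= _)%N](mxrank1 K) -(vr i) -[v i]mul1mx -(vr i) -!mulmxA.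
      by rewrite [r i *m (v i *m _)]mulmxA rv mulmxA (leq_trans (mxrankM_maxl _ _)) // mxrankM_maxr.
    apply: leq_trans (emin (comp (comp r g) v) _) _; last first.
      by apply: leq_sum => i _; rewrite /comp (leq_trans (mxrankM_maxl _ _)) // mxrankM_maxr.
    split=> //; split; first exact: qhom_comp (qhom_comp hr hg) hv.
    move=> i; rewrite /comp -!mulmxA [v i *m _]mulmxA vr mul1mx [g i *m (g i *m _)]mulmxA gg //.
  move=> i; have gu : row_free (g i) by rewrite /row_free gi.
  by apply: (row_free_inj gu); rewrite mul1mx gg.
have indN : indecomposable N.
  apply/indecomposable_idempotent; split.
    move=> z; case: te => i; rewrite /comp (_ : e i = 0) ?mulmx0 ?eqxx //.
    apply/eqP; rewrite -mxrank_eq0 -leqn0 -(z i) -rv.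
    by rewrite (leq_trans (mxrankM_maxl _ _)) // rank_leq_col.
  move=> g hg; have [/(full g hg)|/nonzeroPn z] := pselect (nonzero (comp t (comp (comp r g) v))); first by right.
  left=> i; have := full _ (idempotentC hg); rewrite /comp => h1.
  suff /h1 /(_ i) /eqP : nonzero (fun i => t i *m (r i *m (1%:M - g i) *m v i)).
    by rewrite -subr_eq0 addrC addrA addNr add0r oppr_eq0 => /eqP.
  have [x tx] := te; exists x; rewrite mulmxBr mulmx1 mulmxBl mulmxBr rv.
  by have := z x; rewrite /comp => ->; rewrite subr0.
have vf i : row_free (v i) by apply/row_freeP; exists (r i).
have NL i : (qdim N i <= qdim L i)%N := mulmx1_min (vr i).
have sizeN : (\sum_i qdim N i < \sum_i qdim M i)%N.
  rewrite ltnNge; apply/negP => le; have [x fx] := f0.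
  have NM i : (qdim N i <= qdim M i)%N by rewrite (leq_trans (NL i)) // dL leq_subr.
  have := sum_leq_eq NM le x; have := NL x; rewrite dL.
  have : (0 < \rank (f x))%N by rewrite lt0n mxrank_eq0.
  by have := rank_leq_row (f x); lia.
pose j := comp t r.
have hj : qhom j := qhom_comp ht hr.
(* I embeds into N: the composite from M through I, N and L back to M is a nonzero endomorphism, so
   its rank is at least that of f. *)
have jf i : row_free (j i).
  have nz : nonzero (comp p (comp j (comp v u))).
    apply: contrapT => /nonzeroPn z; have [x tx] := te.
    have [p1 _ _] := h x; move: tx; rewrite /comp -rv mulmxA.
    have -> : t x *m r x = 0; last by rewrite mul0mx eqxx.
    apply: (row_free_inj (vf x)); apply: (row_free_inj (u1 x)); apply: (row_full_inj p1).
    by have := z x; rewrite /comp !mul0mx mulmx0 !mulmxA.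
  have hjj := qhom_comp hp (qhom_comp hj (qhom_comp hv hu)).
  have [_ _ dI] := h i; rewrite /row_free; apply/eqP; apply: (etrans _ (esym dI)); move: i {dI}; apply: sum_leq_eq => [i|].
    by have [_ _ <-] := h i; exact: rank_leq_row.
  apply: leq_trans (fmin hjj nz) _; apply: leq_sum => i _.
  by rewrite /comp (leq_trans (mxrankM_maxr _ _)) // mxrankM_maxl.
have pk i d (A : 'M[K]_(d, qdim M i)) : A *m p i = 0 -> A *m pinvmx (u i) *m u i = A.
  by move=> Ap; apply: uk; rewrite -ps mulmxA Ap mul0mx.
have p1 i : row_full (p i) by case: (h i).
have [R [hR uR]] := extend_hom hu hp hr u1 p1 up pk (noext_sub hj jf (IH N sizeN indN)).
have [|E0|E1] := idem (e := comp R (comp v u)).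
- split; first exact: qhom_comp hR (qhom_comp hv hu).
  move=> i; rewrite /comp -!mulmxA; congr (_ *m _).
  by rewrite [u i *m (R i *m _)]mulmxA uR [r i *m _]mulmxA mulmxA [v i *m (r i *m v i)]mulmxA vr mul1mx.
- have [x] := te; rewrite /comp (_ : e x = 0) ?mulmx0 ?eqxx //.
  apply: (row_free_inj (u1 x)); rewrite mul0mx -rv -uR -!mulmxA.
  by have := E0 x; rewrite /comp => ->; rewrite mulmx0.
(* If the idempotent were the identity, f would vanish, because f kills L. *)
have [x] := f0; rewrite -[f x]mul1mx -(E1 x) /comp -!mulmxA uf !mulmx0 eqxx //.
Qed.

End MinimalEndomorphism.

Lemma indecomposable_brick M : indecomposable M ->
  (forall N, (\sum_i qdim N i < \sum_i qdim M i)%N -> indecomposable N -> noext N N) -> brick M.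
Proof.
move=> /indecomposable_idempotent [nz idem] IH.
have [|f [hf f0] fmin] := @min_rank M M (fun f => qhom f /\ nonzero f).
  exists (idf M); split; first exact: qhom_id.
  apply: contrapT => /nonzeroPn z; apply: nz => i.
  by have /(congr1 (fun A => \rank A)) := z i; rewrite mxrank1 mxrank0.
have fmin' (g : qfamily M M) : qhom g -> nonzero g -> (total_rank f <= total_rank g)%N.
  by move=> hg g0; exact: (fmin g (conj hg g0)).
have [ff|ff] := pselect (nonzero (comp f f)); first exact: (min_rank_square idem hf f0 fmin' ff).
by case: (min_rank_nilpotent idem hf f0 fmin' ff IH).
Qed.

End Bricks.

Section ClosedField.
Variables (K : closedFieldType) (n : nat) (Q : quiver n).
Hypothesis pd : posdef Q.
Implicit Types (M N : qrep K Q).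

(** Subtracting an eigenvalue taken at one vertex leaves an endomorphism that is not invertible
    there, hence zero. *)
Lemma brick_scalar M (f : qfamily M M) : brick M -> ~ qzero M -> qhom f ->
  exists c : K, forall i, f i = c%:M.
Proof.
move=> bM nz hf; have [i i0] : exists i, qdim M i != 0%N.
  by apply: contrapT => h; apply: nz => i; apply/eqP; apply: contraT => hi; case: h; exists i.
have : exists c, f i - c%:M \notin unitmx.
  have /closed_rootP [c] : size (char_poly (f i)) != 1%N by rewrite size_char_poly.
  rewrite -eigenvalue_root_char => ev; exists c.
  by rewrite -row_free_unit -kermx_eq0.
case=> c hc; exists c => j; apply/eqP; rewrite -subr_eq0; apply/eqP; move: j; apply: nonzeroPn => h.
case/negP: hc; apply: (bM (fun j => f j - c%:M) _ h).
by apply: qhomB => // a; rewrite mul_mx_scalar mul_scalar_mx.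
Qed.

Lemma brick_rigid M : brick M -> ~ qzero M -> noext M M /\ form Q (dim_vector M) (dim_vector M) = 2.
Proof.
move=> bM nz; have fE := form_dim_vector M.
have : \dim (hom_space M M) = 1%N.
  suff -> : hom_space M M = <[encode (idf M)]>%VS.
    rewrite dim_vline; case: eqP => // e0; case: nz => i.
    have /(congr1 (fun A => \rank A)) : idf M i = 0.
      by rewrite -[LHS](encodeK (idf M)) e0; apply/matrixP => x y; rewrite !mxE ffunE.
    by rewrite mxrank1 mxrank0.
  apply/eqP; rewrite eqEsubv; apply/andP; split; last first.
    by rewrite -memvE; apply: qhom_mem; exact: qhom_id.
  apply/subvP => v /mem_hom_space hv; have [c hc] := brick_scalar bM nz hv.
  apply/vlineP; exists c; rewrite -[LHS]decodeK; apply/ffunP => t.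
  by rewrite !ffunE hc /idf !mxE -[c *: _]/(c * _) mulr_natr.
have [h1 h2] := dim_hom_space M M => d1.
have : 0 < form Q (dim_vector M) (dim_vector M).
  apply: pd => /rowP v0; apply: nz => i; have := v0 i; rewrite !mxE; lia.
rewrite d1 in h1 h2; move: h1; rewrite fE => h1 h3.
have e1 : euler M M = 1 by lia.
by split; [apply/h2; rewrite e1 | rewrite e1].
Qed.

Lemma indecomposable_rigid M : indecomposable M ->
  noext M M /\ form Q (dim_vector M) (dim_vector M) = 2.
Proof.
have [m] := ubnP (\sum_i qdim M i); elim: m M => // m IH M hm ind.
apply: brick_rigid; last by case: ind.
by apply: indecomposable_brick => // N lt indN; case: (IH N _ indN) => //; apply: leq_trans lt _.
Qed.

End ClosedField.

(** * Rigid representations *)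

(* One arrow of a representation deformed by [H], which maps the corner [e] to the corner [1 - e]. *)
Section Corners.
Variables (K : fieldType) (d1 d2 : nat) (e1 f1 z1 : 'M[K]_d1) (e2 f2 z2 : 'M[K]_d2).
Variables (A H : 'M[K]_(d1, d2)).
Hypotheses (eA : A *m e2 = e1 *m A) (fA : A *m f2 = f1 *m A).
Hypotheses (eH : e1 *m H = H) (He : H *m e2 = 0) (fH : f1 *m H = 0) (Hf : H *m f2 = H).
Hypothesis hz : (A + H) *m z2 = z1 *m (A + H).

Let Az : A *m z2 = z1 *m A + z1 *m H - H *m z2.
Proof. by rewrite -mulmxDr -hz mulmxDl addrK. Qed.

(** Between f on the left and e on the right, both terms with H drop out of the endomorphism
    equation. *)
Lemma corner_lower : A *m (f2 *m z2 *m e2) = f1 *m z1 *m e1 *m A.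
Proof.
rewrite !mulmxA fA -[f1 *m A *m z2]mulmxA Az !mulmxBr !mulmxDr !mulmxBl !mulmxDl.
by rewrite !mulmxA fH !mul0mx subr0 -[_ *m H *m e2]mulmxA He mulmx0 addr0 -!mulmxA eA.
Qed.

Lemma corner_first : f2 *m z2 *m e2 = 0 -> A *m (e2 *m z2 *m e2) = e1 *m z1 *m e1 *m A.
Proof.
move=> low; have Hz : H *m z2 *m e2 = 0 by rewrite -{1}Hf -!mulmxA [f2 *m _]mulmxA low mulmx0.
rewrite !mulmxA eA -[e1 *m A *m z2]mulmxA Az !mulmxBr !mulmxDr !mulmxBl !mulmxDl.
by rewrite !mulmxA eH Hz subr0 -[_ *m H *m e2]mulmxA He mulmx0 addr0 -!mulmxA eA.
Qed.

Lemma corner_second : f1 *m z1 *m e1 = 0 -> A *m (f2 *m z2 *m f2) = f1 *m z1 *m f1 *m A.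
Proof.
move=> low; have zH : f1 *m z1 *m H = 0 by rewrite -{1}eH mulmxA low mul0mx.
rewrite !mulmxA fA -[f1 *m A *m z2]mulmxA Az !mulmxBr !mulmxDr !mulmxBl !mulmxDl.
by rewrite !mulmxA fH !mul0mx subr0 zH mul0mx addr0 -!mulmxA fA.
Qed.

Lemma corner_upper : z1 *m e1 = 0 -> f2 *m z2 = 0 -> A *m z2 = z1 *m A.
Proof.
move=> h1 h2; have zH : z1 *m H = 0 by rewrite -eH mulmxA h1 mul0mx.
have Hz : H *m z2 = 0 by rewrite -Hf -mulmxA h2 mulmx0.
by rewrite Az zH Hz addr0 subr0.
Qed.

(** The upper corner of the equation reads A (e z f) + H (f z f) = (e z f) A + (e z e) H. *)
Lemma corner_cobounds : e1 *m z1 *m e1 = e1 -> f2 *m z2 *m f2 = 0 ->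
  H = A *m (e2 *m z2 *m f2) - e1 *m z1 *m f1 *m A.
Proof.
move=> h1 h2; have zH : e1 *m z1 *m H = H by rewrite -{1}eH mulmxA h1 eH.
have Hz : H *m z2 *m f2 = 0 by rewrite -{1}Hf -!mulmxA [f2 *m _]mulmxA h2 mulmx0.
rewrite !mulmxA eA -[e1 *m A *m z2]mulmxA Az !mulmxBr !mulmxDr !mulmxBl !mulmxDl.
by rewrite !mulmxA eH zH Hz Hf subr0 -[_ *m A *m f2]mulmxA fA !mulmxA [X in X - _]addrC addrK.
Qed.

End Corners.

Section Deformation.
Variables (K : fieldType) (n : nat) (Q : quiver n) (d : 'I_n -> nat).
Local Notation V := (coords K d d).
Local Notation maps := (forall a : arrow Q, 'M[K]_(d (src a), d (tgt a))).
Implicit Types (A H : maps) (i : 'I_n) (a : arrow Q).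

Definition rep A : qrep K Q := @QRep K n Q d A.
Definition endo_space A : {vspace V} := hom_space (rep A) (rep A).

Definition sandwich (e f : forall i, 'M[K]_(d i)) (v : V) : V := encode (fun i => e i *m decode v i *m f i).

Lemma sandwich_linear e f : linear (sandwich e f).
Proof.
move=> c u v; rewrite /sandwich -encodeD; apply: eq_encode => i.
by rewrite decodeD mulmxDr mulmxDl -scalemxAr -scalemxAl.
Qed.

HB.instance Definition _ e f := GRing.isLinear.Build K V V *:%R (sandwich e f) (sandwich_linear e f).

Lemma mem_endo_space A v : (v \in endo_space A) <->
  forall a, A a *m decode v (tgt a) = decode v (src a) *m A a.
Proof. exact: (@mem_hom_space K n Q (rep A) (rep A) v). Qed.

Variables (A H : maps) (e f : forall i, 'M[K]_(d i)).
Hypothesis fE : forall i, f i = 1%:M - e i.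
Hypothesis he : @idempotent K n Q (rep A) e.
Hypothesis hH : forall a, e (src a) *m H a *m f (tgt a) = H a.

(* Grading endomorphisms by the corners of [e], the graded pieces of an endomorphism of the
   deformation are endomorphisms of [rep A], but the piece [e] does not occur. *)
Lemma deformation_endo : (\dim (endo_space A) <= \dim (endo_space (fun a => (A a + H a)%R)))%N ->
  exists g : forall i, 'M[K]_(d i), forall a, H a = A a *m g (tgt a) - g (src a) *m A a.
Proof.
move=> le; have [hom ee] := he.
have ef i : e i *m f i = 0 by rewrite fE mulmxBr mulmx1 ee subrr.
have fe i : f i *m e i = 0 by rewrite fE mulmxBl mul1mx ee subrr.
have ff i : f i *m f i = f i by rewrite {2}fE mulmxBr mulmx1 fe subr0.
have eA a : A a *m e (tgt a) = e (src a) *m A a := hom a.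
have fA a : A a *m f (tgt a) = f (src a) *m A a by rewrite !fE mulmxBr mulmxBl mulmx1 mul1mx eA.
have eH a : e (src a) *m H a = H a by rewrite -hH !mulmxA ee.
have He a : H a *m e (tgt a) = 0 by rewrite -hH -mulmxA fe mulmx0.
have fH a : f (src a) *m H a = 0 by rewrite -hH !mulmxA fe !mul0mx.
have Hf a : H a *m f (tgt a) = H a by rewrite -hH -mulmxA ff.
(* The lower corner and the diagonal part; what both annihilate is the upper corner. *)
pose p1 := linfun (sandwich f e); pose p2 := (linfun (sandwich e e) + linfun (sandwich f f))%R.
have p1E v i : decode (p1 v) i = f i *m decode v i *m e i by rewrite lfunE encodeK.
have p2E v i : decode (p2 v) i = e i *m decode v i *m e i + f i *m decode v i *m f i.
  rewrite lfunE /= !lfunE /= -[X in decode (X + _)]scale1r decodeD scale1r !encodeK //.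
pose U := endo_space (fun a => A a + H a).
pose U1 := (U :&: lker p1)%VS; pose U2 := (U1 :&: lker p2)%VS.
have dec0 i : decode (0 : V) i = 0 by apply/matrixP => x y; rewrite !mxE ffunE.
have low v : v \in lker p1 -> forall i, f i *m decode v i *m e i = 0.
  by rewrite memv_ker => /eqP h i; rewrite -p1E h dec0.
have mid v : v \in lker p2 -> forall i, e i *m decode v i *m e i = 0 /\ f i *m decode v i *m f i = 0.
  rewrite memv_ker => /eqP h i; have := p2E v i; rewrite h dec0 => /esym h0.
  split.
    have := congr1 (fun B => e i *m B *m e i) h0.
    by rewrite /= mulmxDr mulmxDl !mulmxA ee ef !mul0mx addr0 -mulmxA ee mulmx0 mul0mx.
  have := congr1 (fun B => f i *m B *m f i) h0.
  by rewrite /= mulmxDr mulmxDl !mulmxA ff fe !mul0mx add0r -mulmxA ff mulmx0 mul0mx.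
have F1 v : v \in U -> p1 v \in endo_space A.
  move=> /mem_endo_space hv; apply/mem_endo_space => a; rewrite !p1E.
  exact: (corner_lower (eA a) (fA a) (He a) (fH a) (hv a)).
have F2 v : v \in U1 -> p2 v \in endo_space A.
  rewrite memv_cap => /andP [/mem_endo_space hv /low lv]; apply/mem_endo_space => a; rewrite !p2E mulmxDr mulmxDl.
  by rewrite (corner_first (eA a) (eH a) (He a) (Hf a) (hv a)) // (corner_second (fA a) (eH a) (fH a) (hv a)).
have sum4 (B : forall i, 'M[K]_(d i)) i : B i = e i *m B i *m e i + f i *m B i *m e i + (e i *m B i *m f i + f i *m B i *m f i).
  have one : e i + f i = 1%:M by rewrite fE addrC subrK.
  by rewrite -!mulmxDl one !mul1mx -mulmxDr one mulmx1.
have F3 v : v \in U2 -> v \in endo_space A.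
  rewrite !memv_cap => /andP [/andP [/mem_endo_space hv /low lv] /mid mv]; apply/mem_endo_space => a.
  have upper i : decode v i = e i *m decode v i *m f i.
    by have [h1 h2] := mv i; rewrite {1}(sum4 (decode v) i) h1 h2 lv !add0r addr0.
  apply: (corner_upper (eH a) (Hf a) (hv a)).
    by rewrite upper -mulmxA fe mulmx0.
  by rewrite upper !mulmxA fe !mul0mx.
have p11 v : p1 (p1 v) = p1 v.
  by rewrite -[LHS]decodeK -[RHS]decodeK; apply: eq_encode => i; rewrite !p1E !mulmxA ff -!mulmxA ee.
have p12 v : p1 (p2 v) = 0.
  rewrite -[LHS]decodeK -[RHS]decodeK; apply: eq_encode => i.
  by rewrite p1E p2E dec0 mulmxDr mulmxDl !mulmxA fe !mul0mx add0r -!mulmxA fe !mulmx0.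
have p21 v : p2 (p1 v) = 0.
  rewrite -[LHS]decodeK -[RHS]decodeK; apply: eq_encode => i.
  by rewrite p2E p1E dec0 !mulmxA ef !mul0mx add0r -!mulmxA ef !mulmx0.
have p22 v : p2 (p2 v) = p2 v.
  rewrite -[LHS]decodeK -[RHS]decodeK; apply: eq_encode => i.
  rewrite !p2E !mulmxDr !mulmxDl !mulmxA ee ff ef fe !mul0mx addr0 add0r -!mulmxA ee ff.
  by [].
(* The sum of the graded pieces has the dimension of [U] and lies in the endomorphisms of [rep A];
   the hypothesis on dimensions makes the two equal. *)
pose W := (p1 @: U + p2 @: U1 + U2)%VS.
have dimW : \dim W = \dim U.
  have d1 : (p1 @: U :&: p2 @: U1 = 0)%VS.
    apply/eqP; rewrite -subv0; apply/subvP => x.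
    rewrite memv_cap memv0 => /andP [/memv_imgP [u _ ->] /memv_imgP [v _ e1]].
    by rewrite -p11 e1 p12.
  have d2 : ((p1 @: U + p2 @: U1) :&: U2 = 0)%VS.
    apply/eqP; rewrite -subv0; apply/subvP => x; rewrite memv0 3!memv_cap.
    move=> /andP [/memv_addP [_ /memv_imgP [u _ ->] [_ /memv_imgP [v _ ->] ->]] /andP [/andP [_ k1] k2]].
    move: k1 k2; rewrite !memv_ker !linearD /= p11 p12 p21 p22 addr0 add0r => /eqP -> /eqP ->.
    by rewrite addr0.
  rewrite -(limg_ker_dim p1 U) -/U1 -(limg_ker_dim p2 U1) -/U2 /W !dimv_disjoint_sum //.
  by rewrite addnC [in LHS]addnC; lia.
have WA : (W <= endo_space A)%VS.
  rewrite !subv_add; apply/andP; split; first (apply/andP; split).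
  - by apply/subvP => _ /memv_imgP [v vU ->]; apply: F1.
  - by apply/subvP => _ /memv_imgP [v vU ->]; apply: F2.
  - by apply/subvP.
have eA' : encode e \in endo_space A by apply/mem_endo_space => a; rewrite !encodeK.
have /eqP WE : W == endo_space A by rewrite eqEdim WA dimW.
(* Hence [e] itself is the diagonal part of an endomorphism v of the deformation, and the upper
   corner of v bounds [H]. *)
move: eA'; rewrite -WE => /memv_addP [x /memv_addP [_ /memv_imgP [u uU ->] [_ /memv_imgP [v vU ->] ->]] [z zU ez]].
have ve i : e i *m decode v i *m e i + f i *m decode v i *m f i = e i.
  have := congr1 (fun w => decode (p2 w) i) ez.
  have z0 : p2 z = 0 by move: zU; rewrite memv_cap [_ \in lker p2]memv_ker => /andP [_ /eqP].
  rewrite /= !linearD /= p21 p22 z0 add0r addr0 !p2E encodeK => <-.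
  by rewrite !ee -mulmxA ef mulmx0 addr0.
move: vU; rewrite memv_cap => /andP [/mem_endo_space hv _].
exists (fun i => e i *m decode v i *m f i) => a.
apply: (corner_cobounds (eA a) (fA a) (eH a) (Hf a) (hv a)).
  have := congr1 (fun B => e (src a) *m B *m e (src a)) (ve (src a)).
  by rewrite /= mulmxDr mulmxDl !mulmxA ee ef !mul0mx addr0 -mulmxA ee => ->.
have := congr1 (fun B => f (tgt a) *m B *m f (tgt a)) (ve (tgt a)).
by rewrite /= mulmxDr mulmxDl !mulmxA ff fe !mul0mx add0r -mulmxA ff => ->.
Qed.

End Deformation.

(** A linear section s fails to be a homomorphism by a cocycle; if h bounds the cocycle, s - h f is
    a homomorphism. *)
Lemma noext_exceptional (K : fieldType) n (Q : quiver n) (M : qrep K Q) : noext M M -> exceptional M.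
Proof.
move=> ext E f g [hf hg ex].
have [s sg] : exists s : qfamily M E, forall i, s i *m g i = 1%:M.
  by exists (fun i => pinvmx (g i)) => i; have [_ _ /mulVpmx] := ex i.
have [z zE] : exists z : qarrows M M, forall a,
    z a *m f (tgt a) = qmap M a *m s (tgt a) - s (src a) *m qmap E a.
  exists (fun a => (qmap M a *m s (tgt a) - s (src a) *m qmap E a) *m pinvmx (f (tgt a))) => a.
  have [_ fk _] := ex (tgt a); apply: mulmxKpV; rewrite fk sub_kermx mulmxBl -!mulmxA sg mulmx1 hg.
  by rewrite mulmxA sg mul1mx subrr.
have fg i : f i *m g i = 0.
  by have [_ fk _] := ex i; apply/eqP; rewrite -sub_kermx fk.
have [h hE] := ext z; exists (fun i => s i - h i *m f i); split=> [a|i]; last first.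
  by rewrite mulmxBl sg -mulmxA fg mulmx0 subr0.
have := zE a; rewrite hE /coboundary mulmxBl -[h _ *m _ *m f _]mulmxA hf mulmxBr mulmxBl !mulmxA.
set X := qmap M a *m h _ *m _; set Y := h _ *m f _ *m _; set P := qmap M a *m s _; set S := s _ *m _.
by move=> e; rewrite -[P](subrK S) -e addrAC [X - Y]addrC addrK addrC.
Qed.

(** * A representation without self-extensions for every root *)

Section Existence.
Variables (K : closedFieldType) (n : nat) (Q : quiver n) (d : 'I_n -> nat).
Hypothesis pd : posdef Q.
Local Notation maps := (forall a : arrow Q, 'M[K]_(d (src a), d (tgt a))).
Local Notation fam := (forall i, 'M[K]_(d i)).
Implicit Types (A H : maps) (i : 'I_n) (a : arrow Q).

Lemma minimal_endo : exists A : maps, forall B : maps, (\dim (endo_space A) <= \dim (endo_space B))%N.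
Proof.
pose A0 : maps := fun a => 0.
have ex : exists r, `[< exists A : maps, \dim (endo_space A) = r >].
  by exists (\dim (endo_space A0)); apply/asboolP; exists A0.
case: (ex_minnP ex) => r /asboolP [A <-] h; exists A => B.
by apply: h; apply/asboolP; exists B.
Qed.

Lemma idempotent_rank_lt (e g : fam) : (forall i, g i *m g i = g i) -> (forall i, g i *m e i = g i) -> (forall i, e i *m g i = g i) ->
  (exists i, g i != e i) -> (\sum_i \rank (g i) < \sum_i \rank (e i))%N.
Proof.
move=> gg ge eg [i ne]; have le j : (\rank (g j) <= \rank (e j))%N by rewrite -ge mxrankM_maxr.
rewrite ltnNge; apply/negP => /(sum_leq_eq le) /(_ i) eqr.
have sub : (g i <= e i)%MS by apply/submxP; exists (g i); rewrite ge.
have : (e i <= g i)%MS by rewrite -(mxrank_leqif_sup sub) eqr.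
case/submxP => B eB; case/eqP: ne.
by rewrite -[LHS]eg eB -mulmxA gg.
Qed.

Variable A : maps.
Hypothesis Amin : forall B : maps, (\dim (endo_space A) <= \dim (endo_space B))%N.
Local Notation M := (rep A).

Definition cobounds H : Prop :=
  exists g : fam, forall a, H a = A a *m g (tgt a) - g (src a) *m A a.

Lemma coboundsD H H1 H2 : (forall a, H a = H1 a + H2 a) -> cobounds H1 -> cobounds H2 -> cobounds H.
Proof.
move=> e [g1 h1] [g2 h2]; exists (fun i => g1 i + g2 i) => a.
by rewrite e h1 h2 mulmxDr mulmxDl opprD addrACA.
Qed.

(** Induction on the rank of e. If e is the sum of smaller orthogonal idempotents, the diagonal
    blocks of H are covered by induction and the mixed ones by minimality of A. If e is primitive,
    its image is indecomposable and has no self-extensions. *)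
Lemma cobounds_corner (e : fam) H : @idempotent K n Q M e ->
  (forall a, e (src a) *m H a *m e (tgt a) = H a) -> cobounds H.
Proof.
have [m] := ubnP (\sum_i \rank (e i)); elim: m e H => // m IH e H hm he hH.
have [[g [hg ge eg gne g0]]|prim] := pselect (exists g : fam, [/\ @idempotent K n Q M g,
   forall i, g i *m e i = g i, forall i, e i *m g i = g i, exists i, g i != e i & exists i, g i != 0]).
  have ee := he.2; have gg := hg.2; have {gne}lt := idempotent_rank_lt gg ge eg gne.
  have [g' g'E] : exists g' : fam, forall i, g' i = e i - g i by exists (fun i => e i - g i).
  have gg' i : g i *m g' i = 0 by rewrite g'E mulmxBr ge gg subrr.
  have g'g i : g' i *m g i = 0 by rewrite g'E mulmxBl eg gg subrr.
  have g'e i : g' i *m e i = g' i by rewrite g'E mulmxBl ee ge.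
  have eg' i : e i *m g' i = g' i by rewrite g'E mulmxBr ee eg.
  have g'g' i : g' i *m g' i = g' i by rewrite {1}g'E mulmxBl eg' gg' subr0.
  have hg' : @idempotent K n Q M g'.
    by split=> // a; have := qhomB he.1 hg.1 a; rewrite !g'E.
  have lt' : (\sum_i \rank (g' i) < \sum_i \rank (e i))%N.
    apply: idempotent_rank_lt => //; have [i gi] := g0; exists i.
    by rewrite g'E -subr_eq0 addrAC subrr sub0r oppr_eq0.
  have split4 a : H a = (g (src a) *m H a *m g (tgt a) + g' (src a) *m H a *m g' (tgt a))
      + (g (src a) *m H a *m g' (tgt a) + g' (src a) *m H a *m g (tgt a)).
    have eE i : e i = g i + g' i by rewrite g'E addrC subrK.
    by rewrite -[LHS]hH !eE !(mulmxDl, mulmxDr) -!addrA; congr (_ + _); rewrite [RHS]addrC addrA [X in X + _ = _]addrC.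
  (* A mixed block deforms A between complementary corners, and by minimality the deformation has no
     fewer endomorphisms. *)
  have cross (p q : fam) : @idempotent K n Q M p -> (forall i, p i *m q i = 0) -> (forall i, q i *m p i = 0) ->
      cobounds (fun a => p (src a) *m H a *m q (tgt a)).
    move=> hp pq qp; apply: (@deformation_endo _ _ _ _ _ _ p (fun i => 1%:M - p i)) => //.
    by move=> a; rewrite mulmxBr mulmx1 -!mulmxA qp !mulmx0 subr0 !mulmxA hp.2.
  apply: (coboundsD split4); apply: coboundsD; [by [] | | | by [] | exact: cross | exact: cross].
    apply: (IH g) => // [|a]; first exact: leq_trans lt _.
    by rewrite -!mulmxA gg !mulmxA gg.
  apply: (IH g') => // [|a]; first exact: leq_trans lt' _.
  by rewrite -!mulmxA g'g' !mulmxA g'g'.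
have [e0|/nonzeroPn e0] := pselect (@nonzero K n Q M M e); last first.
  exists (fun i => 0) => a; rewrite -hH; have := e0 (src a) => /= ->.
  by rewrite !mul0mx mulmx0 subrr.
have [N [s [r [hs hr sr rs]]]] := split_idempotent he.
have indN : indecomposable N.
  apply/indecomposable_idempotent; split=> [z|g [hg gg]].
    case: e0 => i; rewrite -rs; have : (\rank (r i *m s i) <= 0)%N.
      by rewrite -(z i) (leq_trans (mxrankM_maxl _ _)) // rank_leq_col.
    by rewrite leqn0 mxrank_eq0 => ->.
  have back i : s i *m (r i *m g i *m s i) *m r i = g i.
    by rewrite !mulmxA sr mul1mx -mulmxA sr mulmx1.
  have [g0|/nonzeroPn g0] := pselect (@nonzero K n Q M M (fun i => r i *m g i *m s i)); last first.
    by left=> i; rewrite -back g0 mulmx0 mul0mx.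
  right=> i; rewrite -back; suff -> : r i *m g i *m s i = e i by rewrite -rs mulmxA sr mul1mx sr.
  apply/eqP; apply: contraT => ne; case: prim; exists (fun i => r i *m g i *m s i); split=> //.
  - split; first exact: qhom_comp (qhom_comp hr hg) hs.
    by move=> j; rewrite -!mulmxA [s j *m _]mulmxA sr mul1mx [g j *m (g j *m _)]mulmxA gg.
  - by move=> j; rewrite -rs -!mulmxA [s j *m _]mulmxA sr mul1mx.
  - by move=> j; rewrite -rs !mulmxA -[r j *m s j *m r j]mulmxA sr mulmx1.
  - by exists i.
have [ext _] := indecomposable_rigid pd indN.
have [h hE] := ext (fun a => s (src a) *m H a *m r (tgt a)).
exists (fun i => r i *m h i *m s i) => a.
have -> : H a = r (src a) *m (s (src a) *m H a *m r (tgt a)) *m s (tgt a).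
  by rewrite !mulmxA rs -mulmxA rs hH.
rewrite hE /coboundary mulmxBr mulmxBl !mulmxA -hr /= -!mulmxA; congr (_ - _).
by rewrite hs.
Qed.

End Existence.

(** A nonzero idempotent e spans the endomorphisms, so 1 - e is a multiple of e; multiplied by 1 - e
    this gives 0. *)
Lemma dim_hom_space1 (K : fieldType) n (Q : quiver n) (M : qrep K Q) :
  \dim (hom_space M M) = 1%N -> ~ qzero M -> indecomposable M.
Proof.
move=> d1 nz; apply/indecomposable_idempotent; split=> // e he; have [hom ee] := he.
have [e0|/nonzeroPn e0] := pselect (nonzero e); last by left.
right=> i; apply/esym/eqP; rewrite -subr_eq0; apply/eqP.
have line : <[encode e]>%VS = hom_space M M.
  apply/eqP; rewrite eqEdim -memvE qhom_mem // d1 dim_vline lt0b.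
  have [x ex] := e0; apply: contraNneq ex => z; rewrite -(encodeK e) z.
  by apply/eqP/matrixP => y1 y2; rewrite !mxE ffunE.
have [hc cc] := idempotentC he; have := qhom_mem hc; rewrite -line => /vlineP [c ec].
rewrite -cc; have {1}-> : 1%:M - e i = c *: e i.
  rewrite -[LHS](encodeK (fun i => 1%:M - e i)) ec -[in RHS](encodeK e).
  by apply/matrixP => y1 y2; rewrite !mxE !ffunE.
by rewrite -scalemxAl mulmxBr mulmx1 ee subrr scaler0.
Qed.

Lemma real_Schur_rootsE (K : closedFieldType) n (Q : quiver n) : posdef Q ->
  real_Schur_roots K Q = [set v | posroot Q v].
Proof.
move=> pd; apply/seteqP; split=> [_ [M [ind _ ->]]|v [v0 v2]] /=.
  by have [_ h] := indecomposable_rigid pd ind; split=> // i; rewrite mxE.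
pose d i := absz (v 0 i).
have [A Amin] := @minimal_endo K n Q d.
have ext : noext (rep A) (rep A).
  (* For the identity idempotent the corner is the whole space of cochains. *)
  move=> h; have [||g hg] := @cobounds_corner K n Q d pd A Amin (fun i => 1%:M) h.
  - by split=> [a|i]; rewrite ?mulmx1 ?mul1mx.
  - by move=> a; rewrite mulmx1 mul1mx.
  by exists g.
have dv : dim_vector (rep A) = v.
  by apply/rowP => i; rewrite mxE /= /d; have := v0 i; lia.
have [h1 h2] := dim_hom_space (rep A) (rep A); have {}h2 := h2.2 ext.
have e1 : euler (rep A) (rep A) = 1 by have := form_dim_vector (rep A); rewrite dv v2; lia.
exists (rep A); split=> //; last exact: noext_exceptional.
apply: dim_hom_space1; first by apply/eqP; rewrite -eqz_nat eq_le; move: h1 h2; rewrite e1 => -> ->.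
move=> z; have [_ [i]] := posroot_ltD (conj v0 v2).
by rewrite -dv !mxE z.
Qed.

Lemma associated_roots_sub (R : realType) n (Q : quiver n) (G : 'S_n -> set (R -> R * R)) :
  \bigcup_(s in P_ Q) associated_roots Q s (G s) `<=` [set v | posroot Q v].
Proof. by move=> v [s _ [gamma _ /associated_root_posroot]]. Qed.

Lemma realized_nd (R : realType) n (Q : quiver n) v : realized R Q (@leD n) v ->
  (\bigcup_(s in P_ Q) associated_roots Q s (@Gamma_nd R n Q s)) v.
Proof. by move=> [p hp [gamma [h1 h2 h3 h4]]]; exists p => //; exists gamma. Qed.

Lemma realized_s (R : realType) n (Q : quiver n) v : realized R Q (@ltD n) v ->
  (\bigcup_(s in P_ Q) associated_roots Q s (@Gamma_s R n Q s)) v.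
Proof. by move=> [p hp [gamma [h1 h2 h3 h4]]]; exists p => //; exists gamma. Qed.

Lemma realizedW (R : realType) n (Q : quiver n) v : realized R Q (@ltD n) v -> realized R Q (@leD n) v.
Proof.
move=> [p hp [gamma [h1 h2 [k0 [ks [h3 h5]]] h4]]]; exists p => //; exists gamma; split=> //.
by exists k0, ks; split=> // i /h5 [].
Qed.

Theorem theorem1p3 (R : realType) (k : closedFieldType) (n : nat)
    (Q : quiver n)
    (hQ : type_A Q \/ type_D Q \/ type_E6 Q \/ type_E7 Q) :
  \bigcup_(s in P_ Q) associated_roots Q s (@Gamma_nd R n Q s)
    = real_Schur_roots k Q
  /\ (type_A Q ->
      \bigcup_(s in P_ Q) associated_roots Q s (@Gamma_s R n Q s)
        = real_Schur_roots k Q).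
Proof.
have [pd nd] : posdef Q /\ forall v, posroot Q v -> realized R Q (@leD n) v.
  case: hQ => [/(type_A_realized R) [pd h]|[/(type_D_realized R)|[/(type_E6_realized R)|/(type_E7_realized R)]]] //.
  by split=> // v /h /realizedW.
rewrite (real_Schur_rootsE k pd); split=> [|/(type_A_realized R) [_ h]].
  by apply/seteqP; split; [exact: associated_roots_sub | move=> v /nd /realized_nd].
by apply/seteqP; split; [exact: associated_roots_sub | move=> v /h /realized_s].
Qed.
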